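(* Let $(\mathcal{A},\mathcal{H},D;J)$ be a real spectral triple, possibly not fulfilling the first-order condition. Let $\mathcal{E}$ be a finite-projective right $\mathcal{A}$-module, equipped with a universal connection $\nabla:\mathcal{E}\to\mathcal{E}\otimes_{\mathcal{A}}\Omega^1(\mathcal{A})$. Then, as operators on $\mathcal{E}\otimes_{\mathcal{A}}\mathcal{H}\otimes_{\mathcal{A}}\overline{\mathcal{E}}$, $$(1\otimes_\nabla D)\otimes_{\overline\nabla}1 \;=\; 1\otimes_\nabla(D\otimes_{\overline\nabla}1).$$ Moreover, the triple $(\mathrm{End}_{\mathcal{A}}(\mathcal{E}),\ \mathcal{E}\otimes_{\mathcal{A}}\mathcal{H}\otimes_{\mathcal{A}}\overline{\mathcal{E}},\ D';J')$ is a real spectral triple, where $D'=(1\otimes_\nabla D)\otimes_{\overline\nabla}1$ and the real structure is given by $$J'(v_1\otimes\xi\otimes\overline{v_2})=v_2\otimes J\xi\otimes\overline{v_1}\qquad(v_1,v_2\in\mathcal{E},\ \xi\in\mathcal{H}).$$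
   Context: Real spectral triple (the first-order condition is not part of the definition): a unital involutive algebra $\mathcal{A}$ represented by bounded operators on a Hilbert space $\mathcal{H}$, a self-adjoint operator $D$ on $\mathcal{H}$ with compact resolvent such that each $a\in\mathcal{A}$ preserves $\mathrm{Dom}(D)$ and $[D,a]$ is bounded, and an antilinear isometry $J$ of $\mathcal{H}$ onto itself with $J^2=\pm1$, $JDJ^{-1}=\epsilon D$ for some $\epsilon\in\{\pm1\}$, and $[a,JbJ^{-1}]=0$ for all $a,b\in\mathcal{A}$. The first-order condition is $[[D,a],JbJ^{-1}]=0$ for all $a,b\in\mathcal{A}$; it is not assumed. For an operator $T$ put $T^\circ=JT^*J^{-1}$. $\mathcal{H}$ is an $\mathcal{A}$-bimodule with right action $\xi a=a^\circ\xi$. $\Omega^1(\mathcal{A})$ is the $\mathcal{A}$-bimodule of universal one-forms, spanned by $a\,\delta(b)$, where $\delta$ is the universal derivation ($\delta(ab)=\delta(a)b+a\delta(b)$, $\delta(1)=0$), with involution satisfying $\delta(a)^*=-\delta(a^* )$. A finite-projective right module is one isomorphic to $e\mathcal{A}^n$ for some $n$ and some idempotent $e\in M_n(\mathcal{A})$. A universal connection is a linear map $\nabla:\mathcal{E}\to\mathcal{E}\otimes_{\mathcal{A}}\Omega^1(\mathcal{A})$ with $\nabla(va)=\nabla(v)a+v\otimes\delta(a)$. The conjugate module $\overline{\mathcal{E}}$ is the left $\mathcal{A}$-module of symbols $\overline v$, $v\in\mathcal{E}$ (conjugate vector space), with $a\overline v=\overline{va^*}$. The induced conjugate left connection $\overline\nabla:\overline{\mathcal{E}}\to\Omega^1(\mathcal{A})\otimes_{\mathcal{A}}\overline{\mathcal{E}}$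 is $\overline\nabla(\overline v)=-\sum_i\omega_i^*\otimes\overline{v_i}$ if $\nabla(v)=\sum_i v_i\otimes\omega_i$; it satisfies $\overline\nabla(a\overline v)=a\overline\nabla(\overline v)+\delta(a)\otimes\overline v$. If $T$ is an operator on a space with a left $\mathcal{A}$-action, then $$(1\otimes_\nabla T)(v\otimes\eta)=\nabla_T(v)\eta+v\otimes T\eta,$$ where $\nabla_T(v)$ means that each universal one-form $a\,\delta(b)$ occurring in $\nabla(v)$ is represented as the operator $a[T,b]$ acting on $\eta$. If $T$ is an operator on a space with a right $\mathcal{A}$-action, write $R_a$ for the operator of right multiplication by $a$ (on $\mathcal{H}$, $R_a=a^\circ$; on $\mathcal{E}\otimes_{\mathcal{A}}\mathcal{H}$, $R_a=1\otimes a^\circ$). Then $$(T\otimes_{\overline\nabla}1)(\eta\otimes\overline v)=T\eta\otimes\overline v+\eta\,\overline\nabla_T(\overline v),$$ where each one-form $a\,\delta(b)$ occurring in $\overline\nabla(\overline v)$ acts on $\eta$ from the right as $\eta\mapsto[T,R_b]R_a\eta$. Thus $(1\otimes_\nabla D)\otimes_{\overline\nabla}1$ uses $T=1\otimes_\nabla D$ on $\mathcal{E}\otimes_{\mathcal{A}}\mathcal{H}$ in the second construction, and $1\otimes_\nabla(D\otimes_{\overline\nabla}1)$ uses $T=D\otimes_{\overline\nabla}1$ on $\mathcal{H}\otimes_{\mathcal{A}}\overline{\mathcal{E}}$ in the first. All these operators are defined on the natural domain obtained from $\mathrm{Dom}(D)$. The space $\mathcal{E}\otimes_{\mathcal{A}}\mathcal{H}\otimes_{\mathcal{A}}\overline{\mathcal{E}}$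 is identified with $\pi(e)\hat\pi(e)M_n(\mathcal{H})$, where $(\pi(a)\xi)_{ij}=\sum_k a_{ik}\xi_{kj}$ and $(\hat\pi(a)\xi)_{ij}=\sum_k Ja_{jk}J^{-1}\xi_{ik}$. $\mathrm{End}_{\mathcal{A}}(\mathcal{E})$ acts on the first tensor factor.
   Formalization: In the ''Moreover'' part, e is assumed self-adjoint (so End_A(E) has an involution), and self-adjointness of D' is claimed only for hermitian ∇; all other axioms hold for arbitrary ∇. Without these the claim is undefined or false. *)

(* Defs.v *)
From HB Require Import structures.
From mathcomp Require Import all_boot all_order all_algebra.
From mathcomp Require Import boolp classical_sets functions.

Set Implicit Arguments.
Unset Strict Implicit.
Unset Printing Implicit Defensive.

Import Order.TTheory GRing.Theory Num.Theory.

Local Open Scope ring_scope.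
Local Open Scope classical_set_scope.
Local Open Scope quotient_scope.

(* Unital C-algebras, the zero algebra included: it occurs as End_A(0), and
   MathComp's algType excludes it. *)
Record pzAlgType (C : pzRingType) := PzAlgType {
  pz_base : pzRingType;
  pz_scale : C -> pz_base -> pz_base;
  pz_scaleA : forall a b x, pz_scale a (pz_scale b x) = pz_scale (a * b) x;
  pz_scale1 : left_id 1 pz_scale;
  pz_scaleDr : right_distributive pz_scale +%R;
  pz_scaleDl : forall x, {morph pz_scale^~ x : a b / a + b};
  pz_scaleAl : forall k a b, pz_scale k (a * b) = pz_scale k a * b;
  pz_scaleAr : forall k a b, pz_scale k (a * b) = a * pz_scale k b }.

Definition pz_sort (C : pzRingType) (A : pzAlgType C) : Type := pz_base A.
Coercion pz_sort : pzAlgType >-> Sortclass.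

HB.instance Definition _ (C : pzRingType) (A : pzAlgType C) :=
  GRing.PzRing.copy (pz_sort A) (pz_base A).
HB.instance Definition _ (C : pzRingType) (A : pzAlgType C) :=
  GRing.Zmodule_isLmodule.Build C (pz_sort A)
    (@pz_scaleA C A) (@pz_scale1 C A) (@pz_scaleDr C A) (@pz_scaleDl C A).

(* [presented sc P] is the C-vector space generated by the symbols x : X, with
   the scalar k acting on symbols by [sc k], and universal among the maps
   g : X -> Y to C-vector spaces that satisfy the relations [P Y g]: two formal
   sums of symbols are identified iff all such maps identify them. *)
Section Presented.
Variables (C : pzRingType) (X : choiceType) (sc : C -> X -> X).
Variable P : forall Y : lmodType C, (X -> Y) -> Prop.

Definition respects (Y : lmodType C) (g : X -> Y) : Prop :=
  P g /\ forall k x, g (sc k x) = k *: g x.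

Definition pres_eq (s t : seq X) : bool :=
  `[< forall (Y : lmodType C) (g : X -> Y), respects g ->
        \sum_(x <- s) g x = \sum_(x <- t) g x >].

Lemma pres_eq_refl : reflexive pres_eq.
Proof. by move=> s; apply/asboolP. Qed.

Lemma pres_eq_sym : symmetric pres_eq.
Proof.
by move=> s t; apply/asboolP/asboolP => h Y g hg; rewrite (h Y g hg).
Qed.

Lemma pres_eq_trans : transitive pres_eq.
Proof.
move=> t s u /asboolP h1 /asboolP h2; apply/asboolP => Y g hg.
by rewrite (h1 Y g hg) (h2 Y g hg).
Qed.

Canonical pres_equiv := EquivRel pres_eq pres_eq_refl pres_eq_sym pres_eq_trans.

Definition presented := {eq_quot pres_equiv}.
HB.instance Definition _ := Choice.on presented.

Definition lift (T : nmodType) (g : X -> T) (z : presented) : T :=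
  \sum_(x <- repr z) g x.

Definition gen (x : X) : presented := \pi_presented [:: x].

Lemma lift_pi (Y : lmodType C) (g : X -> Y) s :
  respects g -> lift g (\pi_presented s) = \sum_(x <- s) g x.
Proof.
move=> hg; rewrite /lift.
have /asboolP h : pres_eq (repr (\pi_presented s)) s.
  by apply/eqmodP; rewrite reprK.
exact: h.
Qed.

Lemma lift_gen (Y : lmodType C) (g : X -> Y) x :
  respects g -> lift g (gen x) = g x.
Proof. by move=> hg; rewrite lift_pi // big_seq1. Qed.

Lemma presP (z w : presented) :
  (forall (Y : lmodType C) (g : X -> Y), respects g -> lift g z = lift g w) ->
  z = w.
Proof.
move=> h; rewrite -[z]reprK -[w]reprK; apply/eqmodP/asboolP => Y g hg.
exact: h.
Qed.

Definition pres_zero : presented := \pi_presented [::].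
Definition pres_add (z w : presented) : presented :=
  \pi_presented (repr z ++ repr w).
Definition pres_scale (k : C) (z : presented) : presented :=
  \pi_presented [seq sc k x | x <- repr z].
Definition pres_opp := pres_scale (- 1).

Lemma lift_zero (Y : lmodType C) (g : X -> Y) :
  respects g -> lift g pres_zero = 0.
Proof. by move=> hg; rewrite lift_pi // big_nil. Qed.

Lemma lift_add (Y : lmodType C) (g : X -> Y) z w :
  respects g -> lift g (pres_add z w) = lift g z + lift g w.
Proof. by move=> hg; rewrite lift_pi // big_cat. Qed.

Lemma lift_scale (Y : lmodType C) (g : X -> Y) k z :
  respects g -> lift g (pres_scale k z) = k *: lift g z.
Proof.
move=> hg; rewrite lift_pi // big_map scaler_sumr.
by apply: eq_bigr => x _; case: hg.
Qed.

Lemma pres_addA : associative pres_add.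
Proof. by move=> x y z; apply: presP => Y g hg; rewrite !lift_add // addrA. Qed.

Lemma pres_addC : commutative pres_add.
Proof. by move=> x y; apply: presP => Y g hg; rewrite !lift_add // addrC. Qed.

Lemma pres_add0 : left_id pres_zero pres_add.
Proof.
by move=> x; apply: presP => Y g hg; rewrite lift_add // lift_zero // add0r.
Qed.

Lemma pres_addN : left_inverse pres_zero pres_opp pres_add.
Proof.
move=> x; apply: presP => Y g hg.
by rewrite lift_add // lift_scale // lift_zero // scaleN1r addNr.
Qed.

HB.instance Definition _ :=
  GRing.isZmodule.Build presented pres_addA pres_addC pres_add0 pres_addN.

Lemma pres_scaleA a b z : pres_scale a (pres_scale b z) = pres_scale (a * b) z.
Proof.
by apply: presP => Y g hg; rewrite !lift_scale // scalerA.
Qed.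

Lemma pres_scale1 : left_id 1 pres_scale.
Proof. by move=> z; apply: presP => Y g hg; rewrite lift_scale // scale1r. Qed.

Lemma pres_scaleDr : right_distributive pres_scale +%R.
Proof.
move=> k x y; apply: presP => Y g hg.
by rewrite lift_scale // !lift_add // !lift_scale // scalerDr.
Qed.

Lemma pres_scaleDl z : {morph pres_scale^~ z : a b / a + b}.
Proof.
move=> a b; apply: presP => Y g hg.
by rewrite lift_add // !lift_scale // scalerDl.
Qed.

HB.instance Definition _ := GRing.Zmodule_isLmodule.Build C presented
  pres_scaleA pres_scale1 pres_scaleDr pres_scaleDl.

End Presented.

Section Tensor.
Variables (C : pzRingType) (A : Type) (E M : lmodType C).

Definition bilinear_map (Y : lmodType C) (f : E -> M -> Y) : Prop :=
  (forall m, linear (f^~ m)) /\ (forall v, linear (f v)).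

(* E (x)_A M, where A acts on E from the right by ra and on M from the left by
   la.  No axiom on ra and la is needed to form it. *)
Definition tens (ra : E -> A -> E) (la : A -> M -> M) : lmodType C :=
  @presented C (E * M)%type (fun k p => (k *: p.1, p.2))
    (fun Y g => bilinear_map (fun v m => g (v, m)) /\
       forall v a m, g (ra v a, m) = g (v, la a m)).

Variables (ra : E -> A -> E) (la : A -> M -> M).

Definition tensor (v : E) (m : M) : tens ra la := gen _ _ (v, m).

(* The map out of E (x)_A M induced by a balanced biadditive f, which has to be
   bilinear over C or antilinear in both variables (i.e. bilinear into the
   conjugate space): then tlift f does not depend on representatives. *)
Definition tlift (T : nmodType) (f : E -> M -> T) (x : tens ra la) : T :=
  lift (fun p => f p.1 p.2) x.

Lemma tlift_tensor (Y : lmodType C) (f : E -> M -> Y) v m :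
  bilinear_map f -> (forall v a m, f (ra v a) m = f v (la a m)) ->
  tlift f (tensor v m) = f v m.
Proof.
move=> [fl fr] fb; rewrite /tlift /tensor lift_gen //; split=> //=.
move=> k [x y] /=; have := fl y k x 0; rewrite addr0 => ->.
by have := fl y 1 0 0; rewrite !scale1r addr0 -[X in X = _]addr0 => /addrI <-;
   rewrite addr0.
Qed.

End Tensor.

Arguments tensor {C A E M ra la} v m.
Notation "v \ox m" := (tensor v m) (at level 40, left associativity).

Section Omega.
Variables (C : numClosedFieldType) (A : pzAlgType C).

(* The space of symbols a delta(b), bilinear in (a, b) and with delta(1) = 0.
   The Leibniz rule is what defines the right action omega_r below. *)
Definition omega : lmodType C :=
  @presented C (A * A)%type (fun k p => (k *: p.1, p.2))
    (fun Y g => bilinear_map (fun a b => g (a, b)) /\ forall a, g (a, 1) = 0).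

Definition form (a b : A) : omega := gen _ _ (a, b).
Definition olift (T : nmodType) (f : A -> A -> T) (w : omega) : T :=
  lift (fun p => f p.1 p.2) w.

Definition delta (a : A) : omega := form 1 a.
Definition omega_l (c : A) (w : omega) : omega :=
  olift (fun a b => form (c * a) b) w.
Definition omega_r (w : omega) (c : A) : omega :=
  olift (fun a b => form a (b * c) - form (a * b) c) w.

(* (a delta(b))^* = delta(b)^* a^* = - delta(b^* ) a^* *)
Definition omega_star (star : A -> A) (w : omega) : omega :=
  olift (fun a b => - omega_r (delta (star b)) (star a)) w.

End Omega.

Section Modules.
Variables (C : numClosedFieldType) (A : pzAlgType C).

Record rightModule := RightModule {
  rm_space :> lmodType C;
  ract : rm_space -> A -> rm_space;
  ract1 : forall v, ract v 1 = v;
  ractM : forall v a b, ract v (a * b) = ract (ract v a) b;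
  ract_linl : forall a, linear (ract^~ a);
  ract_linr : forall v, linear (ract v) }.

(* Linearity over C is automatic: k v = v (k 1). *)
Definition iso_onto_eAn (E : rightModule) n (e : 'M[A]_n)
    (phi : E -> 'cV[A]_n) : Prop :=
  [/\ forall v w, phi (v + w) = phi v + phi w,
      forall v a i, phi (ract v a) i 0 = phi v i 0 * a,
      injective phi &
      range phi = [set e *m x | x in [set: 'cV[A]_n]]].

Definition connection_target (E : rightModule) : lmodType C :=
  tens (@ract E) (@omega_l C A).

Definition universal_connection (E : rightModule)
    (nabla : E -> connection_target E) : Prop :=
  linear nabla /\
  forall v a, nabla (ract v a) =
    tlift (fun u w => u \ox omega_r w a) (nabla v) + v \ox delta a.

End Modules.

Section ConjugateSpace.
Variables (C : numClosedFieldType) (V : lmodType C).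

Definition conjv : Type := V.
HB.instance Definition _ := GRing.Zmodule.on conjv.

Definition conjv_scale (k : C) (v : conjv) : conjv := (k^* *: (v : V))%R.

Lemma conjv_scaleA a b z :
  conjv_scale a (conjv_scale b z) = conjv_scale (a * b) z.
Proof. by rewrite /conjv_scale scalerA rmorphM. Qed.

Lemma conjv_scale1 : left_id 1 conjv_scale.
Proof. by move=> z; rewrite /conjv_scale rmorph1 scale1r. Qed.

Lemma conjv_scaleDr : right_distributive conjv_scale +%R.
Proof. by move=> k x y; rewrite /conjv_scale scalerDr. Qed.

Lemma conjv_scaleDl z : {morph conjv_scale^~ z : a b / a + b}.
Proof. by move=> a b; rewrite /conjv_scale rmorphD scalerDl. Qed.

HB.instance Definition _ := GRing.Zmodule_isLmodule.Build C conjv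
  conjv_scaleA conjv_scale1 conjv_scaleDr conjv_scaleDl.

Definition bar (v : V) : conjv := v.

End ConjugateSpace.

Section ConjugateModule.
Variables (C : numClosedFieldType) (A : pzAlgType C) (star : A -> A).
Variable E : rightModule A.

Definition conj_act (a : A) (w : conjv E) : conjv E := bar (ract (w : E) (star a)).

Definition conj_connection (nabla : E -> connection_target E) (w : conjv E) :
    tens (@omega_r C A) conj_act :=
  tlift (fun u o => - (omega_star star o \ox bar u)) (nabla (w : E)).

End ConjugateModule.

(* The values of [app] outside of [dom] are irrelevant. *)
Record operator (H : Type) := Operator { dom : set H; app :> H -> H }.

Section Operators.
Variables (C : numClosedFieldType) (H : lmodType C).

Definition linear_operator (T : operator H) : Prop :=
  dom T 0 /\ forall k x y, dom T x -> dom T y ->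
    dom T (k *: x + y) /\ T (k *: x + y) = k *: T x + T y.

Definition commutator (T b : H -> H) (x : H) : H := T (b x) - b (T x).

Variable dot : H -> H -> C.

Definition hnorm (x : H) : C := sqrtC (dot x x).

Definition cvg_to (u : nat -> H) (l : H) : Prop :=
  forall eps : C, 0 < eps ->
    exists N : nat, forall m, (N <= m)%N -> hnorm (u m - l) < eps.

Definition cauchy_seq (u : nat -> H) : Prop :=
  forall eps : C, 0 < eps ->
    exists N : nat, forall m p, (N <= m)%N -> (N <= p)%N ->
      hnorm (u m - u p) < eps.

Definition hilbert : Prop :=
  (exists f : {dot H for Num.conj}, forall x y, dot x y = f x y) /\
  (forall u, cauchy_seq u -> exists l, cvg_to u l).

Definition bounded_operator (T : H -> H) : Prop :=
  linear T /\ exists M : C, forall x, hnorm (T x) <= M * hnorm x.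

Definition compact_operator (T : H -> H) : Prop :=
  linear T /\
  forall u : nat -> H, (exists M : C, forall m, hnorm (u m) <= M) ->
    exists (s : nat -> nat) (l : H),
      (forall m, (s m < s m.+1)%N) /\ cvg_to (fun m => T (u (s m))) l.

Definition densely_defined (D : operator H) : Prop :=
  forall (x : H) (eps : C), 0 < eps -> exists2 y, dom D y & hnorm (x - y) < eps.

(* The graph of the adjoint of D is the graph of D. *)
Definition self_adjoint (D : operator H) : Prop :=
  [/\ linear_operator D, densely_defined D &
      forall x y, (forall z, dom D z -> dot (D z) x = dot z y) <->
                  (dom D x /\ y = D x)].

Definition compact_resolvent (D : operator H) : Prop :=
  exists (k : C) (K : H -> H),
    [/\ compact_operator K,
        forall x, dom D (K x) /\ D (K x) - k *: K x = x &
        forall x, dom D x -> K (D x - k *: x) = x].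

Definition antilinear (J : H -> H) : Prop :=
  forall k x y, J (k *: x + y) = k^* *: J x + J y.

Definition inverse (J : H -> H) : H -> H := 'pinv_(fun=> 0) [set: H] J.

End Operators.

Section SpectralTriple.
Variables (C : numClosedFieldType) (A : pzAlgType C) (star : A -> A).
Variables (H : lmodType C) (dot : H -> H -> C) (act : A -> H -> H).
Variables (D : operator H) (J : H -> H).

Definition involution : Prop :=
  [/\ forall (k : C) a b, star (k *: a + b) = k^* *: star a + star b,
      forall a b, star (a * b) = star b * star a &
      forall a, star (star a) = a].

Definition star_representation : Prop :=
  [/\ forall a, bounded_operator dot (act a),
      forall x, linear (act^~ x),
      forall x, act 1 x = x,
      forall a b x, act (a * b) x = act a (act b x) &
      forall a x y, dot (act a x) y = dot x (act (star a) y)].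

Definition bounded_commutators : Prop :=
  forall a, (forall x, dom D x -> dom D (act a x)) /\
    exists M : C, forall x, dom D x ->
      hnorm dot (commutator D (act a) x) <= M * hnorm dot x.

Definition real_structure : Prop :=
  [/\ antilinear J,
      (forall x, hnorm dot (J x) = hnorm dot x) /\ (forall y, exists x, J x = y),
      exists s : bool, forall x, J (J x) = (-1) ^+ s *: x,
      exists s : bool, forall x, (dom D (inverse J x) <-> dom D x) /\
        (dom D x -> J (D (inverse J x)) = (-1) ^+ s *: D x) &
      forall a b x, act a (J (act b (inverse J x))) =
                    J (act b (inverse J (act a x)))].

(* Everything required of a real spectral triple, except that D is self-adjoint. *)
Definition real_triple_axioms : Prop :=
  [/\ involution, hilbert dot, star_representation &
      linear_operator D /\ densely_defined dot D] /\
  [/\ compact_resolvent dot D, bounded_commutators & real_structure].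

Definition real_spectral_triple : Prop :=
  real_triple_axioms /\ self_adjoint dot D.

(* The right action of A on H: x a = a^o x with a^o = J a^* J^-1. *)
Definition opp_act (x : H) (a : A) : H := J (act (star a) (inverse J x)).

End SpectralTriple.

Section Twist.
Variables (C : numClosedFieldType) (A : pzAlgType C) (star : A -> A).
Variables (E : rightModule A) (nabla : E -> connection_target E).
Variable M : lmodType C.

(* T' = 1 (x)_nabla T; the formula is required for every way of writing
   nabla(v) as a sum of u (x) a delta(b). *)
Definition is_one_tensor (la : A -> M -> M) (T : operator M)
    (T' : operator (tens (@ract C A E) la)) : Prop :=
  [/\ linear_operator T',
      dom T' = [set x | exists2 s : seq (E * M),
                  (forall p, p \in s -> dom T p.2) &
                  x = \sum_(p <- s) p.1 \ox p.2] &
      forall v y (s : seq (E * A * A)), dom T y ->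
        nabla v = \sum_(p <- s) p.1.1 \ox form p.1.2 p.2 ->
        T' (v \ox y) =
          \sum_(p <- s) p.1.1 \ox la p.1.2 (commutator T (la p.2) y)
          + v \ox T y].

(* T' = T (x)_nablabar 1; the form a delta(b) acts from the right as [T, R_b] R_a. *)
Definition is_tensor_one (ra : M -> A -> M) (T : operator M)
    (T' : operator (tens ra (@conj_act C A star E))) : Prop :=
  [/\ linear_operator T',
      dom T' = [set x | exists2 s : seq (M * conjv E),
                  (forall p, p \in s -> dom T p.1) &
                  x = \sum_(p <- s) p.1 \ox p.2] &
      forall y (w : conjv E) (s : seq (A * A * conjv E)), dom T y ->
        conj_connection star nabla w =
          \sum_(p <- s) form p.1.1 p.1.2 \ox p.2 ->
        T' (y \ox w) =
          T y \ox w
          + \sum_(p <- s) commutator T (ra^~ p.1.2) (ra y p.1.1) \ox p.2].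

End Twist.

Section Endomorphisms.
Variables (C : numClosedFieldType) (A : pzAlgType C) (E : rightModule A).

Definition is_endomorphism : {pred (E -> E)} :=
  fun f => `[< linear f /\ forall v a, f (ract v a) = ract (f v) a >].

Record endA := EndA { endA_fun :> E -> E; endA_prop : endA_fun \in is_endomorphism }.

HB.instance Definition _ := [isSub for endA_fun].
HB.instance Definition _ := [Choice of endA by <:].

Lemma ract0l (a : A) : ract (0 : E) a = 0.
Proof.
have := ract_linl (r:=E) a 1 0 0; rewrite !scale1r addr0 -[X in X = _]addr0.
by move=> /addrI.
Qed.

Lemma is_endomorphism_submod : submod_closed is_endomorphism.
Proof.
split; first apply/asboolP; first split.
- by move=> k x y; rewrite /= scaler0 addr0.
- by move=> v a; rewrite /= ract0l.
move=> k f g /asboolP [fl fa] /asboolP [gl ga]; apply/asboolP; split.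
- move=> c x y; rewrite /= !fctE fl gl !scalerDr !scalerA mulrC.
  by rewrite addrACA.
- by move=> v a; rewrite !fctE fa ga ract_linl.
Qed.

HB.instance Definition _ := GRing.isSubmodClosed.Build C (E -> E) is_endomorphism
  is_endomorphism_submod.
HB.instance Definition _ := [SubChoice_isSubLmodule of endA by <:].

Lemma endAP (S T : endA) : (forall v, S v = T v) -> S = T.
Proof. by move=> h; apply: val_inj; apply: funext. Qed.

Lemma endA_lin (S : endA) : linear S.
Proof. by case: S => f /= /asboolP []. Qed.

Lemma endA_ract (S : endA) v a : S (ract v a) = ract (S v) a.
Proof. by case: S => f /= /asboolP []. Qed.

Fact endA_one_subproof : (fun v : E => v) \in is_endomorphism.
Proof. by apply/asboolP. Qed.
Definition endA_one : endA := EndA endA_one_subproof.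

Fact endA_mul_subproof (S T : endA) : (fun v => S (T v)) \in is_endomorphism.
Proof.
apply/asboolP; split=> [k x y|v a]; first by rewrite !endA_lin.
by rewrite !endA_ract.
Qed.
Definition endA_mul (S T : endA) : endA := EndA (endA_mul_subproof S T).

Lemma endA_add (S : endA) v w : S (v + w) = S v + S w.
Proof. by have := endA_lin S 1 v w; rewrite !scale1r. Qed.

Lemma endA_scale (S : endA) k v : S (k *: v) = k *: S v.
Proof.
have S0 : S 0 = 0 by apply: (@addrI _ (S 0)); rewrite -endA_add !addr0.
by have := endA_lin S k v 0; rewrite S0 !addr0.
Qed.

Lemma endA_mulA : associative endA_mul.
Proof. by move=> S T U; apply: endAP. Qed.
Lemma endA_mul1l : left_id endA_one endA_mul.
Proof. by move=> S; apply: endAP. Qed.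
Lemma endA_mul1r : right_id endA_one endA_mul.
Proof. by move=> S; apply: endAP. Qed.
Lemma endA_mulDl : left_distributive endA_mul +%R.
Proof. by move=> S T U; apply: endAP. Qed.
Lemma endA_mulDr : right_distributive endA_mul +%R.
Proof. by move=> S T U; apply: endAP => v; exact: endA_add. Qed.

HB.instance Definition _ := GRing.Zmodule_isPzRing.Build endA
  endA_mulA endA_mul1l endA_mul1r endA_mulDl endA_mulDr.

Lemma endA_scaleAl (k : C) (S T : endA) : k *: (S * T) = (k *: S) * T.
Proof. by apply: endAP. Qed.
Lemma endA_scaleAr (k : C) (S T : endA) : k *: (S * T) = S * (k *: T).
Proof. by apply: endAP => v; exact/esym/endA_scale. Qed.

Definition endAlg : pzAlgType C :=
  @PzAlgType C endA *:%R (@scalerA C endA) (@scale1r C endA) (@scalerDr C endA)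
    (fun S a b => scalerDl S a b) endA_scaleAl endA_scaleAr.

Section Hermitian.
Variables (star : A -> A) (n : nat) (phi : E -> 'cV[A]_n).

(* The A-valued hermitian structure inherited from A^n. *)
Definition herm (v w : E) : A := \sum_(i < n) star (phi v i 0) * phi w i 0.

Definition endA_star (S : endA) : endA :=
  xget 0 [set T : endA | forall v w, herm (T v) w = herm v (S w)].

(* (v, nabla w) - (nabla v, w) = delta (v, w), where (v, u (x) o) = (v, u) o
   and (u (x) o, w) = o^* (u, w); the sign matches delta(a)^* = - delta(a^* ). *)
Definition hermitian_connection (nabla : E -> connection_target E) : Prop :=
  forall v w,
    tlift (fun u o => omega_l (herm v u) o) (nabla w)
    - tlift (fun u o => omega_r (omega_star star o) (herm u w)) (nabla v)
    = delta (herm v w).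

End Hermitian.
End Endomorphisms.

Section Triple.
Variables (C : numClosedFieldType) (A : pzAlgType C) (star : A -> A).
Variables (H : lmodType C) (dot : H -> H -> C) (act : A -> H -> H) (J : H -> H).
Variable E : rightModule A.

Definition EH : lmodType C := tens (@ract C A E) act.
Definition liftEH (T : nmodType) (f : E -> H -> T) (x : EH) : T :=
  tlift f (x : tens (@ract C A E) act).
Definition EH_r (x : EH) (a : A) : EH :=
  liftEH (fun v y => v \ox opp_act star act J y a) x.

Definition HE : lmodType C := tens (opp_act star act J) (@conj_act C A star E).
Definition HE_l (a : A) (x : HE) : HE :=
  tlift (fun y w => act a y \ox w)
    (x : tens (opp_act star act J) (@conj_act C A star E)).

Definition EHE : lmodType C := tens EH_r (@conj_act C A star E).
Definition EHE' : lmodType C := tens (@ract C A E) HE_l.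

Definition mk3 (v : E) (y : H) (w : E) : EHE := ((v \ox y) : EH) \ox bar w.

Definition lift3 (T : nmodType) (f : E -> H -> E -> T) (x : EHE) : T :=
  tlift (fun z (w : conjv E) => liftEH (fun v y => f v y w) z)
    (x : tens EH_r (@conj_act C A star E)).

Definition assoc : EHE -> EHE' :=
  lift3 (fun v y w => v \ox ((y \ox bar w) : HE)).

Definition same_operator (T : operator EHE) (T' : operator EHE') : Prop :=
  forall x, (dom T x <-> dom T' (assoc x)) /\ (dom T x -> assoc (T x) = T' (assoc x)).

Definition end_act (S : endA E) : EHE -> EHE :=
  lift3 (fun v y w => mk3 (S v) y w).

Definition is_J' (J' : EHE -> EHE) : Prop :=
  antilinear J' /\ forall v1 y v2, J' (mk3 v1 y v2) = mk3 v2 (J y) v1.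

Variables (n : nat) (phi : E -> 'cV[A]_n).

(* The (i, j) entry of the image of x under the identification of
   E (x) H (x) conj(E) with a subspace of M_n(H). *)
Definition entry (i j : 'I_n) : EHE -> H :=
  lift3 (fun v y w => act (phi v i 0) (J (act (phi w j 0) (inverse J y)))).

Definition dot3 (x y : EHE) : C :=
  \sum_(i < n) \sum_(j < n) dot (entry i j x) (entry i j y).

End Triple.

(* Main.v *)
(** Write nabla(v) = sum u (x) c delta(d) and nabla(w) = sum u' (x) c' delta(d').
    Both iterated twists send v (x) y (x) wbar to
      v (x) Dy (x) wbar + sum u (x) c [D,d] y (x) wbar
        + sum v (x) c'^ [D,d'^] y (x) ubar' + sum u (x) c c'^ [[D,d],d'^] y (x) ubar',
    where a^ = J a J^-1: since left and right actions commute,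
    [[D,d],d'^] = [[D,d'^],d].  The formula is symmetric under J', and all its
    terms but the one with Dy are bounded in y.  Through the coordinates in
    M_n(H), D' is thus a bounded perturbation of the compression of D by
    pi(e) pi^(e), which has bounded commutators with D.  Since the resolvent
    (D - z)^-1 has norm at most 1/|Im z|, its compression inverts D' - z up to an
    error of norm at most 1/2 when |Im z| is large, and a Neumann series yields a
    compact resolvent, whether or not D' is symmetric.  If nabla is hermitian, D'
    is symmetric; (D' - zbar)(D' - z)^-1 is then an isometry of the form
    1 + compact, hence surjective, and D' is self-adjoint. *)
From HB Require Import structures.
From mathcomp Require Import all_boot all_order all_algebra.
From mathcomp Require Import boolp classical_sets functions reals.
From mathcomp Require Import complex ring lra.
Require Import Defs.
Import Order.TTheory GRing.Theory Num.Theory.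
Local Open Scope ring_scope.

Set Implicit Arguments.
Unset Strict Implicit.
Unset Printing Implicit Defensive.

(** * Linear maps, tensor products and universal forms *)

(** D is unbounded, so y |-> [D,d] y and the twists make sense only for y in a domain, while maps
    out of a tensor product are induced by bilinear maps defined everywhere. Twists are therefore
    defined through a dual basis of E, by twisting each b_j against the j-th coordinate; the Leibniz
    rule of the connection makes the twist balanced over A, which recovers the prescribed value on
    every elementary tensor. This is done for an arbitrary operator T on an arbitrary module,
    because the second twist starts from 1 (x) D or D (x) 1 and not from D.

    On the analytic side the resolvent of D is known to be compact at one point z, possibly real.
    Once z is off the real axis, steps by half of the current imaginary part reach any height, using
    only the symmetry of D and a Neumann series. As D' may fail to be symmetric, injectivity of D' -
    z cannot be read off from Im z; it comes from comparing D' with D in coordinates, where D - z is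
    bounded below by |Im z|. *)

Section LinearFacts.
Variables (C : pzRingType) (U V : lmodType C) (f : U -> V).
Hypothesis hf : linear f.

Lemma linD : {morph f : x y / x + y}.
Proof. by move=> x y; have := hf 1 x y; rewrite !scale1r. Qed.
Lemma lin0 : f 0 = 0.
Proof. by apply: (@addrI _ (f 0)); rewrite -linD !addr0. Qed.
Lemma linZ k x : f (k *: x) = k *: f x.
Proof. by have := hf k x 0; rewrite lin0 !addr0. Qed.
Lemma linN x : f (- x) = - f x.
Proof. by rewrite -!scaleN1r linZ. Qed.
Lemma linB x y : f (x - y) = f x - f y.
Proof. by rewrite linD linN. Qed.
Lemma lin_sum (I : Type) (r : seq I) (P : pred I) (F : I -> U) :
  f (\sum_(i <- r | P i) F i) = \sum_(i <- r | P i) f (F i).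
Proof. exact: (big_morph f linD lin0). Qed.
End LinearFacts.

Section AntilinearFacts.
Variables (C : numClosedFieldType) (U V : lmodType C) (f : U -> V).
Hypothesis hf : forall k x y, f (k *: x + y) = k^* *: f x + f y.

(** Antilinearity into V is linearity into the conjugate space, which transfers the facts above. *)
Let hf' : linear (f : U -> conjv V).
Proof. exact: hf. Qed.

Lemma antiD : {morph f : x y / x + y}. Proof. exact: (linD hf'). Qed.
Lemma anti0 : f 0 = 0. Proof. exact: (lin0 hf'). Qed.
Lemma antiZ k x : f (k *: x) = k^* *: f x. Proof. exact: (linZ hf'). Qed.
Lemma antiB x y : f (x - y) = f x - f y. Proof. exact: (linB hf'). Qed.
Lemma anti_sum (I : Type) (r : seq I) (P : pred I) (F : I -> U) :
  f (\sum_(i <- r | P i) F i) = \sum_(i <- r | P i) f (F i).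
Proof. exact: (lin_sum hf'). Qed.
End AntilinearFacts.

Lemma additive0 (U V : zmodType) (f : U -> V) :
  {morph f : x y / x + y} -> f 0 = 0.
Proof. by move=> fD; apply: (@addrI _ (f 0)); rewrite -fD !addr0. Qed.

Lemma linear_id (C : pzRingType) (U : lmodType C) : linear (fun x : U => x).
Proof. by []. Qed.

Lemma linear_comp (C : pzRingType) (U V W : lmodType C) (f : V -> W) (g : U -> V) :
  linear f -> linear g -> linear (fun x => f (g x)).
Proof. by move=> hf hg k x y; rewrite hg hf. Qed.

Lemma linear_add (C : comPzRingType) (U V : lmodType C) (f g : U -> V) :
  linear f -> linear g -> linear (fun x => f x + g x).
Proof. by move=> hf hg k x y; rewrite hf hg scalerDr addrACA. Qed.

Lemma linear_opp (C : comPzRingType) (U V : lmodType C) (f : U -> V) :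
  linear f -> linear (fun x => - f x).
Proof. by move=> hf k x y; rewrite hf opprD scalerN. Qed.

Section PresentedFacts.
Variables (C : pzRingType) (X : choiceType) (sc : C -> X -> X).
Variable P : forall Y : lmodType C, (X -> Y) -> Prop.

Lemma lift_linear (Y : lmodType C) (g : X -> Y) :
  respects sc P g -> linear (lift (sc := sc) (P := P) g).
Proof.
move=> hg k x y; have := lift_add (pres_scale k x) y hg.
by rewrite lift_scale.
Qed.

Lemma pres_gen (z : presented sc P) : exists s, z = \sum_(x <- s) gen sc P x.
Proof.
exists (repr z); apply: presP => Y g hg.
rewrite (lin_sum (lift_linear hg)).
by under eq_bigr => x _ do rewrite lift_gen //.
Qed.
End PresentedFacts.

Section TensorFacts.
Variables (C : pzRingType) (A : Type) (E M : lmodType C).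
Variables (ra : E -> A -> E) (la : A -> M -> M).
Local Notation T := (tens ra la).

Lemma tens_respects (Y : lmodType C) (f : E -> M -> Y) :
  bilinear_map f -> (forall v a m, f (ra v a) m = f v (la a m)) ->
  respects (fun k p => (k *: p.1, p.2)) (fun Y g =>
     bilinear_map (fun v m => g (v, m)) /\
     forall v a m, g (ra v a, m) = g (v, la a m)) (fun p => f p.1 p.2).
Proof.
by move=> hf hb; split=> // k [v m] /=; rewrite (linZ (hf.1 m)).
Qed.

Lemma tlift_linear (Y : lmodType C) (f : E -> M -> Y) :
  bilinear_map f -> (forall v a m, f (ra v a) m = f v (la a m)) ->
  linear (tlift f : T -> Y).
Proof. by move=> hf hb; apply: lift_linear; exact: tens_respects. Qed.

Lemma tensor_linearl m : linear (fun v => v \ox m : T).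
Proof.
move=> k v w; apply: presP => Y g hg.
rewrite (lift_linear hg) /tensor !lift_gen //.
by case: hg => -[[hl _] _] _; rewrite hl.
Qed.

Lemma tensor_linearr v : linear (fun m => v \ox m : T).
Proof.
move=> k m p; apply: presP => Y g hg.
rewrite (lift_linear hg) /tensor !lift_gen //.
by case: hg => -[[_ hl] _] _; rewrite hl.
Qed.

Lemma tensor_balanced v a m : ra v a \ox m = v \ox la a m :> T.
Proof.
apply: presP => Y g hg; rewrite /tensor !lift_gen //.
by case: hg => -[_ hb] _; rewrite hb.
Qed.

Lemma tensP (x : T) : exists s : seq (E * M), x = \sum_(p <- s) p.1 \ox p.2.
Proof.
have [s ->] := pres_gen x; exists s; apply: eq_bigr => -[v m] _ //.
Qed.

Lemma tens_eq (Y : zmodType) (f g : T -> Y) :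
  {morph f : x y / x + y} -> {morph g : x y / x + y} ->
  (forall v m, f (v \ox m) = g (v \ox m)) -> forall x, f x = g x.
Proof.
move=> fD gD h x; have [s ->] := tensP x.
rewrite (big_morph f fD (additive0 fD)) (big_morph g gD (additive0 gD)).
by apply: eq_bigr => p _; apply: h.
Qed.
End TensorFacts.

Lemma tens_map_linear (C : pzRingType) (A' : Type) (E M E' M' : lmodType C)
  (ra' : E' -> A' -> E') (la' : A' -> M' -> M')
  (f : E -> E') (g : M -> M') :
  linear f -> linear g -> bilinear_map (fun v m => f v \ox g m : tens ra' la').
Proof.
move=> hf hg; split=> [m|v].
  exact: (linear_comp (tensor_linearl _ _ _) hf).
exact: (linear_comp (tensor_linearr _ _ _) hg).
Qed.

(** * Universal one-forms as a bimodule with involution *)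

Section OmegaFacts.
Variables (C : numClosedFieldType) (A : pzAlgType C).

Lemma pz_mulZl (k : C) (a b : A) : (k *: a) * b = k *: (a * b).
Proof. by rewrite [RHS](@pz_scaleAl _ A). Qed.
Lemma pz_mulZr (k : C) (a b : A) : a * (k *: b) = k *: (a * b).
Proof. by rewrite [RHS](@pz_scaleAr _ A). Qed.
Lemma pz_mul_linearl (b : A) : linear (fun a : A => a * b).
Proof. by move=> k x y; rewrite mulrDl pz_mulZl. Qed.
Lemma pz_mul_linearr (a : A) : linear (fun b : A => a * b).
Proof. by move=> k x y; rewrite mulrDr pz_mulZr. Qed.

Lemma omega_respects (Y : lmodType C) (f : A -> A -> Y) :
  bilinear_map f -> (forall a, f a 1 = 0) ->
  @respects C (A * A)%type (fun k p => (k *: p.1, p.2)) (fun Y g =>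
     bilinear_map (fun a b => g (a, b)) /\ forall a, g (a, 1) = 0) Y
    (fun p => f p.1 p.2).
Proof.
by move=> hf hb; split=> // k [v m] /=; rewrite (linZ (hf.1 m)).
Qed.

Lemma olift_linear (Y : lmodType C) (f : A -> A -> Y) :
  bilinear_map f -> (forall a, f a 1 = 0) -> linear (olift f : omega A -> Y).
Proof. by move=> hf hb; apply: lift_linear; exact: omega_respects. Qed.

Lemma olift_form (Y : lmodType C) (f : A -> A -> Y) :
  bilinear_map f -> (forall a, f a 1 = 0) ->
  forall a b, olift f (form a b) = f a b.
Proof.
by move=> hf hb a b; rewrite /olift /form lift_gen //; exact: omega_respects.
Qed.

Lemma form_linearl b : linear (fun a => form a b : omega A).
Proof.
move=> k v w; apply: presP => Y g hg.
rewrite (lift_linear hg) /form !lift_gen //.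
by case: hg => -[[hl _] _] _; rewrite hl.
Qed.
Lemma form_linearr a : linear (fun b => form a b : omega A).
Proof.
move=> k v w; apply: presP => Y g hg.
rewrite (lift_linear hg) /form !lift_gen //.
by case: hg => -[[_ hl] _] _; rewrite hl.
Qed.
Lemma form1 (a : A) : form a 1 = 0.
Proof.
apply: presP => Y g hg; rewrite (lin0 (lift_linear hg)) /form !lift_gen //.
by case: hg => -[_ hb] _; rewrite hb.
Qed.

Lemma omegaP (x : omega A) : exists s : seq (A * A), x = \sum_(p <- s) form p.1 p.2.
Proof.
have [s ->] := pres_gen x; exists s; apply: eq_bigr => -[v m] _ //.
Qed.

Lemma omega_eq (Y : zmodType) (f g : omega A -> Y) :
  {morph f : x y / x + y} -> {morph g : x y / x + y} ->
  (forall a b, f (form a b) = g (form a b)) -> forall x, f x = g x.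
Proof.
move=> fD gD h x; have [s ->] := omegaP x.
rewrite (big_morph f fD (additive0 fD)) (big_morph g gD (additive0 gD)).
by apply: eq_bigr => p _; apply: h.
Qed.

Lemma omega_l_linear (c : A) : linear (omega_l c).
Proof.
apply: olift_linear => [|a]; last exact: form1.
split=> [b|a]; last exact: form_linearr.
exact: (linear_comp (form_linearl _) (pz_mul_linearr _)).
Qed.
Lemma omega_lE c a b : omega_l c (form a b : omega A) = form (c * a) b.
Proof.
rewrite /omega_l olift_form // => [|d]; last exact: form1.
split=> [d|d]; last exact: form_linearr.
exact: (linear_comp (form_linearl _) (pz_mul_linearr _)).
Qed.

Let omega_r_bilinear c :
  bilinear_map (fun a b : A => form a (b * c) - form (a * b) c : omega A).
Proof.
split=> [b|a]; apply: linear_add; [|apply: linear_opp| |apply: linear_opp].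
- exact: form_linearl.
- exact: (linear_comp (form_linearl _) (pz_mul_linearl _)).
- exact: (linear_comp (form_linearr _) (pz_mul_linearl _)).
exact: (linear_comp (form_linearl _) (pz_mul_linearr _)).
Qed.
Let omega_r_unit c a : form a (1 * c) - form (a * 1) c = 0 :> omega A.
Proof. by rewrite mul1r mulr1 subrr. Qed.

Lemma omega_r_linear (c : A) : linear (fun w => omega_r w c).
Proof. by apply: olift_linear; [exact: omega_r_bilinear|exact: omega_r_unit]. Qed.
Lemma omega_rE c a b :
  omega_r (form a b : omega A) c = form a (b * c) - form (a * b) c.
Proof.
by rewrite /omega_r olift_form.
Qed.

(** On c delta(d) the term c d a delta(b) arises twice with opposite signs. *)
Lemma omega_rM (w : omega A) a b : omega_r w (a * b) = omega_r (omega_r w a) b.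
Proof.
move: w; apply: omega_eq => [x y|x y|c d].
- by rewrite (linD (omega_r_linear _)).
- by rewrite !(linD (omega_r_linear _)).
rewrite !omega_rE (linB (omega_r_linear _)) !omega_rE !mulrA opprB.
by rewrite addrA subrK.
Qed.

Lemma omega_lr (w : omega A) a b : omega_r (omega_l a w) b = omega_l a (omega_r w b).
Proof.
move: w; apply: omega_eq => [x y|x y|c d].
- by rewrite (linD (omega_l_linear _)) (linD (omega_r_linear _)).
- by rewrite (linD (omega_r_linear _)) (linD (omega_l_linear _)).
by rewrite omega_lE !omega_rE (linB (omega_l_linear _)) !omega_lE !mulrA.
Qed.

Lemma omega_r_linearr (w : omega A) : linear (omega_r w).
Proof.
move=> k x y; move: w; apply: omega_eq => [u v|u v|c d].
- exact: (linD (omega_r_linear _)).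
- by rewrite !(linD (omega_r_linear _)) scalerDr addrACA.
rewrite !omega_rE (pz_mul_linearr d) !(form_linearr _ k) scalerBr opprD.
by rewrite addrACA.
Qed.

Section Star.
Variable star : A -> A.
Hypothesis hstar : involution star.

Lemma star_anti k a b : star (k *: a + b) = k^* *: star a + star b.
Proof. by case: hstar. Qed.
Lemma starM a b : star (a * b) = star b * star a.
Proof. by case: hstar. Qed.
Lemma starK a : star (star a) = a.
Proof. by case: hstar. Qed.
Lemma star1 : star 1 = 1.
Proof. by have := starM 1 (star 1); rewrite mul1r starK mul1r => <-. Qed.

(** The involution is antilinear; with values in the conjugate space it has the linearity that
    [olift] demands. *)
Let omega_star_bilinear :
  bilinear_map (fun a b => - omega_r (delta (star b)) (star a) : conjv (omega A)).
Proof.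
split=> [b|a] k x y.
  rewrite star_anti omega_r_linearr opprD; congr (_ + _).
  by rewrite -scalerN.
rewrite star_anti /delta form_linearr (omega_r_linear) opprD; congr (_ + _).
by rewrite -scalerN.
Qed.
Let omega_star_unit a :
  - omega_r (delta (star 1)) (star a) = 0 :> conjv (omega A).
Proof. by rewrite star1 /delta form1 (lin0 (omega_r_linear _)) oppr0. Qed.

Lemma omega_star_linear : linear (omega_star star : omega A -> conjv (omega A)).
Proof. exact: (olift_linear omega_star_bilinear omega_star_unit). Qed.

Lemma omega_starE a b : omega_star star (form a b) =
  form (star b) (star a) - form 1 (star b * star a) :> omega A.
Proof.
rewrite /omega_star (olift_form omega_star_bilinear omega_star_unit).
by rewrite /delta omega_rE opprB mul1r.
Qed.

Lemma omega_star_l a (w : omega A) :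
  omega_star star (omega_l a w) = omega_r (omega_star star w) (star a).
Proof.
move: w; apply: omega_eq => [x y|x y|c d].
- by rewrite (linD (omega_l_linear _)) (linD omega_star_linear).
- rewrite (linD omega_star_linear); exact: (linD (omega_r_linear (star a))).
rewrite omega_lE !omega_starE (linB (omega_r_linear _)) !omega_rE !starM.
by rewrite !mul1r opprB addrA subrK mulrA.
Qed.
End Star.
End OmegaFacts.

(** * Dual bases of finite-projective modules *)

Section ModuleFacts.
Variables (C : numClosedFieldType) (A : pzAlgType C) (E : rightModule A).

Lemma ract_scale k (v : E) : ract v (k *: (1 : A)) = k *: v.
Proof. by rewrite (linZ (ract_linr v)) ract1. Qed.

Variables (n : nat) (e : 'M[A]_n) (phi : E -> 'cV[A]_n).
Hypotheses (he : e *m e = e) (hphi : iso_onto_eAn e phi).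

Lemma phiD v w i : phi (v + w) i 0 = phi v i 0 + phi w i 0.
Proof. by case: hphi => + _ _ _ => ->; rewrite mxE. Qed.
Lemma phi_ract v a i : phi (ract v a) i 0 = phi v i 0 * a.
Proof. by case: hphi. Qed.
Lemma phi_linear i : linear (fun v => phi v i 0 : A).
Proof.
by move=> k v w; rewrite phiD -ract_scale phi_ract pz_mulZr mulr1.
Qed.
Lemma phi_fix v : e *m phi v = phi v.
Proof.
have [_ _ _ hr] := hphi.
have : (range phi)%classic (phi v) by exists v.
by rewrite hr => -[x _ <-]; rewrite mulmxA he.
Qed.

(** The columns of e lie in e A^n because e is idempotent. Their preimages, paired with the
    coordinates of [phi], form a dual basis of E. *)
Lemma dual_basis_exists : exists b : 'I_n -> E, forall i j, phi (b j) i 0 = e i j.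
Proof.
have [_ _ _ hr] := hphi.
have h j : exists v, phi v = col j e.
  have : (range phi)%classic (col j e).
    rewrite hr; exists (col j e) => //.
    by apply/matrixP => i k; rewrite -{3}he !mxE; apply: eq_bigr => l _; rewrite mxE.
  by move=> [v _ <-]; exists v.
have [b hb] := choice h.
by exists b => i j; rewrite hb mxE.
Qed.

Lemma dual_basisE (b : 'I_n -> E) : (forall i j, phi (b j) i 0 = e i j) ->
  forall v, v = \sum_j ract (b j) (phi v j 0).
Proof.
move=> hb v; have [_ _ inj _] := hphi; apply: inj.
apply/matrixP => i j; rewrite (ord1 j) (lin_sum (phi_linear i)) -{1}phi_fix mxE.
by apply: eq_bigr => k _; rewrite phi_ract hb.
Qed.
End ModuleFacts.

(** * Twisting an operator by a universal connection *)

(** The shape of the domain of either twist: [P] puts the domain condition on the right factor for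
    one and on the left factor for the other. *)
Definition span_pairs (C : pzRingType) (A : Type) (E M : lmodType C)
    (ra : E -> A -> E) (la : A -> M -> M) (P : E * M -> Prop) (x : tens ra la) :=
  exists2 s : seq (E * M), (forall p, p \in s -> P p) &
    x = \sum_(p <- s) p.1 \ox p.2.

Section SpanPairs.
Variables (C : pzRingType) (A : Type) (E M : lmodType C).
Variables (ra : E -> A -> E) (la : A -> M -> M) (P : E * M -> Prop).
Local Notation S := (@span_pairs C A E M ra la P).

Lemma span_pairs0 : S 0.
Proof. by exists [::] => //; rewrite big_nil. Qed.

Lemma span_pairs1 v m : P (v, m) -> S (v \ox m).
Proof.
move=> h; exists [:: (v, m)]; last by rewrite big_seq1.
by move=> p; rewrite inE => /eqP->.
Qed.

Lemma span_pairsD x y : S x -> S y -> S (x + y).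
Proof.
move=> [s hs ->] [t ht ->]; exists (s ++ t); last by rewrite big_cat.
by move=> p; rewrite mem_cat => /orP[/hs|/ht].
Qed.

Lemma span_pairs_sum (I : eqType) (r : seq I) (F : I -> tens ra la) :
  (forall i, i \in r -> S (F i)) -> S (\sum_(i <- r) F i).
Proof.
move=> h; rewrite big_seq; elim/big_rec: _ => [|i x hi]; first exact: span_pairs0.
by apply: span_pairsD; exact: h.
Qed.

Lemma span_pairs_lin k x y : (forall k p, P p -> P (k *: p.1, p.2)) ->
  S x -> S y -> S (k *: x + y).
Proof.
move=> hP [s hs ->] hy; apply: span_pairsD => //.
rewrite scaler_sumr; apply: span_pairs_sum => p hp.
rewrite -(linZ (tensor_linearl _ _ _)); apply: span_pairs1; exact/hP/hs.
Qed.

Lemma span_pairs_ind (Q : tens ra la -> Prop) :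
  Q 0 -> (forall x y, Q x -> Q y -> Q (x + y)) ->
  (forall v m, P (v, m) -> Q (v \ox m)) -> forall x, S x -> Q x.
Proof.
move=> Q0 QD Q1 x [s hs ->]; rewrite big_seq.
by elim/big_ind: _ => // -[v m] hp; apply/Q1/hs.
Qed.
End SpanPairs.

Section LinearOperatorFacts.
Variables (C : numClosedFieldType) (M : lmodType C) (T : operator M).
Hypothesis hT : linear_operator T.

Lemma dom0 : dom T 0. Proof. by case: hT. Qed.
Lemma dom_lin k x y : dom T x -> dom T y -> dom T (k *: x + y).
Proof. by case: hT => _ h hx hy; case: (h k x y hx hy). Qed.
Lemma op_lin k x y : dom T x -> dom T y -> T (k *: x + y) = k *: T x + T y.
Proof. by case: hT => _ h hx hy; case: (h k x y hx hy). Qed.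
Lemma domD x y : dom T x -> dom T y -> dom T (x + y).
Proof. by move=> hx hy; rewrite -[x]scale1r; apply: dom_lin. Qed.
Lemma opD x y : dom T x -> dom T y -> T (x + y) = T x + T y.
Proof. by move=> hx hy; rewrite -{1}[x]scale1r op_lin // scale1r. Qed.
Lemma op0 : T 0 = 0.
Proof. by apply: (@addrI _ (T 0)); rewrite -opD ?addr0 //; exact: dom0. Qed.
Lemma domZ k x : dom T x -> dom T (k *: x).
Proof. by move=> hx; rewrite -[k *: x]addr0; apply: dom_lin => //; exact: dom0. Qed.
Lemma opZ k x : dom T x -> T (k *: x) = k *: T x.
Proof.
by move=> hx; rewrite -[k *: x]addr0 op_lin ?op0 ?addr0 //; exact: dom0.
Qed.
Lemma domN x : dom T x -> dom T (- x).
Proof. by move=> hx; rewrite -scaleN1r; exact: domZ. Qed.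
Lemma opN x : dom T x -> T (- x) = - T x.
Proof. by move=> hx; rewrite -!scaleN1r opZ. Qed.
Lemma domB x y : dom T x -> dom T y -> dom T (x - y).
Proof. by move=> hx hy; apply: domD => //; exact: domN. Qed.
Lemma opB x y : dom T x -> dom T y -> T (x - y) = T x - T y.
Proof. by move=> hx hy; rewrite opD ?opN //; exact: domN. Qed.
Lemma dom_sum (I : Type) (r : seq I) (F : I -> M) :
  (forall i, dom T (F i)) -> dom T (\sum_(i <- r) F i).
Proof. by move=> h; elim/big_ind: _ => //; [exact: dom0|exact: domD]. Qed.
Lemma op_sum (I : Type) (r : seq I) (F : I -> M) :
  (forall i, dom T (F i)) -> T (\sum_(i <- r) F i) = \sum_(i <- r) T (F i).
Proof.
move=> h; elim: r => [|i r IH]; first by rewrite !big_nil op0.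
by rewrite !big_cons opD ?IH //; exact: dom_sum.
Qed.
End LinearOperatorFacts.

(** A substitute for the universal property: [F j] is linear on the domain of [T] only, so [tlift]
    cannot be applied to it, whereas the coordinates [crd j] are linear everywhere and land in that
    domain. *)
Lemma coordinate_operator (C : numClosedFieldType) (Z M : lmodType C) (n : nat)
    (S : set Z) (T : operator M) (crd : 'I_n -> Z -> M) (F : 'I_n -> M -> Z) :
  S 0 -> (forall k x y, S x -> S y -> S (k *: x + y)) ->
  (forall j, linear (crd j)) -> (forall j x, S x -> dom T (crd j x)) ->
  (forall j k x y, dom T x -> dom T y -> F j (k *: x + y) = k *: F j x + F j y) ->
  linear_operator (Operator S (fun x => \sum_j F j (crd j x))).
Proof.
move=> S0 SL cl cd Fl; split=> //= k x y hx hy; split; first exact: SL.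
rewrite scaler_sumr -big_split /=; apply: eq_bigr => j _.
by rewrite cl Fl //; exact: cd.
Qed.

(** * Twisting an operator on the left *)

Section LeftTwist.
Variables (C : numClosedFieldType) (A : pzAlgType C) (E : rightModule A).
Variables (nabla : E -> connection_target E) (hnabla : universal_connection nabla).
Variables (M : lmodType C) (la : A -> M -> M) (T : operator M).
Hypotheses (la_linr : forall a, linear (la a)) (la_linl : forall y, linear (la^~ y)).
Hypotheses (la1 : forall y, la 1 y = y) (laM : forall a b y, la (a * b) y = la a (la b y)).
Hypotheses (hT : linear_operator T) (domT : forall a y, dom T y -> dom T (la a y)).
Local Notation EM := (tens (@ract C A E) la).

(** One-forms are evaluated at a vector instead of being represented as operators: [T, b] makes
    sense on the domain only, and for fixed y there the expression is bilinear in (a, b). *)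
Definition form_rep (y : M) : omega A -> M :=
  olift (fun a b => la a (commutator T (la b) y)).

Section FixedVector.
Variables (y : M) (hy : dom T y).

Let rep_bilinear : bilinear_map (fun a b => la a (commutator T (la b) y)).
Proof.
split=> [b|a]; first exact: la_linl.
move=> k b c; rewrite /commutator !la_linl op_lin //; [|exact: domT..].
by rewrite opprD addrACA -scalerBr la_linr.
Qed.
Let rep_unit a : la a (commutator T (la 1) y) = 0.
Proof. by rewrite /commutator !la1 subrr (lin0 (la_linr _)). Qed.

Lemma form_rep_linear : linear (form_rep y).
Proof. exact: olift_linear rep_bilinear rep_unit. Qed.
Lemma form_repE a b : form_rep y (form a b) = la a (commutator T (la b) y).
Proof. exact: olift_form rep_bilinear rep_unit a b. Qed.
Lemma form_rep_l a w : form_rep y (omega_l a w) = la a (form_rep y w).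
Proof.
move: w; apply: omega_eq => [u v|u v|c d].
- by rewrite (linD (omega_l_linear _)) (linD form_rep_linear).
- by rewrite (linD form_rep_linear) (linD (la_linr a)).
by rewrite omega_lE !form_repE laM.
Qed.
End FixedVector.

(** The rule [T, da] = [T, d] a + d [T, a] cancels the second term of the right action on forms. *)
Lemma form_rep_r y a w : dom T y ->
  form_rep y (omega_r w a) = form_rep (la a y) w.
Proof.
move=> hy; have hay := domT a hy.
move: w; apply: omega_eq => [u v|u v|c d].
- by rewrite (linD (omega_r_linear _)) (linD (form_rep_linear hy)).
- exact: (linD (form_rep_linear hay)).
rewrite omega_rE (linB (form_rep_linear hy)) !form_repE // /commutator !laM.
by rewrite !(linB (la_linr _)) opprB addrA subrK.
Qed.

Lemma form_rep_linear_dom w k x y : dom T x -> dom T y ->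
  form_rep (k *: x + y) w = k *: form_rep x w + form_rep y w.
Proof.
move=> hx hy; have hxy := dom_lin hT k hx hy.
move: w; apply: omega_eq => [u v|u v|c d].
- exact: (linD (form_rep_linear hxy)).
- rewrite (linD (form_rep_linear hx)) (linD (form_rep_linear hy)).
  by rewrite scalerDr addrACA.
rewrite !form_repE // /commutator la_linr !op_lin //; [|exact: domT..].
by rewrite la_linr opprD addrACA -scalerBr la_linr.
Qed.

Definition grad_rep (y : M) : connection_target E -> EM :=
  tlift (fun u w => u \ox form_rep y w).

Section FixedVector2.
Variables (y : M) (hy : dom T y).
Let grad_bilinear : bilinear_map (fun u w => u \ox form_rep y w : EM).
Proof. exact: tens_map_linear (@linear_id C E) (form_rep_linear hy). Qed.
Let grad_balanced v a w :
  ract v a \ox form_rep y w = v \ox form_rep y (omega_l a w) :> EM.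
Proof. by rewrite tensor_balanced form_rep_l. Qed.

Lemma grad_rep_linear : linear (grad_rep y).
Proof. exact: tlift_linear grad_bilinear grad_balanced. Qed.
Lemma grad_repE u w : grad_rep y (u \ox w) = u \ox form_rep y w.
Proof. exact: tlift_tensor u w grad_bilinear grad_balanced. Qed.
End FixedVector2.

Lemma omega_right_linear (a : A) :
  linear (tlift (fun u w => u \ox omega_r w a) : connection_target E -> connection_target E).
Proof.
apply: tlift_linear => [|v b w].
  exact: tens_map_linear (@linear_id C E) (omega_r_linear a).
by rewrite tensor_balanced omega_lr.
Qed.
Lemma omega_right_tensor (a : A) (u : E) (w : omega A) :
  tlift (fun u w => u \ox omega_r w a) (u \ox w : connection_target E) =
  u \ox omega_r w a :> connection_target E.
Proof.
apply: tlift_tensor => [|v b o].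
  exact: tens_map_linear (@linear_id C E) (omega_r_linear a).
by rewrite tensor_balanced omega_lr.
Qed.

Definition twist_left (v : E) (y : M) : EM := grad_rep y (nabla v) + v \ox T y.

Lemma twist_left_linearl y : dom T y -> linear (twist_left^~ y).
Proof.
move=> hy; apply: linear_add; last exact: tensor_linearl.
exact: linear_comp (grad_rep_linear hy) (hnabla.1).
Qed.

Lemma twist_left_linearr v k x y : dom T x -> dom T y ->
  twist_left v (k *: x + y) = k *: twist_left v x + twist_left v y.
Proof.
move=> hx hy; rewrite /twist_left op_lin // tensor_linearr scalerDr addrACA.
congr (_ + _); move: (nabla v); apply: tens_eq => [s t|s t|u w].
- exact: (linD (grad_rep_linear (dom_lin hT k hx hy))).
- by rewrite !(linD (grad_rep_linear _)) // scalerDr addrACA.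
rewrite !grad_repE //; last exact: dom_lin.
by rewrite form_rep_linear_dom // tensor_linearr.
Qed.

(** Neither summand of [twist_left] is balanced alone. The term v (x) delta(a) in the Leibniz rule
    of the connection contributes v (x) [T, a] y, which is exactly what separates v (x) T (a y) from
    v (x) a (T y). *)
Lemma twist_left_balanced v a y : dom T y ->
  twist_left (ract v a) y = twist_left v (la a y).
Proof.
move=> hy; rewrite /twist_left hnabla.2 (linD (grad_rep_linear hy)) grad_repE //.
rewrite -addrA tensor_balanced -(linD (tensor_linearr _ _ _)) /delta form_repE //.
rewrite la1 /commutator subrK; congr (_ + _).
move: (nabla v); apply: tens_eq => [s t|s t|u w].
- by rewrite (linD (omega_right_linear a)) (linD (grad_rep_linear hy)).
- exact: (linD (grad_rep_linear (domT a hy))).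
rewrite omega_right_tensor !grad_repE ?form_rep_r //; exact: domT.
Qed.

Variables (n : nat) (b : 'I_n -> E) (c : 'I_n -> E -> A).
Hypotheses (c_linear : forall j, linear (c j)).
Hypotheses (c_ract : forall j v a, c j (ract v a) = c j v * a).
Hypotheses (bc : forall v, v = \sum_j ract (b j) (c j v)).

Definition left_coord j : EM -> M := tlift (fun v y => la (c j v) y).
Let left_coord_bilinear j : bilinear_map (fun v y => la (c j v) y).
Proof. by split=> [y|v] //; exact: linear_comp (la_linl y) (c_linear j). Qed.
Let left_coord_balanced j v a y : la (c j (ract v a)) y = la (c j v) (la a y).
Proof. by rewrite c_ract laM. Qed.
Lemma left_coord_linear j : linear (left_coord j).
Proof. exact: tlift_linear (left_coord_bilinear j) (left_coord_balanced j). Qed.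
Lemma left_coordE j v y : left_coord j (v \ox y) = la (c j v) y.
Proof. exact: tlift_tensor v y (left_coord_bilinear j) (left_coord_balanced j). Qed.

Lemma one_tensor_exists : exists T' : operator EM, is_one_tensor nabla T T'.
Proof.
pose S := @span_pairs C A E M (@ract C A E) la (fun p => dom T p.2).
exists (Operator S (fun x => \sum_j twist_left (b j) (left_coord j x))).
split=> //.
  apply: (coordinate_operator (T := T) (crd := left_coord)
    (F := fun j => twist_left (b j))).
  - exact: span_pairs0.
  - by move=> k x y; apply: span_pairs_lin.
  - exact: left_coord_linear.
  - move=> j; apply: (span_pairs_ind (Q := fun x => dom T (left_coord j x))).
    + by rewrite (lin0 (left_coord_linear j)); exact: dom0.
    + by move=> s t; rewrite (linD (left_coord_linear j)); exact: domD.
    + by move=> v m /= hm; rewrite left_coordE; exact: domT.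
  - by move=> j k x y; exact: twist_left_linearr.
move=> v y s hy hs /=.
transitivity (twist_left v y).
  (* Balancedness moves the coordinate of v back onto b_j, and the dual basis reassembles v. *)
  under eq_bigr => j _ do rewrite left_coordE -twist_left_balanced //.
  by rewrite -(lin_sum (twist_left_linearl hy)) -bc.
rewrite /twist_left hs (lin_sum (grad_rep_linear hy)); congr (_ + _).
by apply: eq_bigr => p _; rewrite grad_repE // form_repE.
Qed.
End LeftTwist.

(** The twists are specified through such presentations of nabla(v), so each vector needs one. *)
Lemma connection_sumP (C : numClosedFieldType) (A : pzAlgType C) (E : rightModule A)
    (t : connection_target E) :
  exists s : seq (E * A * A), t = \sum_(p <- s) p.1.1 \ox form p.1.2 p.2.
Proof.
have [s ->] := tensP t; elim: s => [|[u w] s [s' IH]].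
  by exists [::]; rewrite !big_nil.
have [r ->] := omegaP w.
exists ([seq ((u, q.1), q.2) | q <- r] ++ s').
rewrite big_cons big_cat big_map IH /=; congr (_ + _).
exact: (lin_sum (tensor_linearr _ _ u)).
Qed.

(** * The conjugate connection *)

Section ConjugateConnection.
Variables (C : numClosedFieldType) (A : pzAlgType C) (star : A -> A).
Hypothesis hstar : involution star.
Variables (E : rightModule A) (nabla : E -> connection_target E).
Hypothesis hnabla : universal_connection nabla.
Local Notation ctarget := (tens (@omega_r C A) (@conj_act C A star E)).
Local Notation conj_act := (@conj_act C A star E).

Definition conj_form (t : connection_target E) : conjv ctarget :=
  tlift (fun u o => - (omega_star star o \ox bar u)) t.

Let conj_form_bilinear : bilinear_map
  (fun u o => - (omega_star star o \ox bar u) : conjv ctarget).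
Proof.
split=> [o|u] k x y.
  transitivity (- (omega_star star o \ox (k^* *: bar x + bar y : conjv E)) : ctarget).
    by congr (- (_ \ox _)); rewrite /bar /GRing.scale /= /conjv_scale conjCK.
  by rewrite tensor_linearr opprD -scalerN.
rewrite (omega_star_linear hstar) [X in - (X \ox _)](_ : _ =
  k^* *: (omega_star star x : omega A) + omega_star star y) //.
by rewrite tensor_linearl opprD -scalerN.
Qed.
Let conj_form_balanced v a o : - (omega_star star o \ox bar (ract v a)) =
  - (omega_star star (omega_l a o) \ox bar v) :> conjv ctarget.
Proof.
rewrite (omega_star_l hstar) tensor_balanced; congr (- (_ \ox _)).
by rewrite /conj_act (starK hstar).
Qed.

Lemma conj_form_linear : linear conj_form.
Proof. exact: tlift_linear conj_form_bilinear conj_form_balanced. Qed.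
Lemma conj_formE u o : conj_form (u \ox o) = - (omega_star star o \ox bar u) :> ctarget.
Proof. exact: tlift_tensor u o conj_form_bilinear conj_form_balanced. Qed.

Lemma conj_connectionE w : conj_connection star nabla w = conj_form (nabla (w : E)).
Proof. by []. Qed.

Lemma conj_connection_linear : linear (conj_connection star nabla : conjv E -> ctarget).
Proof.
move=> k v w; rewrite !conj_connectionE.
have -> : nabla (k *: v + w : conjv E) = k^* *: nabla v + nabla w.
  exact: (hnabla.1 k^* (v : E) (w : E)).
rewrite conj_form_linear; congr (_ + _).
by rewrite {1}/GRing.scale /= /conjv_scale conjCK.
Qed.

Lemma omega_star_r (w : omega A) a :
  omega_star star (omega_r w a) = omega_l (star a) (omega_star star w).
Proof.
move: w; apply: omega_eq => [x y|x y|c d].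
- by rewrite (linD (omega_r_linear _)) (linD (omega_star_linear hstar)).
- rewrite (linD (omega_star_linear hstar)); exact: (linD (omega_l_linear (star a))).
rewrite omega_rE (linB (omega_star_linear hstar)) !(omega_starE hstar).
rewrite (linB (omega_l_linear _)) !omega_lE !(starM hstar) !mulrA mulr1.
by rewrite opprB addrA subrK.
Qed.
End ConjugateConnection.

(** * Twisting an operator on the right *)

Section RightTwist.
Variables (C : numClosedFieldType) (A : pzAlgType C) (star : A -> A).
Hypothesis hstar : involution star.
Variables (E : rightModule A) (nabla : E -> connection_target E).
Hypothesis hnabla : universal_connection nabla.
Variables (M : lmodType C) (ra : M -> A -> M) (T : operator M).
Hypotheses (ra_linl : forall a, linear (fun y => ra y a)) (ra_linr : forall y, linear (ra y)).
Hypotheses (ra1 : forall y, ra y 1 = y) (raM : forall a b y, ra y (a * b) = ra (ra y a) b).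
Hypotheses (hT : linear_operator T) (domT : forall a y, dom T y -> dom T (ra y a)).
Local Notation conj_act := (@conj_act C A star E).
Local Notation MbarE := (tens ra conj_act).
Local Notation ctarget := (tens (@omega_r C A) (@Defs.conj_act C A star E)).

Definition right_form_rep (y : M) : omega A -> M :=
  olift (fun a b => commutator T (ra^~ b) (ra y a)).

Section FixedVector.
Variables (y : M) (hy : dom T y).

Let rep_bilinear : bilinear_map (fun a b => commutator T (ra^~ b) (ra y a)).
Proof.
split=> [b|a] k c d; rewrite /commutator.
  rewrite ra_linr ra_linl !op_lin // ?ra_linl; try by do !apply: domT.
  by rewrite opprD addrACA -scalerBr.
rewrite !ra_linr op_lin //; try by do !apply: domT.
by rewrite opprD addrACA -scalerBr.
Qed.
Let rep_unit a : commutator T (ra^~ 1) (ra y a) = 0.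
Proof. by rewrite /commutator !ra1 subrr. Qed.

Lemma right_form_rep_linear : linear (right_form_rep y).
Proof. exact: olift_linear rep_bilinear rep_unit. Qed.
Lemma right_form_repE a b :
  right_form_rep y (form a b) = commutator T (ra^~ b) (ra y a).
Proof. exact: olift_form rep_bilinear rep_unit a b. Qed.
Lemma right_form_rep_r a w :
  right_form_rep y (omega_r w a) = ra (right_form_rep y w) a.
Proof.
move: w; apply: omega_eq => [u v|u v|c d].
- by rewrite (linD (omega_r_linear _)) (linD right_form_rep_linear).
- by rewrite (linD right_form_rep_linear) (linD (ra_linl a)).
rewrite omega_rE (linB right_form_rep_linear) !right_form_repE /commutator !raM.
by rewrite (linB (ra_linl a)) opprB addrC addrA subrK.
Qed.
End FixedVector.

Lemma right_form_rep_l y a w : dom T y ->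
  right_form_rep y (omega_l a w) = right_form_rep (ra y a) w.
Proof.
move=> hy; have hay := domT a hy.
move: w; apply: omega_eq => [u v|u v|c d].
- by rewrite (linD (omega_l_linear _)) (linD (right_form_rep_linear hy)).
- exact: (linD (right_form_rep_linear hay)).
by rewrite omega_lE !right_form_repE // /commutator !raM.
Qed.

Lemma right_form_rep_linear_dom w k x y : dom T x -> dom T y ->
  right_form_rep (k *: x + y) w = k *: right_form_rep x w + right_form_rep y w.
Proof.
move=> hx hy; have hxy := dom_lin hT k hx hy.
move: w; apply: omega_eq => [u v|u v|c d].
- exact: (linD (right_form_rep_linear hxy)).
- rewrite (linD (right_form_rep_linear hx)) (linD (right_form_rep_linear hy)).
  by rewrite scalerDr addrACA.
rewrite !right_form_repE // /commutator !ra_linl !op_lin // ?ra_linl;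
  try by do !apply: domT.
by rewrite opprD addrACA -scalerBr.
Qed.

Definition right_grad_rep (y : M) : ctarget -> MbarE :=
  tlift (fun o w => right_form_rep y o \ox w).

Section FixedVector2.
Variables (y : M) (hy : dom T y).
Let grad_bilinear : bilinear_map (fun o w => right_form_rep y o \ox w : MbarE).
Proof. exact: tens_map_linear (right_form_rep_linear hy) (@linear_id C _). Qed.
Let grad_balanced o a w :
  right_form_rep y (omega_r o a) \ox w = right_form_rep y o \ox conj_act a w :> MbarE.
Proof. by rewrite right_form_rep_r // tensor_balanced. Qed.

Lemma right_grad_rep_linear : linear (right_grad_rep y).
Proof. exact: tlift_linear grad_bilinear grad_balanced. Qed.
Lemma right_grad_repE o w : right_grad_rep y (o \ox w) = right_form_rep y o \ox w.
Proof. exact: tlift_tensor o w grad_bilinear grad_balanced. Qed.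
End FixedVector2.

Definition twist_right (w : conjv E) (y : M) : MbarE :=
  T y \ox w + right_grad_rep y (conj_connection star nabla w).

Lemma twist_right_linearl y : dom T y -> linear (twist_right^~ y).
Proof.
move=> hy; apply: linear_add; first exact: tensor_linearr.
exact: linear_comp (right_grad_rep_linear hy) (conj_connection_linear hstar hnabla).
Qed.

Lemma twist_right_linearr w k x y : dom T x -> dom T y ->
  twist_right w (k *: x + y) = k *: twist_right w x + twist_right w y.
Proof.
move=> hx hy; rewrite /twist_right op_lin // tensor_linearl scalerDr addrACA.
congr (_ + _); move: (conj_connection _ _ _); apply: tens_eq => [s t|s t|u o].
- exact: (linD (right_grad_rep_linear (dom_lin hT k hx hy))).
- by rewrite !(linD (right_grad_rep_linear _)) // scalerDr addrACA.
rewrite !right_grad_repE //; last exact: dom_lin.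
by rewrite right_form_rep_linear_dom // tensor_linearl.
Qed.

(** Two stars cancel, so the conjugate connection acquires the extra term delta(a) (x) w. It is
    represented by [T, R_a] y, the difference between T (y a) and (T y) a. *)
Lemma twist_right_balanced w a y : dom T y ->
  twist_right (conj_act a w) y = twist_right w (ra y a).
Proof.
move=> hy; have hay := domT a hy; rewrite /twist_right !conj_connectionE.
have -> : nabla (conj_act a w) = nabla (ract (w : E) (star a)) by [].
rewrite hnabla.2 (linD (@conj_form_linear C A star hstar E)) (linD (right_grad_rep_linear hy)).
rewrite addrCA addrC (conj_formE hstar) /delta (omega_starE hstar).
rewrite (starK hstar) (star1 hstar) mulr1 form1 add0r.
have -> : - ((- form 1 a : omega A) \ox w : ctarget) = form 1 a \ox w.
  by rewrite (linN (tensor_linearl _ _ _)) opprK.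
rewrite right_grad_repE // right_form_repE // ra1 -tensor_balanced.
rewrite -(linD (tensor_linearl _ _ _)) /commutator [ra (T y) a + _]addrC subrK; congr (_ + _).
move: (nabla w); apply: tens_eq => [s t|s t|u o].
- rewrite (linD (omega_right_linear _)) (linD (@conj_form_linear C A star hstar E)).
  by rewrite (linD (right_grad_rep_linear hy)).
- rewrite (linD (@conj_form_linear C A star hstar E)).
  exact: (linD (right_grad_rep_linear hay)).
rewrite omega_right_tensor !(conj_formE hstar) (omega_star_r hstar) (starK hstar).
rewrite !(linN (right_grad_rep_linear _)) // !right_grad_repE //.
by rewrite right_form_rep_l.
Qed.

Variables (n : nat) (b : 'I_n -> E) (c : 'I_n -> E -> A).
Hypotheses (c_linear : forall j, linear (c j)).
Hypotheses (c_ract : forall j v a, c j (ract v a) = c j v * a).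
Hypotheses (bc : forall v, v = \sum_j ract (b j) (c j v)).

Definition right_coord j : MbarE -> M := tlift (fun y (w : conjv E) => ra y (star (c j (w : E)))).
Let right_coord_bilinear j :
  bilinear_map (fun y (w : conjv E) => ra y (star (c j (w : E)))).
Proof.
split=> [w|y] //= k v w.
have -> : c j (k *: v + w : conjv E) = k^* *: c j v + c j w by exact: c_linear.
by rewrite (star_anti hstar) conjCK ra_linr.
Qed.
Let right_coord_balanced j y a w :
  ra (ra y a) (star (c j (w : E))) = ra y (star (c j (conj_act a w : E))).
Proof. by rewrite /conj_act c_ract (starM hstar) (starK hstar) raM. Qed.
Lemma right_coord_linear j : linear (right_coord j).
Proof. exact: tlift_linear (right_coord_bilinear j) (right_coord_balanced j). Qed.
Lemma right_coordE j y w : right_coord j (y \ox w) = ra y (star (c j (w : E))).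
Proof. exact: tlift_tensor y w (right_coord_bilinear j) (right_coord_balanced j). Qed.

Lemma tensor_one_exists : exists T' : operator MbarE, is_tensor_one nabla T T'.
Proof.
pose S := @span_pairs C A M (conjv E) ra conj_act (fun p => dom T p.1).
exists (Operator S (fun x => \sum_j twist_right (bar (b j)) (right_coord j x))).
split=> //.
  apply: (coordinate_operator (T := T) (crd := right_coord)
    (F := fun j => twist_right (bar (b j)))).
  - exact: span_pairs0.
  - by move=> k x y; apply: span_pairs_lin => l p; exact: domZ.
  - exact: right_coord_linear.
  - move=> j; apply: (span_pairs_ind (Q := fun x => dom T (right_coord j x))).
    + by rewrite (lin0 (right_coord_linear j)); exact: dom0.
    + by move=> s t; rewrite (linD (right_coord_linear j)); exact: domD.
    + by move=> v m /= hm; rewrite right_coordE; exact: domT.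
  - by move=> j k x y; exact: twist_right_linearr.
move=> y w s hy hs /=.
transitivity (twist_right w y).
  under eq_bigr => j _ do rewrite right_coordE -twist_right_balanced //.
  rewrite -(lin_sum (twist_right_linearl hy)); congr twist_right.
  rewrite [RHS]bc; apply: eq_bigr => j _.
  by rewrite /conj_act (starK hstar).
rewrite /twist_right hs (lin_sum (right_grad_rep_linear hy)); congr (_ + _).
by apply: eq_bigr => p _; rewrite right_grad_repE // right_form_repE.
Qed.

Lemma tensor_one_formula (T' : operator MbarE) v y (s : seq (E * A * A)) :
  is_tensor_one nabla T T' -> dom T y ->
  nabla v = \sum_(p <- s) p.1.1 \ox form p.1.2 p.2 ->
  T' (y \ox bar v) = T y \ox bar v + \sum_(p <- s)
    ra (commutator T (ra^~ (star p.2)) y) (star p.1.2) \ox bar p.1.1.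
Proof.
move=> [_ _ h] hy hs.
(* For c delta(d) in nabla(v), the conjugate connection contains delta(star d) (star c), that is
   delta(star d star c) - (star d) delta(star c): [s1] and [s2] list these two families. Acting from
   the right they combine to R_{star c} [T, R_{star d}]. *)
pose s1 := [seq (1 : A, star p.2 * star p.1.2, bar p.1.1) | p <- s].
pose s2 := [seq (- star p.2, star p.1.2, bar p.1.1) | p <- s].
rewrite (h y (bar v) (s1 ++ s2) hy).
  rewrite big_cat !big_map /= -big_split /=; congr (_ + _).
  apply: eq_bigr => p _; rewrite -(linD (tensor_linearl _ _ _)) ra1.
  rewrite (linN (ra_linr _)) /commutator (linN (ra_linl _)) !raM.
  rewrite !opN // ?(linN (ra_linl _)); try by do !apply: domT.
  congr (_ \ox _); rewrite (linB (ra_linl _)) opprK addrCA -addrA.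
  by rewrite addKr addrC.
rewrite conj_connectionE hs (lin_sum (@conj_form_linear C A star hstar E)).
rewrite big_cat !big_map /= -big_split /=; apply: eq_bigr => p _.
rewrite (conj_formE hstar) (omega_starE hstar) -(linD (tensor_linearl _ _ _)).
rewrite -(linN (tensor_linearl _ _ _)) opprB; congr (_ \ox _); congr (_ + _).
exact/esym/(linN (form_linearl _)).
Qed.
End RightTwist.

(** * The twisted triple: algebra *)

Lemma inverseK (C : numClosedFieldType) (H : lmodType C) (J : H -> H) :
  (forall y, exists x, J x = y) -> cancel (inverse J) J.
Proof.
move=> hJ y; apply: (@surjpK _ _ _ setT setT J) => [x _|]; last exact: in_setT.
by have [z hz] := hJ x; exists z.
Qed.

Section InnerProduct.
Variables (C : numClosedFieldType) (V : lmodType C) (dot : V -> V -> C).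
Hypothesis hdot : exists f : {dot V for Num.conj}, forall x y, dot x y = f x y.

Lemma dotDZl k x y z : dot (k *: x + y) z = k * dot x z + dot y z.
Proof. by case: hdot => f hf; rewrite !hf linearPl. Qed.
Lemma dotC x y : dot x y = (dot y x)^*.
Proof. by case: hdot => f hf; rewrite !hf hermC expr0 mul1r. Qed.
Lemma dotDZr k x y z : dot x (k *: y + z) = k^* * dot x y + dot x z.
Proof. by rewrite ![dot x _]dotC dotDZl rmorphD rmorphM. Qed.
Lemma dot_ge0 x : 0 <= dot x x.
Proof. by case: hdot => f hf; rewrite hf dnorm_ge0. Qed.
Lemma dot_eq0 x : dot x x = 0 -> x = 0.
Proof.
by case: hdot => f hf; rewrite hf => /eqP; rewrite dnorm_eq0 => /eqP.
Qed.
Lemma dotDl x y z : dot (x + y) z = dot x z + dot y z.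
Proof. by have := dotDZl 1 x y z; rewrite scale1r mul1r. Qed.
Lemma dotDr x y z : dot x (y + z) = dot x y + dot x z.
Proof. by have := dotDZr 1 x y z; rewrite rmorph1 scale1r mul1r. Qed.
Lemma dot0l z : dot 0 z = 0.
Proof. by apply: (@addrI _ (dot 0 z)); rewrite -dotDl !addr0. Qed.
Lemma dot0r z : dot z 0 = 0.
Proof. by rewrite dotC dot0l rmorph0. Qed.
Lemma dotZl k x y : dot (k *: x) y = k * dot x y.
Proof. by have := dotDZl k x 0 y; rewrite dot0l !addr0. Qed.
Lemma dotZr k x y : dot x (k *: y) = k^* * dot x y.
Proof. by have := dotDZr k x y 0; rewrite dot0r !addr0. Qed.
Lemma dotNl x y : dot (- x) y = - dot x y.
Proof. by rewrite -scaleN1r dotZl mulN1r. Qed.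
Lemma dotNr x y : dot x (- y) = - dot x y.
Proof. by rewrite ![dot x _]dotC dotNl rmorphN. Qed.
Lemma dotBl x y z : dot (x - y) z = dot x z - dot y z.
Proof. by rewrite dotDl dotNl. Qed.
Lemma dotBr x y z : dot x (y - z) = dot x y - dot x z.
Proof. by rewrite dotDr dotNr. Qed.
Lemma dot_sumr (I : Type) (r : seq I) (F : I -> V) y :
  dot y (\sum_(i <- r) F i) = \sum_(i <- r) dot y (F i).
Proof. exact: (big_morph (dot y) (dotDr y) (dot0r y)). Qed.
Lemma hnorm_eq0 x : hnorm dot x = 0 -> x = 0.
Proof. by move=> /eqP; rewrite sqrtC_eq0 => /eqP /dot_eq0. Qed.
Lemma hnorm0 : hnorm dot 0 = 0.
Proof. by rewrite /hnorm dot0l sqrtC0. Qed.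
End InnerProduct.

(** * Consequences of the axioms of a real spectral triple *)

Section Triple.
Variables (C : numClosedFieldType) (A : pzAlgType C) (star : A -> A).
Variables (H : lmodType C) (dot : H -> H -> C) (act : A -> H -> H).
Variables (D : operator H) (J : H -> H).
Hypothesis HD : real_spectral_triple star dot act D J.

Lemma star_involution : involution star. Proof. by case: HD => -[[]]. Qed.
Lemma H_hilbert : hilbert dot. Proof. by case: HD => -[[]]. Qed.
Lemma dot_form : exists f : {dot H for Num.conj}, forall x y, dot x y = f x y.
Proof. by case: H_hilbert. Qed.
Lemma act_linr a : linear (act a).
Proof. by case: HD => -[[_ _ [/(_ a) []]]]. Qed.
Lemma act_linl y : linear (act^~ y).
Proof. by case: HD => -[[_ _ [_ /(_ y)]]]. Qed.
Lemma act1 y : act 1 y = y.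
Proof. by case: HD => -[[_ _ [_ _ /(_ y)]]]. Qed.
Lemma actM a b y : act (a * b) y = act a (act b y).
Proof. by case: HD => -[[_ _ [_ _ _ /(_ a b y)]]]. Qed.
Lemma act_star a x y : dot (act a x) y = dot x (act (star a) y).
Proof. by case: HD => -[[_ _ [_ _ _ _ /(_ a x y)]]]. Qed.
Lemma D_linear : linear_operator D.
Proof. by case: HD => -[[_ _ _ []]]. Qed.
Lemma D_dense : densely_defined dot D.
Proof. by case: HD => -[[_ _ _ []]]. Qed.
Lemma D_act a y : dom D y -> dom D (act a y).
Proof. by case: HD => -[_ [_ /(_ a) [h _] _]] _; exact: h. Qed.
Lemma Janti : antilinear J.
Proof. by case: HD => -[_ [_ _ []]]. Qed.
Lemma J_norm x : hnorm dot (J x) = hnorm dot x.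
Proof. by case: HD => -[_ [_ _ [_ []]]]. Qed.
Lemma J_inj : injective J.
Proof.
move=> x y hxy; apply/eqP; rewrite -subr_eq0; apply/eqP/(hnorm_eq0 dot_form).
by rewrite -J_norm (antiB Janti) hxy subrr (hnorm0 dot_form).
Qed.
Lemma JVK x : J (inverse J x) = x.
Proof. by apply: inverseK; case: HD => -[_ [_ _ [_ []]]]. Qed.
Lemma VJK x : inverse J (J x) = x.
Proof. exact: J_inj (JVK _). Qed.
Lemma JJ_ex : exists s : bool, forall x, J (J x) = (-1) ^+ s *: x.
Proof. by case: HD => -[_ [_ _ []]]. Qed.
Lemma JD_ex : exists s : bool, forall x, (dom D (inverse J x) <-> dom D x) /\
  (dom D x -> J (D (inverse J x)) = (-1) ^+ s *: D x).
Proof. by case: HD => -[_ [_ _ []]]. Qed.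
Lemma dom_J x : dom D (J x) <-> dom D x.
Proof. by have [s /(_ (J x)) []] := JD_ex; rewrite VJK => ->. Qed.
Lemma dom_invJ x : dom D (inverse J x) <-> dom D x.
Proof. by rewrite -dom_J JVK. Qed.
Lemma JC a b x :
  act a (J (act b (inverse J x))) = J (act b (inverse J (act a x))).
Proof. by case: HD => -[_ [_ _ []]]. Qed.

(** * The iterated tensor products and their actions *)

Variable E : rightModule A.

Local Notation oact := (opp_act star act J).
Local Notation EH := (@EH C A H act E).
Local Notation HE := (@HE C A star H act J E).
Local Notation EHE := (@EHE C A star H act J E).
Local Notation EHE' := (@EHE' C A star H act J E).
Local Notation EHr := (@EH_r C A star H act J E).
Local Notation HEl := (@HE_l C A star H act J E).
Local Notation mk3 := (@mk3 C A star H act J E).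
Local Notation conj_act := (@conj_act C A star E).

Lemma invJ_anti k x y :
  inverse J (k *: x + y) = k^* *: inverse J x + inverse J y.
Proof. by rewrite -{1}[x]JVK -{1}[y]JVK -{1}[k]conjCK -Janti VJK. Qed.

Lemma oact_linl a : linear (fun y => oact y a).
Proof. by move=> k x y; rewrite /opp_act invJ_anti act_linr Janti conjCK. Qed.
Lemma oact_linr y : linear (oact y).
Proof. by move=> k a b; rewrite /opp_act (star_anti star_involution) act_linl Janti conjCK. Qed.
Lemma oact1 y : oact y 1 = y.
Proof. by rewrite /opp_act (star1 star_involution) act1 JVK. Qed.
Lemma oactM a b y : oact y (a * b) = oact (oact y a) b.
Proof. by rewrite /opp_act (starM star_involution) VJK actM. Qed.
Lemma act_oact a b y : act a (oact y b) = oact (act a y) b.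
Proof. exact: JC. Qed.
Lemma J_act a y : J (act a y) = oact (J y) (star a).
Proof. by rewrite /opp_act (starK star_involution) VJK. Qed.
(** Since the square of J is a sign, the inverse of J is J up to the same sign, which occurs twice
    here. *)
Lemma J_oact y a : J (oact y a) = act (star a) (J y).
Proof.
have [sJ hs] := JJ_ex; have invJE x : inverse J x = (-1) ^+ sJ *: J x.
  by rewrite -{2}[x]JVK hs scalerA -signr_addb addbb scale1r.
rewrite /opp_act hs invJE (linZ (act_linr _)) scalerA -signr_addb addbb.
by rewrite scale1r.
Qed.
Lemma D_oact y a : dom D y -> dom D (oact y a).
Proof. by move=> hy; apply/dom_J/D_act/dom_invJ. Qed.

Section EHr.
Variable a : A.
Let bil : bilinear_map (fun v y => v \ox oact y a : EH).
Proof. exact: tens_map_linear (@linear_id C E) (oact_linl a). Qed.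
Let bal v b y : ract v b \ox oact y a = v \ox oact (act b y) a :> EH.
Proof. by rewrite tensor_balanced act_oact. Qed.
Lemma EHr_linear : linear (fun x => EHr x a).
Proof. exact: tlift_linear bil bal. Qed.
Lemma EHrE v y : EHr (v \ox y) a = v \ox oact y a.
Proof. exact: tlift_tensor v y bil bal. Qed.
End EHr.

Lemma EHr_linr x : linear (EHr x).
Proof.
move=> k a b; move: x; apply: tens_eq => [x y|x y|v y].
- exact: (linD (EHr_linear _)).
- by rewrite !(linD (EHr_linear _)) scalerDr addrACA.
by rewrite !EHrE oact_linr tensor_linearr.
Qed.
Lemma EHr1 x : EHr x 1 = x.
Proof.
move: x; apply: tens_eq => [x y|x y|v y] //; first exact: (linD (EHr_linear _)).
by rewrite EHrE oact1.
Qed.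
Lemma EHrM a b x : EHr x (a * b) = EHr (EHr x a) b.
Proof.
move: x; apply: tens_eq => [x y|x y|v y]; first exact: (linD (EHr_linear _)).
  by rewrite !(linD (EHr_linear _)).
by rewrite !EHrE oactM.
Qed.

Section HEl.
Variable a : A.
Let bil : bilinear_map (fun y w => act a y \ox w : HE).
Proof. exact: tens_map_linear (act_linr a) (@linear_id C _). Qed.
Let bal y b w : act a (oact y b) \ox w = act a y \ox conj_act b w :> HE.
Proof. by rewrite act_oact tensor_balanced. Qed.
Lemma HEl_linear : linear (HEl a).
Proof. exact: tlift_linear bil bal. Qed.
Lemma HElE y w : HEl a (y \ox w) = act a y \ox w.
Proof. exact: tlift_tensor y w bil bal. Qed.
End HEl.

Lemma HEl_linl x : linear (HEl^~ x).
Proof.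
move=> k a b; move: x; apply: tens_eq => [x y|x y|v y].
- exact: (linD (HEl_linear _)).
- by rewrite !(linD (HEl_linear _)) scalerDr addrACA.
by rewrite !HElE act_linl tensor_linearl.
Qed.
Lemma HEl1 x : HEl 1 x = x.
Proof.
move: x; apply: tens_eq => [x y|x y|v y] //; first exact: (linD (HEl_linear _)).
by rewrite HElE act1.
Qed.
Lemma HElM a b x : HEl (a * b) x = HEl a (HEl b x).
Proof.
move: x; apply: tens_eq => [x y|x y|v y]; first exact: (linD (HEl_linear _)).
  by rewrite !(linD (HEl_linear _)).
by rewrite !HElE actM.
Qed.

Section Lift3.
Variables (Y : lmodType C) (f : E -> H -> E -> Y).
Hypotheses (f1 : forall y w, linear (fun v => f v y w)).
Hypotheses (f2 : forall v w, linear (fun y => f v y w)).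
Hypotheses (f3 : forall v y k w w', f v y (k *: w + w') = k^* *: f v y w + f v y w').
Hypotheses (f12 : forall v a y w, f (ract v a) y w = f v (act a y) w).
Hypotheses (f23 : forall v y a w, f v (oact y a) w = f v y (ract w (star a))).

Let g w : EH -> Y := @liftEH C A H act E Y (fun v y => f v y w).
Let bil1 w : bilinear_map (fun v y => f v y w). Proof. by split. Qed.
Let g_linear w : linear (g w).
Proof. exact: tlift_linear (bil1 w) (fun v a y => f12 v a y w). Qed.
Let gE w v y : g w (v \ox y) = f v y w.
Proof. exact: tlift_tensor v y (bil1 w) (fun v a y => f12 v a y w). Qed.
Let bil : bilinear_map (fun z (w : conjv E) => g w z).
Proof.
split=> [w|z] //= k v w.
move: z; apply: tens_eq => [x y|x y|u y].
- exact: (linD (g_linear _)).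
- by rewrite !(linD (g_linear _)) scalerDr addrACA.
by rewrite !gE [k *: v]/(k^* *: (v : E)) f3 conjCK.
Qed.
Let bal z a (w : conjv E) : g w (EHr z a) = g (conj_act a w) z.
Proof.
move: z; apply: tens_eq => [x y|x y|u y].
- by rewrite (linD (EHr_linear _)) (linD (g_linear _)).
- exact: (linD (g_linear _)).
by rewrite EHrE !gE f23.
Qed.

(** Antilinearity of f in its third argument is linearity on the conjugate module; [f12] and [f23]
    balance f over the two tensor signs. *)
Lemma lift3_linear : linear (lift3 f : EHE -> Y).
Proof. exact: tlift_linear bil bal. Qed.
Lemma lift3E v y w : lift3 f (mk3 v y w) = f v y w.
Proof. by rewrite -gE; exact: tlift_tensor (v \ox y) (bar w) bil bal. Qed.
End Lift3.

Lemma mk3_linear1 y w : linear (fun v => mk3 v y w).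
Proof. exact: linear_comp (tensor_linearl _ _ _) (tensor_linearl _ _ _). Qed.
Lemma mk3_linear2 v w : linear (fun y => mk3 v y w).
Proof. exact: linear_comp (tensor_linearl _ _ _) (tensor_linearr _ _ _). Qed.
Lemma mk3_anti3 v y k w w' :
  mk3 v y (k *: w + w') = k^* *: mk3 v y w + mk3 v y w'.
Proof.
rewrite -(tensor_linearr _ _ (v \ox y)); congr (_ \ox _).
by rewrite /bar {2}/GRing.scale /= /conjv_scale conjCK.
Qed.
Lemma mk3_act v a y w : mk3 (ract v a) y w = mk3 v (act a y) w.
Proof. by rewrite /Defs.mk3 tensor_balanced. Qed.
Lemma mk3_oact v y a w : mk3 v (oact y a) w = mk3 v y (ract w (star a)).
Proof. by rewrite /Defs.mk3 -EHrE tensor_balanced. Qed.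

Lemma EHE_ind (Q : EHE -> Prop) : Q 0 -> (forall x y, Q x -> Q y -> Q (x + y)) ->
  (forall v y w, Q (mk3 v y w)) -> forall x, Q x.
Proof.
move=> Q0 QD Q1 x; have [s ->] := tensP x.
elim/big_ind: _ => // -[z w] _ /=; have [t ->] := tensP z.
rewrite (lin_sum (tensor_linearl _ _ _)); elim/big_ind: _ => // -[v y] _.
exact: Q1.
Qed.

Lemma EHE_eq (Y : zmodType) (f g : EHE -> Y) :
  {morph f : x y / x + y} -> {morph g : x y / x + y} ->
  (forall v y w, f (mk3 v y w) = g (mk3 v y w)) -> forall x, f x = g x.
Proof.
move=> fD gD h; apply: EHE_ind => [|x y|//]; first by rewrite !additive0.
by rewrite fD gD => -> ->.
Qed.

Section Assoc.
Let f v y w : EHE' := v \ox ((y \ox bar w) : HE).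
Let f1 y w : linear (fun v => f v y w).
Proof. exact: tensor_linearl. Qed.
Let f2 v w : linear (fun y => f v y w).
Proof. exact: linear_comp (tensor_linearr _ _ _) (tensor_linearl _ _ _). Qed.
Let f3 v y k w w' : f v y (k *: w + w') = k^* *: f v y w + f v y w'.
Proof.
rewrite /f -(tensor_linearr _ _ v) -tensor_linearr; congr (_ \ox (_ \ox _)).
by rewrite /bar {2}/GRing.scale /= /conjv_scale conjCK.
Qed.
Let f12 v a y w : f (ract v a) y w = f v (act a y) w.
Proof. by rewrite /f tensor_balanced HElE. Qed.
Let f23 v y a w : f v (oact y a) w = f v y (ract w (star a)).
Proof. by rewrite /f tensor_balanced. Qed.
Lemma assoc_linear : linear (@assoc C A star H act J E).
Proof. exact: (lift3_linear f1 f2 f3 f12 f23). Qed.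
Lemma assocE v y w :
  @assoc C A star H act J E (mk3 v y w) = v \ox ((y \ox bar w) : HE).
Proof. exact: (lift3E f1 f2 f3 f12 f23). Qed.
End Assoc.

Definition unassoc : EHE' -> EHE :=
  tlift (fun v z => tlift (fun y w => ((v \ox y) : EH) \ox w) z).

Section Unassoc.
Let f v : HE -> EHE := tlift (fun y w => ((v \ox y) : EH) \ox w).
Let bil1 v : bilinear_map (fun y w => ((v \ox y) : EH) \ox w : EHE).
Proof. exact: tens_map_linear (tensor_linearr _ _ v) (@linear_id C _). Qed.
Let bal1 v y a w :
  ((v \ox oact y a) : EH) \ox w = ((v \ox y) : EH) \ox conj_act a w :> EHE.
Proof. by rewrite -EHrE tensor_balanced. Qed.
Let f_linear v : linear (f v).
Proof. exact: tlift_linear (bil1 v) (bal1 v). Qed.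
Let fE v y w : f v (y \ox w) = ((v \ox y) : EH) \ox w.
Proof. exact: tlift_tensor y w (bil1 v) (bal1 v). Qed.
Let bil : bilinear_map f.
Proof.
split=> // z k v v'; move: z; apply: tens_eq => [x y|x y|y w].
- exact: (linD (f_linear _)).
- by rewrite !(linD (f_linear _)) scalerDr addrACA.
by rewrite !fE !tensor_linearl.
Qed.
Let bal v a z : f (ract v a) z = f v (HEl a z).
Proof.
move: z; apply: tens_eq => [x y|x y|y w].
- exact: (linD (f_linear _)).
- by rewrite (linD (HEl_linear _)) (linD (f_linear _)).
by rewrite HElE !fE tensor_balanced.
Qed.
Lemma unassoc_linear : linear unassoc.
Proof. exact: tlift_linear bil bal. Qed.
Lemma unassocE v y w : unassoc (v \ox ((y \ox w) : HE)) = ((v \ox y) : EH) \ox w.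
Proof. by rewrite -fE; exact: tlift_tensor v (y \ox w) bil bal. Qed.
End Unassoc.

Local Notation assoc := (@assoc C A star H act J E).

Lemma EHE'_eq (Y : zmodType) (f g : EHE' -> Y) :
  {morph f : x y / x + y} -> {morph g : x y / x + y} ->
  (forall v y w, f (v \ox ((y \ox w) : HE)) = g (v \ox ((y \ox w) : HE))) ->
  forall x, f x = g x.
Proof.
move=> fD gD h; apply: tens_eq => // v.
apply: tens_eq => [x y|x y|y w //].
  by rewrite (linD (tensor_linearr _ _ _)) fD.
by rewrite (linD (tensor_linearr _ _ _)) gD.
Qed.

Lemma assocK : cancel assoc unassoc.
Proof.
apply: EHE_eq => // [x y|v y w].
  by rewrite (linD assoc_linear) (linD unassoc_linear).
by rewrite assocE unassocE.
Qed.
Lemma unassocK : cancel unassoc assoc.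
Proof.
apply: EHE'_eq => // [x y|v y w].
  by rewrite (linD unassoc_linear) (linD assoc_linear).
by rewrite unassocE; exact: assocE.
Qed.
Lemma assoc_bij : bijective assoc.
Proof. exact: Bijective assocK unassocK. Qed.

Lemma J'_exists : exists J', @is_J' _ A star H act J E J'.
Proof.
pose g v y w : conjv EHE := mk3 w (J y) v.
have g1 y w : linear (fun v => g v y w).
  by move=> k v v'; rewrite /g mk3_anti3.
have g2 v w : linear (fun y => g v y w).
  by move=> k y y'; rewrite /g Janti mk3_linear2.
have g3 v y k w w' : g v y (k *: w + w') = k^* *: g v y w + g v y w'.
  by rewrite /g mk3_linear1 {2}/GRing.scale /= /conjv_scale conjCK.
have g12 v a y w : g (ract v a) y w = g v (act a y) w.
  by rewrite /g J_act mk3_oact (starK star_involution).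
have g23 v y a w : g v (oact y a) w = g v y (ract w (star a)).
  by rewrite /g J_oact mk3_act.
exists (lift3 g); split; first exact: (lift3_linear g1 g2 g3 g12 g23).
by move=> v y w; exact: (lift3E g1 g2 g3 g12 g23).
Qed.

Section EndAct.
Variable S : endA E.
Local Notation eact := (@end_act C A star H act J E S).
Let f1 y w : linear (fun v => mk3 (S v) y w).
Proof. exact: linear_comp (mk3_linear1 y w) (endA_lin S). Qed.
Let f2 v w : linear (fun y => mk3 (S v) y w).
Proof. exact: mk3_linear2. Qed.
Let f3 v y k w w' : mk3 (S v) y (k *: w + w') = k^* *: mk3 (S v) y w + mk3 (S v) y w'.
Proof. exact: mk3_anti3. Qed.
Let f12 v a y w : mk3 (S (ract v a)) y w = mk3 (S v) (act a y) w.
Proof. by rewrite endA_ract mk3_act. Qed.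
Let f23 v y a w : mk3 (S v) (oact y a) w = mk3 (S v) y (ract w (star a)).
Proof. exact: mk3_oact. Qed.
Lemma end_act_linear : linear eact.
Proof. exact: (lift3_linear f1 f2 f3 f12 f23). Qed.
Lemma end_actE v y w : eact (mk3 v y w) = mk3 (S v) y w.
Proof. exact: (lift3E f1 f2 f3 f12 f23). Qed.
End EndAct.

Lemma end_act_linl x : linear (fun S => @end_act C A star H act J E S x).
Proof.
move=> k S T; move: x; apply: EHE_eq => [x y|x y|v y w].
- exact: (linD (end_act_linear _)).
- by rewrite !(linD (end_act_linear _)) scalerDr addrACA.
by rewrite !end_actE; exact: mk3_linear1.
Qed.
Lemma end_act1 x : @end_act C A star H act J E (1 : endA E) x = x.
Proof.
move: x; apply: EHE_eq => [x y|x y|v y w] //; first exact: (linD (end_act_linear _)).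
by rewrite end_actE.
Qed.
Lemma end_actM (S T : endA E) x : @end_act C A star H act J E (S * T) x =
  @end_act C A star H act J E S (@end_act C A star H act J E T x).
Proof.
move: x; apply: EHE_eq => [x y|x y|v y w]; first exact: (linD (end_act_linear _)).
  by rewrite !(linD (end_act_linear _)).
by rewrite !end_actE.
Qed.

(** * Coordinates in M_n(H) and existence of the twisted operators *)

Variables (n : nat) (e : 'M[A]_n) (phi : E -> 'cV[A]_n).
Hypotheses (he : e *m e = e) (hphi : iso_onto_eAn e phi).
Variable b : 'I_n -> E.
Hypothesis hb : forall i j, phi (b j) i 0 = e i j.

Local Notation crd i := (fun v => phi v i 0 : A).
Local Notation entry := (@entry C A star H act J E n phi).

Section Entry.
Variables i j : 'I_n.
Let f v y w : H := act (phi v i 0) (J (act (phi w j 0) (inverse J y))).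
Let f1 y w : linear (fun v => f v y w).
Proof. exact: linear_comp (act_linl _) (phi_linear hphi i). Qed.
Let f2 v w : linear (fun y => f v y w).
Proof. by move=> k x y; rewrite /f invJ_anti act_linr Janti act_linr conjCK. Qed.
Let f3 v y k w w' : f v y (k *: w + w') = k^* *: f v y w + f v y w'.
Proof. by rewrite /f (phi_linear hphi) act_linl Janti act_linr. Qed.
Let f12 v a y w : f (ract v a) y w = f v (act a y) w.
Proof. by rewrite /f (phi_ract hphi) actM JC. Qed.
Let f23 v y a w : f v (oact y a) w = f v y (ract w (star a)).
Proof. by rewrite /f (phi_ract hphi) actM /opp_act VJK. Qed.
Lemma entry_linear : linear (entry i j).
Proof. exact: (lift3_linear f1 f2 f3 f12 f23). Qed.
Lemma entryE v y w :
  entry i j (mk3 v y w) = act (phi v i 0) (oact y (star (phi w j 0))).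
Proof.
rewrite -[RHS]/(act _ (J (act (star (star _)) (inverse J y)))) (starK star_involution).
exact: (lift3E f1 f2 f3 f12 f23).
Qed.
End Entry.

(** The dual basis is used in both outer factors. The entries form a frame and not a basis:
    composing in the other order gives pi(e) pi^(e) on M_n(H). *)
Lemma entryK x : \sum_i \sum_j mk3 (b i) (entry i j x) (b j) = x.
Proof.
move: x; apply: EHE_eq => [x y|x y|v y w] //.
  rewrite -big_split /=; apply: eq_bigr => i _; rewrite -big_split /=.
  by apply: eq_bigr => j _; rewrite (linD (entry_linear i j)) (linD (mk3_linear2 _ _)).
have hv := dual_basisE he hphi hb v; have hw := dual_basisE he hphi hb w.
rewrite {2}hv (lin_sum (mk3_linear1 _ _)); apply: eq_bigr => i _.
rewrite {2}hw (anti_sum (mk3_anti3 _ _)); apply: eq_bigr => j _.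
by rewrite entryE -mk3_act mk3_oact (starK star_involution).
Qed.

Variables (nabla : E -> connection_target E) (hnabla : universal_connection nabla).

Lemma operators_exist :
  exists (D1 : operator EH) (D2 : operator HE) (D' : operator EHE) (D'' : operator EHE'),
    [/\ is_one_tensor nabla D D1, is_tensor_one nabla D D2,
        is_tensor_one nabla D1 D' & is_one_tensor nabla D2 D''].
Proof.
pose c j v : A := phi v j 0.
have cl j : linear (c j) := phi_linear hphi j.
have cr j v a : c j (ract v a) = c j v * a := phi_ract hphi v a j.
have bc v : v = \sum_j ract (b j) (c j v) := dual_basisE he hphi hb v.
have [D1 hD1] := one_tensor_exists hnabla act_linr act_linl act1 actM D_linear D_act cl cr bc.
have [D2 hD2] := tensor_one_exists star_involution hnabla oact_linl oact_linr oact1 oactM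
  D_linear (fun a y => @D_oact y a) cl cr bc.
have [lD1 dD1 _] := hD1; have [lD2 dD2 _] := hD2.
(* The second twist needs the domain of the first one to be stable under the remaining action of
   A. *)
have D1r a (x : EH) : dom D1 x -> dom D1 (EHr x a).
  rewrite dD1; move: x; apply: (span_pairs_ind (P := fun p : E * H => dom D p.2)
    (Q := fun x => span_pairs _ (EHr x a))).
  - by rewrite (lin0 (EHr_linear a)); exact: span_pairs0.
  - by move=> x y; rewrite (linD (EHr_linear a)); exact: span_pairsD.
  - by move=> v y hy; rewrite EHrE; apply/span_pairs1/D_oact.
have D2l a (x : HE) : dom D2 x -> dom D2 (HEl a x).
  rewrite dD2; move: x; apply: (span_pairs_ind (P := fun p : H * conjv E => dom D p.1)
    (Q := fun x => span_pairs _ (HEl a x))).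
  - by rewrite (lin0 (HEl_linear a)); exact: span_pairs0.
  - by move=> x y; rewrite (linD (HEl_linear a)); exact: span_pairsD.
  - by move=> v y hy; rewrite HElE; apply/span_pairs1/D_act.
have [D' hD'] := tensor_one_exists star_involution hnabla EHr_linear EHr_linr EHr1 EHrM lD1 D1r cl cr bc.
have [D'' hD''] := one_tensor_exists hnabla HEl_linear HEl_linl HEl1 HElM lD2 D2l cl cr bc.
by exists D1, D2, D', D''; split.
Qed.

(** * The iterated twists and their equality *)

Section TwistedOperator.
Variables (D1 : operator EH) (D2 : operator HE) (D' : operator EHE) (D'' : operator EHE').
Hypotheses (hD1 : is_one_tensor nabla D D1) (hD2 : is_tensor_one nabla D D2).
Hypotheses (hD' : is_tensor_one nabla D1 D') (hD'' : is_one_tensor nabla D2 D'').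

Lemma D1_linear : linear_operator D1. Proof. by case: hD1. Qed.
Lemma D'_linear : linear_operator D'. Proof. by case: hD'. Qed.
Lemma D''_linear : linear_operator D''. Proof. by case: hD''. Qed.

Lemma dom_D1_ind (Q : EH -> Prop) : Q 0 ->
  (forall x y, Q x -> Q y -> Q (x + y)) ->
  (forall v y, dom D y -> Q (v \ox y)) -> forall x, dom D1 x -> Q x.
Proof.
move=> Q0 QD Q1; case: hD1 => _ -> _.
exact: (span_pairs_ind (P := fun p : E * H => dom D p.2)).
Qed.
Lemma dom_D1 v y : dom D y -> dom D1 (v \ox y).
Proof.
by case: hD1 => _ -> _ hy; apply: (span_pairs1 _ _ (P := fun p : E * H => dom D p.2)).
Qed.
Lemma dom_D2 y w : dom D y -> dom D2 (y \ox w).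
Proof.
by case: hD2 => _ -> _ hy; apply: (span_pairs1 _ _ (P := fun p : H * conjv E => dom D p.1)).
Qed.

Lemma dom_D'_ind (Q : EHE -> Prop) : Q 0 ->
  (forall x y, Q x -> Q y -> Q (x + y)) ->
  (forall v y w, dom D y -> Q (mk3 v y w)) -> forall x, dom D' x -> Q x.
Proof.
move=> Q0 QD Q1; case: hD' => _ -> _.
apply: (span_pairs_ind (P := fun p : EH * conjv E => dom D1 p.1)) => // z w /= hz.
apply: (dom_D1_ind (Q := fun z => Q (z \ox w))) hz.
- by rewrite (lin0 (tensor_linearl _ _ _)).
- by move=> x y; rewrite (linD (tensor_linearl _ _ _)); exact: QD.
- by move=> v y; exact: Q1.
Qed.
Lemma dom_D' v y w : dom D y -> dom D' (mk3 v y w).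
Proof.
case: hD' => _ -> _ /(dom_D1 v) hy.
by apply: (span_pairs1 _ _ (P := fun p : EH * conjv E => dom D1 p.1)).
Qed.

Lemma dom_D'' v y w : dom D y -> dom D'' (v \ox ((y \ox w) : HE)).
Proof.
case: hD'' => _ -> _ /(dom_D2 w) hy.
by apply: (span_pairs1 _ _ (P := fun p : E * HE => dom D2 p.2)).
Qed.

Lemma dom_unassoc z : dom D'' z -> dom D' (unassoc z).
Proof.
case: hD'' => _ -> _; move: z.
apply: (span_pairs_ind (P := fun p : E * HE => dom D2 p.2)
  (Q := fun z => dom D' (unassoc z))).
- by rewrite (lin0 unassoc_linear); exact: (dom0 D'_linear).
- by move=> x y; rewrite (linD unassoc_linear); exact: (domD D'_linear).
move=> v z /=; case: hD2 => _ -> _; move: z.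
apply: (span_pairs_ind (P := fun p : H * conjv E => dom D p.1)
  (Q := fun z => dom D' (unassoc (v \ox z)))).
- by rewrite (lin0 (tensor_linearr _ _ _)) (lin0 unassoc_linear); exact: (dom0 D'_linear).
- move=> x y; rewrite (linD (tensor_linearr _ _ _)) (linD unassoc_linear).
  exact: (domD D'_linear).
by move=> y w /= hy; rewrite unassocE; exact: dom_D'.
Qed.

(** Here [s] and [t] present nabla(v) and nabla(w). The terms are grouped as an outer right twist
    produces them; [sum_regroup] relates this to the grouping of an outer left twist. *)
Definition twisted_terms (s t : seq (E * A * A)) v y w : EHE :=
  (\sum_(q <- s) mk3 q.1.1 (act q.1.2 (commutator D (act q.2) y)) w
     + mk3 v (D y) w) +
  \sum_(p <- t) (\sum_(q <- s) mk3 q.1.1 (act q.1.2 (oact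
         (commutator (commutator D (act q.2)) (oact^~ (star p.2)) y)
         (star p.1.2))) p.1.1
     + mk3 v (oact (commutator D (oact^~ (star p.2)) y) (star p.1.2)) p.1.1).

Lemma D'_formula v y w (s t : seq (E * A * A)) : dom D y ->
  nabla v = \sum_(p <- s) p.1.1 \ox form p.1.2 p.2 ->
  nabla w = \sum_(p <- t) p.1.1 \ox form p.1.2 p.2 ->
  D' (mk3 v y w) = twisted_terms s t v y w.
Proof.
move=> hy hs ht.
have hD1E z : dom D z -> D1 (v \ox z) =
    \sum_(p <- s) p.1.1 \ox act p.1.2 (commutator D (act p.2) z) + v \ox D z.
  by move=> hz; case: hD1 => _ _ /(_ v z s hz hs).
rewrite (tensor_one_formula star_involution EHr_linear EHr_linr EHr1 EHrM D1_linear _ hD' _ ht);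
  last exact: dom_D1.
  rewrite hD1E // (linD (tensor_linearl _ _ _)) (lin_sum (tensor_linearl _ _ _)).
  congr (_ + _); apply: eq_bigr => p _.
  have hyp := D_oact (star p.2) hy.
  rewrite [commutator D1 _ _]/commutator EHrE !hD1E // (linB (EHr_linear _)).
  rewrite !(linD (EHr_linear _)) opprD addrACA !EHrE.
  rewrite -(linB (tensor_linearr _ _ _)) -(linB (oact_linl _)).
  rewrite (linD (tensor_linearl _ _ _)); congr (_ + _).
  rewrite (lin_sum (EHr_linear (star p.2))) !(lin_sum (EHr_linear (star p.1.2))) -sumrB.
  rewrite (lin_sum (tensor_linearl _ _ _)); apply: eq_bigr => q _.
  rewrite !EHrE -(linB (tensor_linearr _ _ _)); congr ((_ \ox _) \ox _).
  by rewrite -!act_oact -(linB (act_linr _)) -(linB (oact_linl _)).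
move=> a x; apply: (dom_D1_ind (Q := fun x => dom D1 (EHr x a))).
- by rewrite (lin0 (EHr_linear a)); exact: (dom0 D1_linear).
- by move=> x1 x2; rewrite (linD (EHr_linear a)); exact: (domD D1_linear).
- by move=> u z hz; rewrite EHrE; apply/dom_D1/D_oact.
Qed.

(** A Jacobi identity, whose third term [D, [a, R_c]] vanishes because the two actions commute. The
    double commutator itself may be nonzero, and the two iterated twists have to share it. *)
Lemma commutator_swap a c y : dom D y ->
  commutator D (oact^~ c) (act a y) - act a (commutator D (oact^~ c) y) =
  commutator (commutator D (act a)) (oact^~ c) y.
Proof.
move=> hy; rewrite /commutator (linB (act_linr _)) (linB (oact_linl _)).
rewrite !act_oact !opprB !addrA [LHS]addrAC [RHS]addrAC; congr (_ + _).
by rewrite addrAC.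
Qed.

Lemma D2_formula z w (t : seq (E * A * A)) : dom D z ->
  nabla w = \sum_(p <- t) p.1.1 \ox form p.1.2 p.2 ->
  D2 (z \ox bar w) = D z \ox bar w + \sum_(p <- t)
    oact (commutator D (oact^~ (star p.2)) z) (star p.1.2) \ox bar p.1.1.
Proof.
move=> hz ht; exact: (tensor_one_formula star_involution oact_linl oact_linr oact1 oactM
  D_linear (fun a y => @D_oact y a) hD2 hz ht).
Qed.

Lemma D2_commutator a z w (t : seq (E * A * A)) : dom D z ->
  nabla w = \sum_(p <- t) p.1.1 \ox form p.1.2 p.2 ->
  commutator D2 (HEl a) (z \ox bar w) = commutator D (act a) z \ox bar w +
    \sum_(p <- t) oact (commutator (commutator D (act a)) (oact^~ (star p.2)) z)
       (star p.1.2) \ox bar p.1.1.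
Proof.
move=> hz ht; rewrite {1}/commutator HElE.
rewrite (D2_formula (D_act a hz) ht) (D2_formula hz ht).
rewrite (linD (HEl_linear a)) HElE (lin_sum (HEl_linear a)) opprD addrACA -sumrB.
rewrite -(linB (tensor_linearl _ _ _)); congr (_ + _).
apply: eq_bigr => p _; rewrite HElE -(linB (tensor_linearl _ _ _)).
rewrite -commutator_swap // act_oact; congr (_ \ox _).
exact/esym/(linB (oact_linl _)).
Qed.

Lemma sum_regroup (Y : zmodType) (I K : Type) (s : seq I) (t : seq K)
    (F : I -> Y) (G : K -> I -> Y) (a : Y) (B : K -> Y) :
  \sum_(q <- s) (F q + \sum_(p <- t) G p q) + (a + \sum_(p <- t) B p) =
  (\sum_(q <- s) F q + a) + \sum_(p <- t) (\sum_(q <- s) G p q + B p).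
Proof. by rewrite !big_split /= addrACA exchange_big. Qed.

Lemma D''_formula v y w (s t : seq (E * A * A)) : dom D y ->
  nabla v = \sum_(p <- s) p.1.1 \ox form p.1.2 p.2 ->
  nabla w = \sum_(p <- t) p.1.1 \ox form p.1.2 p.2 ->
  D'' (v \ox ((y \ox bar w) : HE)) = assoc (twisted_terms s t v y w).
Proof.
move=> hy hs ht.
pose T u x u' : EHE' := u \ox ((x \ox bar u') : HE).
have TE u x u' : assoc (mk3 u x u') = T u x u' := assocE u x u'.
pose X1 (q : E * A * A) := act q.1.2 (commutator D (act q.2) y).
pose X2 (p : E * A * A) := oact (commutator D (oact^~ (star p.2)) y) (star p.1.2).
pose X3 (p q : E * A * A) := act q.1.2 (oact
  (commutator (commutator D (act q.2)) (oact^~ (star p.2)) y) (star p.1.2)).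
transitivity ((\sum_(q <- s) T q.1.1 (X1 q) w + T v (D y) w) +
  \sum_(p <- t) (\sum_(q <- s) T q.1.1 (X3 p q) p.1.1 + T v (X2 p) p.1.1)).
  case: hD'' => _ _ /(_ v (y \ox bar w) s (dom_D2 _ hy) hs) ->.
  rewrite -sum_regroup; congr (_ + _); last first.
    rewrite (D2_formula hy ht) (linD (tensor_linearr _ _ _)).
    by rewrite (lin_sum (tensor_linearr _ _ _)).
  apply: eq_bigr => q _; rewrite (D2_commutator q.2 hy ht).
  rewrite (linD (HEl_linear q.1.2)) HElE (lin_sum (HEl_linear q.1.2)).
  rewrite (linD (tensor_linearr _ _ _)) (lin_sum (tensor_linearr _ _ _)).
  by congr (_ + _); apply: eq_bigr => p _; rewrite HElE.
rewrite /twisted_terms (linD assoc_linear) (linD assoc_linear) TE.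
rewrite (lin_sum assoc_linear) (lin_sum assoc_linear); congr (_ + _ + _).
  by apply: eq_bigr => q _; rewrite TE.
apply: eq_bigr => p _; rewrite (linD assoc_linear) TE (lin_sum assoc_linear).
by congr (_ + _); apply: eq_bigr => q _; rewrite TE.
Qed.

Lemma same_operator_twist : same_operator D' D''.
Proof.
(* An operator is additive only on its domain, and [dom_D'_ind] forgets the domain hypothesis;
   membership is therefore carried through the induction. The same device recurs below. *)
have key : forall x, dom D' x ->
    [/\ dom D' x, dom D'' (assoc x) & assoc (D' x) = D'' (assoc x)].
  apply: dom_D'_ind.
  - rewrite (op0 D'_linear) (lin0 assoc_linear) (op0 D''_linear).
    by split=> //; [exact: (dom0 D'_linear)|exact: (dom0 D''_linear)].
  - move=> x y [x1 x2 x3] [y1 y2 y3]; rewrite (linD assoc_linear).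
    rewrite (opD D'_linear) // (opD D''_linear) // (linD assoc_linear) x3 y3.
    by split=> //; [exact: (domD D'_linear)|exact: (domD D''_linear)].
  move=> v y w hy; have [s hs] := connection_sumP (nabla v).
  have [t ht] := connection_sumP (nabla w).
  rewrite assocE (D''_formula hy hs ht) (D'_formula hy hs ht).
  by split=> //; [exact: dom_D'|exact: dom_D''].
move=> x; split=> [|/key [] //]; split=> [/key [] //|].
by move=> /dom_unassoc; rewrite assocK.
Qed.

Lemma J_D : exists s : bool, forall y, dom D y -> D (J y) = (-1) ^+ s *: J (D y).
Proof.
have [s hs] := JD_ex; exists s => y hy.
have [_ /(_ _)] := hs (J y); rewrite VJK => -> //; last exact/dom_J.
by rewrite scalerA -signr_addb addbb scale1r.
Qed.

(** J turns right multiplication by [star a] into left multiplication by a, and commutes with D up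
    to a sign. *)
Lemma commutator_J (s : bool) : (forall y, dom D y -> D (J y) = (-1) ^+ s *: J (D y)) ->
  forall a y, dom D y ->
    commutator D (act a) (J y) = (-1) ^+ s *: J (commutator D (oact^~ (star a)) y).
Proof.
move=> hs a y hy; have yJ := J_oact y (star a); rewrite (starK star_involution) in yJ.
rewrite /commutator -yJ (hs _ (D_oact (star a) hy)) (hs _ hy).
rewrite (antiB Janti) scalerBr; congr (_ - _).
by rewrite (linZ (act_linr _)) J_oact (starK star_involution).
Qed.

Lemma commutator_J_oact (s : bool) :
  (forall y, dom D y -> D (J y) = (-1) ^+ s *: J (D y)) -> forall a y, dom D y ->
  commutator D (oact^~ (star a)) (J y) = (-1) ^+ s *: J (commutator D (act a) y).
Proof.
move=> hs a y hy; rewrite /commutator -J_act (hs _ (D_act a hy)) (hs _ hy).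
rewrite (antiB Janti) scalerBr; congr (_ - _).
by rewrite (linZ (oact_linl _)) -J_act.
Qed.

Lemma commutator2_J (s : bool) :
  (forall y, dom D y -> D (J y) = (-1) ^+ s *: J (D y)) -> forall a c y, dom D y ->
  commutator (commutator D (act a)) (oact^~ (star c)) (J y) =
  (-1) ^+ s *: J (commutator (commutator D (act c)) (oact^~ (star a)) y).
Proof.
move=> hs a c y hy; rewrite {1}/commutator -J_act (commutator_J hs a (D_act c hy)) (commutator_J hs a hy).
by rewrite (linZ (oact_linl _)) -J_act -scalerBr -(antiB Janti) commutator_swap.
Qed.

(** * The real structure on the twisted space *)

Section RealStructure.
Variable J' : EHE -> EHE.
Hypothesis hJ' : is_J' J'.

Lemma J'_anti : antilinear J'. Proof. by case: hJ'. Qed.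
Lemma J'E v y w : J' (mk3 v y w) = mk3 w (J y) v. Proof. by case: hJ'. Qed.

Lemma J'J' (s : bool) : (forall y, J (J y) = (-1) ^+ s *: y) ->
  forall x, J' (J' x) = (-1) ^+ s *: x.
Proof.
move=> hs; apply: EHE_eq => [x y|x y|v y w].
- by rewrite !(antiD J'_anti).
- by rewrite scalerDr.
by rewrite !J'E hs (linZ (mk3_linear2 _ _)).
Qed.

Lemma J'_surj y : exists x, J' x = y.
Proof.
have [s hs] := JJ_ex; exists ((-1) ^+ s *: J' y).
rewrite (antiZ J'_anti) rmorph_sign (J'J' hs) scalerA -signr_addb addbb.
by rewrite scale1r.
Qed.
Lemma J'VK : cancel (inverse J') J'.
Proof. exact: inverseK J'_surj. Qed.
Lemma J'_inj : injective J'.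
Proof.
have [s hs] := JJ_ex; move=> x y hxy; have := congr1 J' hxy.
rewrite !(J'J' hs) => /(congr1 (fun z => (-1) ^+ s *: z)).
by rewrite !scalerA -signr_addb addbb !scale1r.
Qed.
Lemma VJ'K : cancel J' (inverse J').
Proof. by move=> x; apply: J'_inj; exact: J'VK. Qed.

(** This will make J' isometric, since [dot3] sums over all pairs (i, j) and is insensitive to a
    transposition of indices. *)
Lemma entry_J' i j x : entry i j (J' x) = J (entry j i x).
Proof.
move: x; apply: EHE_eq => [x y|x y|v y w].
- by rewrite (antiD J'_anti) (linD (entry_linear i j)).
- by rewrite (linD (entry_linear j i)) (antiD Janti).
by rewrite J'E !entryE J_act J_oact (starK star_involution) act_oact.
Qed.

Lemma dom_J' x : dom D' x -> dom D' (J' x).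
Proof.
move: x; apply: dom_D'_ind.
- by rewrite (anti0 J'_anti); exact: (dom0 D'_linear).
- by move=> x y; rewrite (antiD J'_anti); exact: (domD D'_linear).
by move=> v y w hy; rewrite J'E; apply/dom_D'/dom_J.
Qed.

Lemma D'_J' (s : bool) : (forall y, dom D y -> D (J y) = (-1) ^+ s *: J (D y)) ->
  forall x, dom D' x -> D' (J' x) = (-1) ^+ s *: J' (D' x).
Proof.
move=> hs x hx.
suff : dom D' x /\ D' (J' x) = (-1) ^+ s *: J' (D' x) by case.
move: x hx; apply: dom_D'_ind.
- rewrite (anti0 J'_anti) (op0 D'_linear) (anti0 J'_anti) scaler0.
  by split=> //; exact: (dom0 D'_linear).
- move=> x y [x1 x2] [y1 y2]; split; first exact: (domD D'_linear).
  rewrite (antiD J'_anti) (opD D'_linear) // ?(opD D'_linear) //; try exact: dom_J'.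
  by rewrite (antiD J'_anti) scalerDr x2 y2.
move=> v y w hy; split; first exact: dom_D'.
have [l hl] := connection_sumP (nabla v); have [m hm] := connection_sumP (nabla w).
have sgn u z u' : (-1) ^+ s *: J' (mk3 u z u') = mk3 u' ((-1) ^+ s *: J z) u.
  by rewrite J'E (linZ (mk3_linear2 _ _)).
have J'sum (r : seq (E * A * A)) (F : E * A * A -> EHE) :
    (-1) ^+ s *: J' (\sum_(p <- r) F p) = \sum_(p <- r) (-1) ^+ s *: J' (F p).
  by rewrite (anti_sum J'_anti) scaler_sumr.
have J'add x1 x2 : (-1) ^+ s *: J' (x1 + x2) = (-1) ^+ s *: J' x1 + (-1) ^+ s *: J' x2.
  by rewrite (antiD J'_anti) scalerDr.
(* As v and w trade places, so do their presentations: the two groups of single commutators are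
   exchanged, and the double commutators correspond by [commutator2_J]. Regrouping one side by
   [sum_regroup] aligns the sums. *)
rewrite J'E (D'_formula _ hm hl); last exact/dom_J.
rewrite (D'_formula hy hl hm) /twisted_terms -sum_regroup addrC.
rewrite !J'add sgn -(hs y hy) !J'sum; congr (_ + _).
  rewrite addrC; congr (_ + _); apply: eq_bigr => p _.
  by rewrite sgn J_act (commutator_J_oact hs) // (linZ (oact_linl _)).
apply: eq_bigr => p _; rewrite J'add J'sum sgn addrC J_oact (starK star_involution).
congr (_ + _); last first.
  by rewrite (commutator_J hs) // (linZ (act_linr _)).
apply: eq_bigr => q _; rewrite sgn (commutator2_J hs) // J_act J_oact (starK star_involution).
by rewrite (linZ (oact_linl _)) (linZ (act_linr _)) act_oact.
Qed.
End RealStructure.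

(** Polarisation. The defect f satisfies f u v + f v u = 0, because J preserves the norm of u + v;
    replacing v by 'i v gives f u v = f v u, hence 2 f = 0. *)
Lemma dotJ x y : dot (J x) (J y) = dot y x.
Proof.
have dJ z : dot (J z) (J z) = dot z z.
  by rewrite -[LHS]sqrtCK -[RHS]sqrtCK; congr (_ ^+ 2); exact: J_norm.
pose f u v := dot (J u) (J v) - dot v u.
have polar u v : f u v + f v u = 0.
  have := dJ (u + v); rewrite (antiD Janti) !(dotDl dot_form) !(dotDr dot_form) !dJ.
  rewrite -!addrA => /addrI; rewrite !addrA => /addIr h.
  by rewrite /f -addrA addrACA h -opprD [dot v u + _]addrC subrr.
have fi u v : f u ('i *: v) = 'i * f u v.
  by rewrite /f (antiZ Janti) (dotZr dot_form) (dotZl dot_form) conjCK mulrBr.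
have fi' u v : f ('i *: v) u = - 'i * f v u.
  by rewrite /f (antiZ Janti) (dotZr dot_form) (dotZl dot_form) conjCi mulrBr.
have h1 := polar x y; have := polar x ('i *: y).
rewrite fi fi' mulNr -mulrBr => /eqP; rewrite mulf_eq0 (negPf (neq0Ci _)) /= => /eqP h2.
have : f x y *+ 2 = 0.
  by rewrite mulr2n -{1}[f x y](subrK (f y x)) h2 add0r addrC h1.
by move=> /eqP; rewrite mulrn_eq0 /= subr_eq0 => /eqP.
Qed.

Lemma dot_oact x y a : dot (oact x a) y = dot x (oact y (star a)).
Proof.
rewrite -{1}[y]JVK dotJ /opp_act (starK star_involution) -{2}[x]JVK dotJ.
by rewrite [RHS]act_star.
Qed.

(** * The hermitian structure of E and the adjoint on its endomorphisms *)

Hypothesis hes : forall i j, star (e i j) = e j i.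
Local Notation herm := (@herm C A E star n phi).

Lemma star_sum (I : Type) (r : seq I) (F : I -> A) :
  star (\sum_(i <- r) F i) = \sum_(i <- r) star (F i).
Proof. exact: (anti_sum (star_anti star_involution)). Qed.
Lemma herm_star v w : star (herm v w) = herm w v.
Proof.
rewrite star_sum; apply: eq_bigr => i _.
by rewrite (starM star_involution) (starK star_involution).
Qed.
Lemma herm_linearr v : linear (herm v).
Proof.
move=> k x y; rewrite /Defs.herm scaler_sumr -big_split /=.
by apply: eq_bigr => i _; rewrite (phi_linear hphi) pz_mul_linearr.
Qed.
Lemma herm_antil w k u v : herm (k *: u + v) w = k^* *: herm u w + herm v w.
Proof.
by rewrite -herm_star herm_linearr (star_anti star_involution) !herm_star.
Qed.
Lemma herm_ractr v w a : herm v (ract w a) = herm v w * a.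
Proof.
rewrite /Defs.herm mulr_suml; apply: eq_bigr => i _.
by rewrite (phi_ract hphi) mulrA.
Qed.
Lemma herm_ractl v w a : herm (ract v a) w = star a * herm v w.
Proof. by rewrite -herm_star herm_ractr (starM star_involution) herm_star. Qed.
(** Self-adjointness of e turns its j-th column, once starred, into its j-th row, and e fixes
    [phi w]. Nondegeneracy of [herm] follows. *)
Lemma herm_b j w : herm (b j) w = phi w j 0.
Proof.
rewrite -[in RHS](phi_fix he hphi w) mxE; apply: eq_bigr => i _.
by rewrite hb hes.
Qed.
Lemma herm_inj w w' : (forall v, herm v w = herm v w') -> w = w'.
Proof.
move=> h; have [_ _ inj _] := hphi; apply: inj; apply/matrixP => i j.
by rewrite (ord1 j) -!herm_b.
Qed.

Lemma endA_starP (S : endA E) v w : herm (endA_star star phi S v) w = herm v (S w).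
Proof.
(* An adjoint of S must have the coordinates (b_k, S^* v) = (S b_k, v), and the dual basis then
   forces this formula. As an adjoint exists, [xget] does not fall back on its default 0. *)
pose f v := \sum_k ract (b k) (herm (S (b k)) v).
have f_end : f \in @is_endomorphism C A E.
  apply/asboolP; split.
    move=> c u u'; rewrite /f scaler_sumr -big_split /=; apply: eq_bigr => k _.
    by rewrite herm_linearr ract_linr.
  move=> u a; rewrite /f (lin_sum (ract_linl a)); apply: eq_bigr => k _.
  by rewrite herm_ractr ractM.
have : [set T : endA E | forall v w, herm (T v) w = herm v (S w)]%classic (EndA f_end).
  move=> u u' /=; rewrite /f (anti_sum (herm_antil u')).
  rewrite [in RHS](dual_basisE he hphi hb u') (lin_sum (endA_lin S)).
  rewrite (lin_sum (herm_linearr u)); apply: eq_bigr => k _.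
  by rewrite herm_ractl herm_star herm_b endA_ract herm_ractr.
by move=> hT; exact: (xgetI 0 hT).
Qed.

Lemma endA_star_uniq (S T : endA E) :
  (forall v w, herm (T v) w = herm v (S w)) -> endA_star star phi S = T.
Proof.
move=> h; apply: endAP => v; apply: herm_inj => w.
by rewrite -herm_star endA_starP -h herm_star.
Qed.

Lemma endA_involution : involution (A := endAlg E) (endA_star star phi).
Proof.
split=> [k S T|S T|S].
- apply: endA_star_uniq => v w.
  rewrite -[(k *: S + T) w]/(k *: S w + T w) herm_linearr.
  transitivity (herm (k^* *: endA_star star phi S v + endA_star star phi T v) w) => //.
  by rewrite herm_antil conjCK !endA_starP.
- apply: endA_star_uniq => v w.
  transitivity (herm (endA_star star phi T (endA_star star phi S v)) w) => //.
  by rewrite !endA_starP.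
- by apply: endA_star_uniq => v w; rewrite -[RHS]herm_star endA_starP herm_star.
Qed.

Local Notation dot3 := (@dot3 C A star H dot act J E n phi).

(** Moving coordinates across [dot] collects the sums over i and j into A-valued hermitian products,
    from which adjoints can be read off. *)
Lemma dot3_mk3 v y w v' y' w' :
  dot3 (mk3 v y w) (mk3 v' y' w') =
  dot y (act (herm v v') (oact y' (star (herm w w')))).
Proof.
rewrite /Defs.dot3 (lin_sum (fun k x z => act_linl (oact y' _) k x z)).
rewrite (dot_sumr dot_form); apply: eq_bigr => i _.
rewrite star_sum (lin_sum (oact_linr y')) (lin_sum (act_linr _)) (dot_sumr dot_form).
apply: eq_bigr => j _; rewrite !entryE act_star -actM dot_oact (starK star_involution).
by rewrite -act_oact -oactM (starM star_involution) (starK star_involution).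
Qed.

Lemma dot3Dl x y z : dot3 (x + y) z = dot3 x z + dot3 y z.
Proof.
rewrite /Defs.dot3 -big_split /=; apply: eq_bigr => i _.
rewrite -big_split /=; apply: eq_bigr => j _.
by rewrite (linD (entry_linear i j)) (dotDl dot_form).
Qed.
Lemma dot3C x y : dot3 x y = (dot3 y x)^*.
Proof.
rewrite /Defs.dot3 rmorph_sum; apply: eq_bigr => i _.
by rewrite rmorph_sum; apply: eq_bigr => j _; exact: (dotC dot_form).
Qed.
Lemma dot3Dr x y z : dot3 x (y + z) = dot3 x y + dot3 x z.
Proof. by rewrite ![dot3 x _]dot3C dot3Dl rmorphD. Qed.
Lemma dot3Zl k x z : dot3 (k *: x) z = k * dot3 x z.
Proof.
rewrite /Defs.dot3 mulr_sumr; apply: eq_bigr => i _.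
rewrite mulr_sumr; apply: eq_bigr => j _.
by rewrite (linZ (entry_linear i j)) (dotZl dot_form).
Qed.
Lemma dot3_ge0 x : 0 <= dot3 x x.
Proof. by apply: sumr_ge0 => i _; apply: sumr_ge0 => j _; exact: (dot_ge0 dot_form). Qed.
Lemma dot3_eq0 x : dot3 x x = 0 -> x = 0.
Proof.
move=> /eqP; rewrite psumr_eq0 => [|i _]; last first.
  by apply: sumr_ge0 => j _; exact: (dot_ge0 dot_form).
move=> /allP h; rewrite -[x]entryK big1 // => i _; rewrite big1 // => j _.
have := h i (mem_index_enum i); rewrite /= psumr_eq0 => [|k _]; last exact: (dot_ge0 dot_form).
move=> /allP /(_ j (mem_index_enum j)) /eqP /(dot_eq0 dot_form) ->.
exact: (lin0 (mk3_linear2 _ _)).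
Qed.

Lemma dot3_end_act (S : endA E) x y :
  dot3 (@end_act C A star H act J E S x) y =
  dot3 x (@end_act C A star H act J E (endA_star star phi S) y).
Proof.
move: x; apply: EHE_eq => [x1 x2|x1 x2|v y0 w].
- by rewrite (linD (end_act_linear _)) dot3Dl.
- exact: dot3Dl.
move: y; apply: EHE_eq => [x1 x2|x1 x2|v' y' w'].
- exact: dot3Dr.
- by rewrite (linD (end_act_linear _)) dot3Dr.
by rewrite !end_actE !dot3_mk3 -[herm v (endA_star _ _ _ _)]herm_star endA_starP (herm_star v').
Qed.

(** * Symmetry of the twisted operator for a hermitian connection *)

Section HermitianConnection.
Hypothesis hherm : hermitian_connection star phi nabla.

Section LeftPairing.
Variable v : E.
Let bil : bilinear_map (fun u o => omega_l (herm v u) o : omega A).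
Proof.
split=> [o|u]; last exact: omega_l_linear.
move=> k x y; move: o; apply: omega_eq => [o1 o2|o1 o2|c d].
- exact: (linD (omega_l_linear _)).
- by rewrite !(linD (omega_l_linear _)) scalerDr addrACA.
by rewrite !omega_lE herm_linearr mulrDl pz_mulZl form_linearl.
Qed.
Let bal u a o : omega_l (herm v (ract u a)) o = omega_l (herm v u) (omega_l a o) :> omega A.
Proof.
move: o; apply: omega_eq => [o1 o2|o1 o2|c d].
- exact: (linD (omega_l_linear _)).
- by rewrite !(linD (omega_l_linear _)).
by rewrite !omega_lE herm_ractr mulrA.
Qed.
Lemma pairing_left (s : seq (E * A * A)) :
  tlift (fun u o => omega_l (herm v u) o)
    (\sum_(p <- s) p.1.1 \ox form p.1.2 p.2 : connection_target E) =
  \sum_(p <- s) form (herm v p.1.1 * p.1.2) p.2 :> omega A.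
Proof.
rewrite (lin_sum (tlift_linear bil bal)); apply: eq_bigr => p _.
rewrite -omega_lE; exact: (tlift_tensor _ _ bil bal).
Qed.
End LeftPairing.

Section RightPairing.
Variable w : E.
Let bil : bilinear_map
  (fun u o => omega_r (omega_star star o) (herm u w) : conjv (omega A)).
Proof.
split=> [o|u] k x y.
  rewrite herm_antil; exact: (omega_r_linearr (omega_star star o : omega A) k^*).
rewrite (omega_star_linear star_involution).
exact: (omega_r_linear (herm u w) k^* (omega_star star x : omega A)).
Qed.
Let bal u a o : omega_r (omega_star star o) (herm (ract u a) w) =
  omega_r (omega_star star (omega_l a o)) (herm u w) :> conjv (omega A).
Proof. by rewrite herm_ractl omega_rM (omega_star_l star_involution). Qed.
Lemma pairing_right (s : seq (E * A * A)) :
  tlift (fun u o => omega_r (omega_star star o) (herm u w))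
    (\sum_(p <- s) p.1.1 \ox form p.1.2 p.2 : connection_target E) =
  \sum_(p <- s) (form (star p.2) (star p.1.2 * herm p.1.1 w)
     - form 1 (star p.2 * (star p.1.2 * herm p.1.1 w))) :> omega A.
Proof.
apply: etrans (lin_sum (tlift_linear bil bal) _ _ _) _; apply: eq_bigr => p _.
apply: etrans (tlift_tensor _ _ bil bal) _.
rewrite (omega_starE star_involution) (linB (omega_r_linear _)) !omega_rE mul1r !mulrA.
by rewrite opprB addrA subrK.
Qed.
End RightPairing.

(** It serves both twists: once for [act] on H, once for right multiplication by [star a] on E (x)
    H. The latter is antilinear in a, hence the purely additive assumptions on [B], [L] and [rho].
    The proof applies [rho] to the hermitian identity, where delta(v, v') becomes the commutator
    [T, (v, v')] y'. *)
Lemma twist_symmetric (M : lmodType C) (B : M -> M -> C) (T : operator M)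
    (L : A -> M -> M) :
  (forall x y z, B (x + y) z = B x z + B y z) ->
  (forall x y z, B x (y + z) = B x y + B x z) ->
  (forall x y, dom T x -> dom T y -> B (T x) y = B x (T y)) ->
  (forall a, {morph L a : x y / x + y}) -> (forall a x, dom T x -> dom T (L a x)) ->
  (forall x, L 1 x = x) -> (forall a c x, L (a * c) x = L a (L c x)) ->
  (forall a x y, B (L a x) y = B x (L (star a) y)) ->
  (forall y, dom T y -> exists2 rho : omega A -> M, {morph rho : x y / x + y} &
     forall a c, rho (form a c) = L a (commutator T (L c) y)) ->
  forall v v' y y' (s t : seq (E * A * A)), dom T y -> dom T y' ->
  nabla v = \sum_(p <- s) p.1.1 \ox form p.1.2 p.2 ->
  nabla v' = \sum_(p <- t) p.1.1 \ox form p.1.2 p.2 ->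
  \sum_(p <- s) B (L p.1.2 (commutator T (L p.2) y)) (L (herm p.1.1 v') y')
    + B (T y) (L (herm v v') y') =
  \sum_(p <- t) B y (L (herm v p.1.1) (L p.1.2 (commutator T (L p.2) y')))
    + B y (L (herm v v') (T y')).
Proof.
move=> Bl Br TB LD Ldom L1 LM LB rep v v' y y' s t hy hy' hs ht.
have [rho rhoD rhoE] := rep y' hy'.
have rho0 := additive0 rhoD.
have rhoN x : rho (- x) = - rho x.
  by apply/eqP; rewrite -addr_eq0 -rhoD addNr rho0.
have L0 a := additive0 (LD a).
have LN a x : L a (- x) = - L a x.
  by apply/eqP; rewrite -addr_eq0 -LD addNr L0.
have B0r x : B x 0 = 0 by exact: (additive0 (Br x)).
have BNr x z : B x (- z) = - B x z.
  by apply/eqP; rewrite -addr_eq0 -Br addNr B0r.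
have B0l x : B 0 x = 0.
  by apply: (@addrI _ (B 0 x)); rewrite -Bl !addr0.
have BNl x z : B (- z) x = - B z x.
  by apply/eqP; rewrite -addr_eq0 -Bl addNr B0l.
have key := hherm v v'; rewrite hs ht pairing_left pairing_right in key.
pose Z (p : E * A * A) := L (star p.1.2) (L (herm p.1.1 v') y').
have hZ p : dom T (Z p) by exact/Ldom/Ldom.
have rho1 : \sum_(p <- t) L (herm v p.1.1) (L p.1.2 (commutator T (L p.2) y'))
    + \sum_(p <- s) commutator T (L (star p.2)) (Z p) = commutator T (L (herm v v')) y'.
  have := congr1 rho key; rewrite /delta rhoE L1 => <-.
  rewrite rhoD rhoN !(big_morph rho rhoD rho0); congr (_ + _).
    by apply: eq_bigr => p _; rewrite rhoE LM.
  rewrite -sumrN; apply: eq_bigr => p _.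
  rewrite rhoD rhoN !rhoE L1 opprB /commutator !LM LD LN -/(Z p).
  by rewrite opprB addrA subrK.
(* Symmetry of T carries the commutator to the other side, with a minus sign and starred
   coefficients; this is the sum over s in [rho1]. *)
have comm p : B (L p.1.2 (commutator T (L p.2) y)) (L (herm p.1.1 v') y') =
    - B y (commutator T (L (star p.2)) (Z p)).
  rewrite LB -/(Z p) /commutator Bl BNl Br BNr TB //; last exact: Ldom.
  rewrite !LB TB //; last exact: Ldom.
  by rewrite opprD opprK addrC.
rewrite (eq_bigr _ (fun p _ => comm p)) sumrN -(big_morph (B y) (Br y) (B0r y)).
rewrite -(big_morph (B y) (Br y) (B0r y)) TB //; last exact: Ldom.
rewrite -!Br -BNr -Br; congr B; rewrite addrC; apply/eqP; rewrite subr_eq.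
by rewrite addrAC rho1 /commutator subrK.
Qed.

Let EHc i : EH -> H := @left_coord C A E H act n (fun j v => phi v j 0) i.
Let EHcE i v y : EHc i (v \ox y) = act (phi v i 0) y.
Proof.
exact: (left_coordE act_linr act_linl actM (fun j => phi_linear hphi j)
  (fun j v a => phi_ract hphi v a j)).
Qed.
Let EHc_linear i : linear (EHc i).
Proof.
exact: (left_coord_linear act_linr act_linl actM (fun j => phi_linear hphi j)
  (fun j v a => phi_ract hphi v a j)).
Qed.
(** The inner product on E (x) H for which the first twist is symmetric; it plays the role of [dot]
    for the second. *)
Let dot2 (x y : EH) : C := \sum_i dot (EHc i x) (EHc i y).
Let dot2Dl x y z : dot2 (x + y) z = dot2 x z + dot2 y z.
Proof.
rewrite /dot2 -big_split; apply: eq_bigr => i _.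
by rewrite (linD (EHc_linear i)) (dotDl dot_form).
Qed.
Let dot2Dr x y z : dot2 x (y + z) = dot2 x y + dot2 x z.
Proof.
rewrite /dot2 -big_split; apply: eq_bigr => i _.
by rewrite (linD (EHc_linear i)) (dotDr dot_form).
Qed.
Let dot2E v y v' y' : dot2 (v \ox y) (v' \ox y') = dot y (act (herm v v') y').
Proof.
rewrite (lin_sum (fun k x z => act_linl y' k x z)) (dot_sumr dot_form).
by apply: eq_bigr => i _; rewrite !EHcE act_star -actM.
Qed.
Let dot20l z : dot2 0 z = 0.
Proof. by apply: (@addrI _ (dot2 0 z)); rewrite -dot2Dl !addr0. Qed.

Lemma dot3_tensor x w x' w' : dot3 ((x : EH) \ox bar w) ((x' : EH) \ox bar w') =
  dot2 x (EHr x' (star (herm w w'))).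
Proof.
move: x; apply: tens_eq => [x1 x2|x1 x2|v y].
- by rewrite (linD (tensor_linearl _ _ _)) dot3Dl.
- by rewrite dot2Dl.
move: x'; apply: tens_eq => [x1 x2|x1 x2|v' y'].
- by rewrite (linD (tensor_linearl _ _ _)) dot3Dr.
- by rewrite (linD (EHr_linear _)) dot2Dr.
by rewrite EHrE dot2E -dot3_mk3.
Qed.

Lemma D_sym x y : self_adjoint dot D -> dom D x -> dom D y -> dot (D x) y = dot x (D y).
Proof. by move=> [_ _ sa] hx hy; have [_ /(_ (conj hy erefl)) ->] := sa y (D y). Qed.

Let dot2_D1 x x' : dom D1 x -> dom D1 x' -> dot2 (D1 x) x' = dot2 x (D1 x').
Proof.
move=> hx hx'.
suff : dom D1 x /\ dot2 (D1 x) x' = dot2 x (D1 x') by case.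
move: x hx; apply: dom_D1_ind.
- by rewrite (op0 D1_linear) !dot20l; split=> //; exact: (dom0 D1_linear).
- move=> x1 x2 [h1 e1] [h2 e2]; rewrite (opD D1_linear) // !dot2Dl e1 e2.
  by split=> //; exact: (domD D1_linear).
move=> v y hy; split; first exact: dom_D1.
suff : dom D1 x' /\ dot2 (D1 (v \ox y)) x' = dot2 (v \ox y) (D1 x') by case.
move: x' hx'; apply: dom_D1_ind.
- have dot20r z : dot2 z 0 = 0 by exact: (additive0 (dot2Dr z)).
  by rewrite (op0 D1_linear) !dot20r; split=> //; exact: (dom0 D1_linear).
- move=> x1 x2 [h1 e1] [h2 e2]; rewrite (opD D1_linear) // !dot2Dr e1 e2.
  by split=> //; exact: (domD D1_linear).
move=> v' y' hy'; split; first exact: dom_D1.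
have [s hs] := connection_sumP (nabla v); have [t ht] := connection_sumP (nabla v').
have [_ _ D1E] := hD1; rewrite (D1E _ _ _ hy hs) (D1E _ _ _ hy' ht).
rewrite dot2Dl dot2Dr (big_morph (dot2^~ _) (fun a c => dot2Dl a c _) (dot20l _)).
rewrite (big_morph (dot2 _) (dot2Dr _) (additive0 (dot2Dr _))).
have : self_adjoint dot D by case: HD.
move=> sa; under eq_bigr => p _ do rewrite dot2E.
under [in RHS]eq_bigr => p _ do rewrite dot2E.
rewrite !dot2E; apply: (twist_symmetric (B := dot) (T := D) (L := act)) => //.
- exact: (dotDl dot_form).
- exact: (dotDr dot_form).
- by move=> a c; exact: D_sym.
- by move=> a; exact: (linD (act_linr a)).
- by move=> a z; exact: D_act.
- exact: act1.
- exact: actM.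
- exact: act_star.
move=> z hz; exists (form_rep act D z).
  exact: (linD (form_rep_linear act_linr act_linl act1 D_linear D_act hz)).
exact: (form_repE act_linr act_linl act1 D_linear D_act hz).
Qed.

Lemma D'_sym x x' : dom D' x -> dom D' x' -> dot3 (D' x) x' = dot3 x (D' x').
Proof.
have dot30l z : dot3 0 z = 0 by apply: (@addrI _ (dot3 0 z)); rewrite -dot3Dl !addr0.
have dot30r z : dot3 z 0 = 0 by exact: (additive0 (dot3Dr z)).
move=> hx hx'.
suff : dom D' x /\ dot3 (D' x) x' = dot3 x (D' x') by case.
move: x hx; apply: dom_D'_ind.
- by rewrite (op0 D'_linear) !dot30l; split=> //; exact: (dom0 D'_linear).
- move=> x1 x2 [h1 e1] [h2 e2]; rewrite (opD D'_linear) // !dot3Dl e1 e2.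
  by split=> //; exact: (domD D'_linear).
move=> v y w hy; split; first exact: dom_D'.
suff : dom D' x' /\ dot3 (D' (mk3 v y w)) x' = dot3 (mk3 v y w) (D' x') by case.
move: x' hx'; apply: dom_D'_ind.
- by rewrite (op0 D'_linear) !dot30r; split=> //; exact: (dom0 D'_linear).
- move=> x1 x2 [h1 e1] [h2 e2]; rewrite (opD D'_linear) // !dot3Dr e1 e2.
  by split=> //; exact: (domD D'_linear).
move=> v' y' w' hy'; split; first exact: dom_D'.
have [s hs] := connection_sumP (nabla w); have [t ht] := connection_sumP (nabla w').
have D1r a (z : EH) : dom D1 z -> dom D1 (EHr z a).
  move: z; apply: (dom_D1_ind (Q := fun x => dom D1 (EHr x a))).
  - by rewrite (lin0 (EHr_linear a)); exact: (dom0 D1_linear).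
  - by move=> x1 x2; rewrite (linD (EHr_linear a)); exact: (domD D1_linear).
  - by move=> u z hz; rewrite EHrE; apply/dom_D1/D_oact.
have D'E := tensor_one_formula star_involution EHr_linear EHr_linr EHr1 EHrM D1_linear D1r hD'.
rewrite /Defs.mk3 (D'E _ _ _ (dom_D1 v hy) hs) (D'E _ _ _ (dom_D1 v' hy') ht).
rewrite dot3Dl dot3Dr (big_morph (dot3^~ _) (fun a c => dot3Dl a c _) (dot30l _)).
rewrite (big_morph (dot3 _) (dot3Dr _) (additive0 (dot3Dr _))).
under eq_bigr => p _ do rewrite dot3_tensor.
under [in RHS]eq_bigr => p _ do rewrite dot3_tensor.
rewrite !dot3_tensor addrC [RHS]addrC.
apply: (twist_symmetric (B := dot2) (T := D1) (L := fun a x => EHr x (star a))) => //; try exact: dom_D1.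
- by move=> a; exact: (linD (EHr_linear _)).
- by move=> a z; exact: D1r.
- by move=> z; rewrite (star1 star_involution) EHr1.
- by move=> a c z; rewrite (starM star_involution) EHrM.
- move=> a x1 x2; rewrite (starK star_involution).
  move: x1; apply: tens_eq => [u1 u2|u1 u2|u z].
  + by rewrite (linD (EHr_linear _)) dot2Dl.
  + by rewrite dot2Dl.
  move: x2; apply: tens_eq => [u1 u2|u1 u2|u' z'].
  + by rewrite dot2Dr.
  + by rewrite (linD (EHr_linear _)) dot2Dr.
  by rewrite !EHrE !dot2E dot_oact (starK star_involution) act_oact.
(* On the conjugate of E (x) H, right multiplication by [star a] is a left action linear in a, and
   [D1] is still a linear operator, so [form_rep] supplies the required additive map. *)
pose L (a : A) (z : conjv EH) : conjv EH := EHr z (star a).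
move=> z hz.
have L1 a : linear (L a) by move=> k x1 x2; exact: EHr_linear.
have L2 x1 : linear (L^~ x1).
  by move=> k a c; rewrite /L (star_anti star_involution); exact: EHr_linr.
have L3 x1 : L 1 x1 = x1 by rewrite /L (star1 star_involution) EHr1.
have T1 : linear_operator (D1 : operator (conjv EH)).
  split=> [|k x1 x2]; first exact: (dom0 D1_linear).
  by move=> h1 h2; split; [exact: (dom_lin D1_linear)|exact: (op_lin D1_linear)].
have T2 a x1 : dom (D1 : operator (conjv EH)) x1 -> dom (D1 : operator (conjv EH)) (L a x1).
  exact: D1r.
exists (form_rep L (D1 : operator (conjv EH)) z).
  exact: (linD (form_rep_linear L1 L2 L3 T1 T2 hz)).
exact: (form_repE L1 L2 L3 T1 T2 hz).
Qed.
End HermitianConnection.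
End TwistedOperator.
End Triple.

(** * Norms, compactness and resolvents *)

Section Norm.
Variables (C : numClosedFieldType) (V : lmodType C) (dot : V -> V -> C).
Hypothesis hdot : exists f : {dot V for Num.conj}, forall x y, dot x y = f x y.

Lemma hnorm_ge0 x : 0 <= hnorm dot x.
Proof. by rewrite sqrtC_ge0 (dot_ge0 hdot). Qed.
Lemma hnormZ k x : hnorm dot (k *: x) = `|k| * hnorm dot x.
Proof.
rewrite /hnorm (dotZl hdot) (dotZr hdot) mulrA -normCK sqrtCM ?sqrCK //.
  by rewrite nnegrE exprn_ge0.
by rewrite nnegrE (dot_ge0 hdot).
Qed.
Lemma cauchy_schwarz x y : `|dot x y| <= hnorm dot x * hnorm dot y.
Proof.
have [->|ny] := eqVneq y 0; first by rewrite (dot0r hdot) normr0 mulr_ge0 ?hnorm_ge0.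
have yy : 0 < dot y y.
  by rewrite lt_def (dot_ge0 hdot) andbT; apply: contra_neq ny; exact: dot_eq0.
rewrite -ler_sqr ?nnegrE ?mulr_ge0 ?hnorm_ge0 // exprMn /hnorm !sqrtCK.
pose a := dot x y / dot y y; have aq : a * dot y y = dot x y.
  by rewrite divfK // gt_eqF.
have := dot_ge0 hdot (x - a *: y).
rewrite (dotBl hdot) !(dotBr hdot) !(dotZl hdot) !(dotZr hdot) mulrCA aq.
rewrite opprB addrA subrK subr_ge0 [dot y x](dotC hdot) /a mulrAC -normCK.
by rewrite ler_pdivrMr.
Qed.
Lemma hnormD x y : hnorm dot (x + y) <= hnorm dot x + hnorm dot y.
Proof.
rewrite -ler_sqr ?nnegrE ?addr_ge0 ?hnorm_ge0 // sqrrD /hnorm !sqrtCK.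
rewrite (dotDl hdot) !(dotDr hdot) !addrA lerD2r -!addrA lerD2l.
rewrite [dot y x](dotC hdot).
have := cauchy_schwarz x y; set d := dot x y => h.
have dd : d + d^* \is Num.real by rewrite CrealE rmorphD /= conjCK addrC.
apply: le_trans (real_ler_norm dd) _; apply: le_trans (ler_normD _ _) _.
by rewrite norm_conjC lerD.
Qed.
End Norm.

Section RealNorm.
Variables (R : realType) (V : lmodType R[i]) (dot : V -> V -> R[i]).
Hypothesis hdot : exists f : {dot V for Num.conj}, forall x y, dot x y = f x y.

(** Norms are measured in R[i], whose order is partial; the estimates are carried out in the ordered
    field R. *)
Definition nrm (x : V) : R := complex.Re (hnorm dot x).

Lemma nrmE x : hnorm dot x = real_complex R (nrm x).
Proof. by rewrite /nrm RRe_real // ger0_real // hnorm_ge0. Qed.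
Lemma nrm_ge0 x : 0 <= nrm x.
Proof. by rewrite -ler0c -nrmE hnorm_ge0. Qed.
Lemma nrm0 : nrm 0 = 0.
Proof. by rewrite /nrm (hnorm0 hdot). Qed.
Lemma nrm_eq0 x : nrm x = 0 -> x = 0.
Proof. by move=> h; apply: (hnorm_eq0 hdot); rewrite nrmE h. Qed.
Lemma nrmZ k x : nrm (k *: x) = complex.Re `|k| * nrm x.
Proof.
apply: complexI; rewrite -nrmE hnormZ // nrmE rmorphM /=; congr (_ * _).
Qed.
Lemma nrmZr (k : R) x : nrm (real_complex R k *: x) = `|k| * nrm x.
Proof. by rewrite nrmZ normc_def /= expr0n addr0 sqrtr_sqr. Qed.
Lemma nrmZi (k : R) x : nrm (Complex 0 k *: x) = `|k| * nrm x.
Proof. by rewrite nrmZ normc_def /= expr0n add0r sqrtr_sqr. Qed.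
Lemma nrmN x : nrm (- x) = nrm x.
Proof. by rewrite -scaleN1r nrmZ normrN1 /= mul1r. Qed.
Lemma nrmD x y : nrm (x + y) <= nrm x + nrm y.
Proof. by rewrite -lecR rmorphD /= -!nrmE hnormD. Qed.
Lemma nrmB x y : nrm (x - y) <= nrm x + nrm y.
Proof. by apply: le_trans (nrmD _ _) _; rewrite nrmN. Qed.
Lemma nrm_dist x y : nrm (x - y) = nrm (y - x).
Proof. by rewrite -nrmN opprB. Qed.
Lemma nrm_tri z x y : nrm (x - y) <= nrm (x - z) + nrm (z - y).
Proof. by rewrite -[x - y](subrKA z); exact: nrmD. Qed.
Lemma nrm_sum (I : Type) (r : seq I) (F : I -> V) :
  nrm (\sum_(i <- r) F i) <= \sum_(i <- r) nrm (F i).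
Proof.
elim/big_ind2: _ => // [|x a y c h1 h2]; first by rewrite nrm0.
by apply: le_trans (nrmD _ _) _; exact: lerD.
Qed.
Lemma nrm_eps x : (forall eps : R, 0 < eps -> nrm x < eps) -> x = 0.
Proof.
move=> h; apply: nrm_eq0; apply/eqP; rewrite eq_le nrm_ge0 andbT leNgt.
by apply/negP => /h; rewrite ltxx.
Qed.

Definition rcvg (u : nat -> V) (l : V) := forall eps : R, 0 < eps ->
  exists N : nat, forall m, (N <= m)%N -> nrm (u m - l) < eps.

Lemma pos_complex (eps : R[i]) : 0 < eps ->
  0 < complex.Re eps /\ eps = real_complex R (complex.Re eps).
Proof.
move=> h; split; first by move: h; rewrite ltcE => /andP[].
by rewrite RRe_real // gtr0_real.
Qed.

Lemma rcvgP u l : cvg_to dot u l <-> rcvg u l.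
Proof.
split=> h eps e0.
  have /h[N hN] : 0 < real_complex R eps by rewrite (ltcR 0).
  by exists N => m /hN; rewrite nrmE ltcR.
have [r0 re] := pos_complex e0; have [N hN] := h _ r0.
by exists N => m /hN; rewrite nrmE re ltcR.
Qed.

Definition rcauchy (u : nat -> V) := forall eps : R, 0 < eps ->
  exists N : nat, forall m p, (N <= m)%N -> (N <= p)%N -> nrm (u m - u p) < eps.

Lemma rcauchyP u : cauchy_seq dot u <-> rcauchy u.
Proof.
split=> h eps e0.
  have /h[N hN] : 0 < real_complex R eps by rewrite (ltcR 0).
  by exists N => m p /hN h1 /h1; rewrite nrmE ltcR.
have [r0 re] := pos_complex e0; have [N hN] := h _ r0.
by exists N => m p /hN h1 /h1; rewrite nrmE re ltcR.
Qed.

(** An inequality in R[i] compares real parts and equates imaginary parts, so the real part of a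
    complex bound is again a bound. *)
Lemma nrm_bound (M : R[i]) (r : R) y :
  hnorm dot y <= M * real_complex R r -> nrm y <= complex.Re M * r.
Proof. by rewrite lecE => /andP[_]; case: M => a b /=; rewrite mulr0 subr0. Qed.
End RealNorm.

Lemma half_pow_small (R : realType) (c eps : R) : 0 < eps ->
  exists N : nat, forall m, (N <= m)%N -> (2^-1) ^+ m * c < eps.
Proof.
move=> e0; exists (Num.bound (c / eps)) => m /upper_nthrootP.
rewrite ltr_pdivrMr // => h.
by rewrite exprVn mulrC ltr_pdivrMr ?exprn_gt0 // mulrC.
Qed.

Lemma inv_small (R : realType) (eps : R) : 0 < eps ->
  exists N : nat, forall m, (N <= m)%N -> m.+1%:R^-1 < eps.
Proof.
move=> e0; exists (Num.bound eps^-1) => m hm.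
rewrite invf_plt ?posrE //; apply: lt_le_trans (archi_boundP _) _.
  by rewrite invr_ge0 ltW.
by rewrite ler_nat ltnW // ltnS.
Qed.

(** * Inverting 1 + B when B has norm at most 1/2 *)

Section Neumann.
Variables (R : realType) (V : lmodType R[i]) (dot : V -> V -> R[i]).
Hypothesis hV : hilbert dot.
Let hdot := hV.1.
Local Notation N := (nrm dot).

Lemma complete u : rcauchy dot u -> exists l, rcvg dot u l.
Proof.
by move=> /(rcauchyP hdot) /hV.2 [l /(rcvgP hdot) hl]; exists l.
Qed.

Variable B : V -> V.
Hypotheses (Blin : linear B) (Bhalf : forall x, N (B x) <= 2^-1 * N x).

Lemma neumann_inj x : x + B x = 0 -> x = 0.
Proof.
move=> h; apply: (nrm_eq0 hdot); have := Bhalf x.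
have -> : B x = - x by apply/eqP; rewrite -addr_eq0 addrC h.
by rewrite nrmN //; have := nrm_ge0 hdot x; lra.
Qed.

Lemma neumann_solve y : exists x, x + B x = y.
Proof.
(* The iterates are the partial sums of the Neumann series applied to y. *)
pose u := fix u m := if m is k.+1 then y - B (u k) else 0.
have uS m : u m.+1 = y - B (u m) by [].
have ubound m : N (u m) <= 2 * N y.
  elim: m => [|m IH]; first by rewrite /= (nrm0 hdot) mulr_ge0 // nrm_ge0.
  rewrite uS; apply: le_trans (nrmB hdot _ _) _.
  by have := Bhalf (u m); lra.
have ustep k m : N (u (m + k)%N - u m) <= 2^-1 ^+ m * (2 * N y).
  elim: m => [|m IH]; first by rewrite /= subr0 expr0 mul1r add0n.
  rewrite addSn !uS opprB addrC addrA subrK -(linB Blin).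
  apply: le_trans (Bhalf _) _; rewrite exprS -mulrA ler_pM2l ?invr_gt0 //.
  by rewrite (nrm_dist hdot).
have ucauchy : rcauchy dot u.
  (* By [ustep] both terms lie within 2 N y / 2^M of u M, whence the factor 4. *)
  move=> eps e0; have [M hM] := half_pow_small (4 * N y) e0.
  exists M => m p hm hp; apply: le_lt_trans (hM M (leqnn _)).
  apply: le_trans (nrm_tri hdot (u M) _ _) _.
  rewrite [N (u M - _)](nrm_dist hdot).
  have := ustep (m - M)%N M; have := ustep (p - M)%N M; rewrite !subnKC //.
  by lra.
have [l hl] := complete ucauchy; exists l.
apply/eqP; rewrite -subr_eq0; apply/eqP/(nrm_eps hdot) => eps e0.
have [M hM] := hl (eps / 2) (divr_gt0 e0 (ltr0n _ 2)).
have -> : l + B l - y = (l - u M.+1) + B (l - u M).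
  rewrite uS (linB Blin) opprB -addrA -[RHS]addrA; congr (l + _).
  by rewrite [RHS]addrCA [B (u M) - y - _]addrAC subrr add0r.
apply: le_lt_trans (nrmD hdot _ _) _.
have h1 := hM M.+1 (leqnSn _); have h2 := hM M (leqnn _).
rewrite (nrm_dist hdot) in h1; rewrite (nrm_dist hdot) in h2.
by have := Bhalf (l - u M); have := nrm_ge0 hdot (l - u M); lra.
Qed.

Lemma neumann : exists S : V -> V,
  [/\ linear S, forall y, S y + B (S y) = y & forall y, N (S y) <= 2 * N y].
Proof.
have [S hS] := choice neumann_solve; exists S; split=> //.
  move=> k x y; apply/eqP; rewrite -subr_eq0; apply/eqP/neumann_inj.
  rewrite (linB Blin) Blin.
  transitivity ((S (k *: x + y) + B (S (k *: x + y))) -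
    (k *: (S x + B (S x)) + (S y + B (S y)))).
    by rewrite scalerDr [k *: S x + _ + _]addrACA [in RHS]opprD [RHS]addrACA.
  by rewrite !hS subrr.
move=> y; have := nrmB hdot y (B (S y)); rewrite -{1}[y](hS y) addrK.
by have := Bhalf (S y); lra.
Qed.
End Neumann.

(** * Compact maps *)

Section Compact.
Variables (R : realType).

(** Source and target may differ, because the resolvent on H will be composed with maps from and to
    the twisted space. *)
Definition rcompact (U V : lmodType R[i]) (dU : U -> U -> R[i]) (dV : V -> V -> R[i])
    (T : U -> V) :=
  forall u : nat -> U, (exists M : R, forall m, nrm dU (u m) <= M) ->
    exists (s : nat -> nat) (l : V),
      (forall m, (s m < s m.+1)%N) /\ rcvg dV (fun m => T (u (s m))) l.

Lemma subseq_ge (s : nat -> nat) : (forall m, (s m < s m.+1)%N) -> forall m, (m <= s m)%N.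
Proof. by move=> h; elim=> // m IH; exact: leq_ltn_trans IH (h m). Qed.

Variables (U V W : lmodType R[i]) (dU : U -> U -> R[i]) (dV : V -> V -> R[i]).
Variable dW : W -> W -> R[i].
Hypothesis hU : exists f : {dot U for Num.conj}, forall x y, dU x y = f x y.
Hypothesis hdV : exists f : {dot V for Num.conj}, forall x y, dV x y = f x y.
Hypothesis hW : exists f : {dot W for Num.conj}, forall x y, dW x y = f x y.

Lemma rcompact_compr (T : V -> W) (S : U -> V) (M : R) :
  (forall x, nrm dV (S x) <= M * nrm dU x) -> 0 <= M ->
  rcompact dV dW T -> rcompact dU dW (fun x => T (S x)).
Proof.
move=> hS M0 hT u [K hK]; apply: (hT (fun m => S (u m))); exists (M * K) => m.
by apply: le_trans (hS _) _; rewrite ler_wpM2l.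
Qed.

Lemma rcompact_compl (T : V -> W) (S : U -> V) (M : R) : linear T ->
  (forall x, nrm dW (T x) <= M * nrm dV x) -> 0 <= M ->
  rcompact dU dV S -> rcompact dU dW (fun x => T (S x)).
Proof.
move=> Tl hT M0 hS u /hS [s [l [hs hl]]]; exists s, (T l); split=> // eps e0.
have M1 : 0 < M + 1 by rewrite ltr_wpDl.
have [N hN] := hl _ (divr_gt0 e0 M1); exists N => m /hN.
rewrite ltr_pdivlMr // => h; rewrite -(linB Tl).
apply: le_lt_trans (hT _) _; apply: le_lt_trans h.
rewrite mulrC ler_wpM2l ?nrm_ge0 //; lra.
Qed.

Lemma rcvg_sub (u : nat -> V) l (s : nat -> nat) : (forall m, (s m < s m.+1)%N) ->
  rcvg dV u l -> rcvg dV (fun m => u (s m)) l.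
Proof.
move=> hs hl eps /hl [N hN]; exists N => m hm; apply: hN.
exact: leq_trans hm (subseq_ge hs m).
Qed.

Lemma rcvgD (u v : nat -> V) l l' : rcvg dV u l -> rcvg dV v l' ->
  rcvg dV (fun m => u m + v m) (l + l').
Proof.
move=> hu hv eps e0; have e2 : 0 < eps / 2 by apply: divr_gt0.
have [N hN] := hu _ e2; have [N' hN'] := hv _ e2.
exists (maxn N N') => m; rewrite geq_max => /andP[/hN h1 /hN' h2].
have -> : u m + v m - (l + l') = (u m - l) + (v m - l') by rewrite opprD addrACA.
by apply: le_lt_trans (nrmD hdV _ _) _; lra.
Qed.

Lemma rcompactD (T S : U -> V) : rcompact dU dV T -> rcompact dU dV S ->
  rcompact dU dV (fun x => T x + S x).
Proof.
move=> hT hS u [M hM].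
have [s [l [hs hl]]] := hT u (ex_intro _ M hM).
have [s' [l' [hs' hl']]] := hS (fun m => u (s m)) (ex_intro _ M (fun m => hM (s m))).
exists (fun m => s (s' m)), (l + l'); split.
  have mono a c : (a < c)%N -> (s a < s c)%N.
    elim: c => // c IH; rewrite ltnS leq_eqVlt => /orP[/eqP->|/IH h] //.
    exact: ltn_trans h (hs c).
  by move=> m; apply: mono.
by apply: rcvgD => //; exact: (rcvg_sub hs' hl).
Qed.

Lemma rcompact0 : rcompact dU dV (fun=> 0).
Proof.
move=> u _; exists id, 0; split=> // eps e0; exists 0%N => m _.
by rewrite subrr (nrm0 hdV).
Qed.

Lemma rcompact_sum (I : Type) (r : seq I) (T : I -> U -> V) :
  (forall i, rcompact dU dV (T i)) -> rcompact dU dV (fun x => \sum_(i <- r) T i x).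
Proof.
move=> h; elim: r => [|i r IH].
  by rewrite (_ : (fun x => _) = fun=> 0); [exact: rcompact0|apply/funext => x; rewrite big_nil].
rewrite (_ : (fun x => _) = fun x => T i x + \sum_(j <- r) T j x).
  exact: rcompactD.
by apply/funext => x; rewrite big_cons.
Qed.

(** Otherwise some unit vectors u m would have images of norm above m + 1, and no subsequence of
    these images could converge. *)
Lemma rcompact_bounded (T : U -> V) : linear T -> rcompact dU dV T ->
  exists2 M : R, 0 < M & forall x, nrm dV (T x) <= M * nrm dU x.
Proof.
move=> Tl hT; apply: contrapT => h.
have : forall m : nat, exists x, (m.+1%:R : R) * nrm dU x < nrm dV (T x).
  move=> m; apply: contrapT => hm; apply: h; exists m.+1%:R => // x.
  by rewrite leNgt; apply/negP => hx; apply: hm; exists x.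
move=> /choice [x hx].
have x0 m : 0 < nrm dU (x m).
  rewrite lt_def nrm_ge0 // andbT; apply/eqP => hx0.
  have := hx m; rewrite (nrm_eq0 hU hx0) (lin0 Tl) (nrm0 hU) (nrm0 hdV) mulr0.
  by rewrite ltxx.
pose u m := real_complex R (nrm dU (x m))^-1 *: x m.
have [|s [l [hs hl]]] := hT u.
  exists 1 => m; rewrite /u (nrmZr hU) gtr0_norm ?invr_gt0 //.
  by rewrite mulVf // gt_eqF.
have [N hN] := hl 1 ltr01.
(* This index is past the convergence threshold, so the image has norm below that of l plus 1, and
   large enough to force a norm above it. *)
pose m := maxn N (Num.bound (nrm dV l + 1)).
have := hN m (leq_maxl _ _); rewrite /u (linZ Tl).
set y := T (x (s m)) => h1.
have : (s m).+1%:R < nrm dV (real_complex R (nrm dU (x (s m)))^-1 *: y).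
  rewrite (nrmZr hdV) gtr0_norm ?invr_gt0 // mulrC ltr_pdivlMr //.
have h2 := nrmD hdV (real_complex R (nrm dU (x (s m)))^-1 *: y - l) l.
rewrite subrK in h2.
have h3 : nrm dV l + 1 < (s m).+1%:R.
  apply: lt_le_trans (archi_boundP _) _; first by rewrite addr_ge0 ?nrm_ge0.
  by rewrite ler_nat ltnW // ltnS; apply: leq_trans (subseq_ge hs m); exact: leq_maxr.
move=> h4; lra.
Qed.
End Compact.

(** * Resolvents and self-adjointness *)

Section Resolvent.
Variables (R : realType) (V : lmodType R[i]) (dot : V -> V -> R[i]).
Hypothesis hV : hilbert dot.
Let hdot := hV.1.
Local Notation N := (nrm dot).
Variable T : operator V.
Hypothesis hT : linear_operator T.

Definition resolvent_at (z : R[i]) (K : V -> V) : Prop :=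
  [/\ linear K, rcompact dot dot K,
      forall x, dom T (K x) /\ T (K x) - z *: K x = x &
      forall x, dom T x -> K (T x - z *: x) = x].

Lemma compact_operatorP (K : V -> V) : linear K ->
  compact_operator dot K <-> rcompact dot dot K.
Proof.
move=> Kl; split=> [[_ h] u [M hM]|h].
  case: (h u); first by exists (real_complex R M) => m; rewrite (nrmE hdot) lecR.
  by move=> s [l [hs /(rcvgP hdot) hl]]; exists s, l.
split=> // u [M hM]; case: (h u).
  exists (complex.Re M) => m; have := hM m.
  by have := @nrm_bound _ _ dot M 1 (u m); rewrite rmorph1 !mulr1.
by move=> s [l [hs hl]]; exists s, l; split=> //; apply/(rcvgP hdot).
Qed.

Lemma compact_resolventP : compact_resolvent dot T <-> exists z K, resolvent_at z K.
Proof.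
split=> -[z [K]].
  move=> [hc h1 h2]; have Kl := hc.1; exists z, K; split=> //.
  by apply/(compact_operatorP Kl).
move=> [Kl hK h1 h2]; exists z, K; split=> //.
by apply/(compact_operatorP Kl).
Qed.

(** (T - z) K0 = 1 + B with B of norm at most 1/2. K0 after the Neumann inverse of 1 + B is a right
    inverse, compact like K0, and injectivity of T - z makes it two-sided. *)
Lemma resolvent_of_approximate z (K0 : V -> V) : linear K0 -> rcompact dot dot K0 ->
  (forall y, dom T (K0 y)) ->
  (forall y, N (T (K0 y) - z *: K0 y - y) <= 2^-1 * N y) ->
  (forall x, dom T x -> T x - z *: x = 0 -> x = 0) ->
  exists K, resolvent_at z K.
Proof.
move=> K0l K0c K0d K0h inj.
pose B y := T (K0 y) - z *: K0 y - y.
have Bl : linear B.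
  apply: linear_add; last exact: (linear_opp (@linear_id _ V)).
  apply: linear_add; first by move=> k x y; rewrite K0l (op_lin hT).
  by apply: linear_opp => k x y; rewrite K0l scalerDr !scalerA mulrC.
have [S [Sl SE Sb]] := neumann hV Bl K0h.
have KE y : T (K0 (S y)) - z *: K0 (S y) = y by rewrite -[RHS]SE /B [RHS]addrC subrK.
exists (fun y => K0 (S y)); split=> [||x|x hx].
- exact: linear_comp.
- by apply: (rcompact_compr (M := 2) Sb).
- by split.
apply/eqP; rewrite -subr_eq0; apply/eqP/inj; first exact: (domB hT).
transitivity ((T (K0 (S (T x - z *: x))) - z *: K0 (S (T x - z *: x))) - (T x - z *: x)).
  rewrite (opB hT) // scalerBr !opprB !addrA [LHS]addrAC [RHS]addrAC.
  by congr (_ + _); rewrite addrAC.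
by rewrite KE subrr.
Qed.

Hypothesis T_sym : forall x y, dom T x -> dom T y -> dot (T x) y = dot x (T y).

(** For symmetric T the number (T x, x) is real, so ((T - z) x, x) has imaginary part - Im z times
    the square of N x; the Cauchy-Schwarz inequality concludes. *)
Lemma sym_lower_bound z x : dom T x -> `|complex.Im z| * N x <= N (T x - z *: x).
Proof.
move=> hx; have [->|x0] := eqVneq x 0; first by rewrite (nrm0 hdot) mulr0 nrm_ge0.
have Nx : 0 < N x.
  rewrite lt_def nrm_ge0 // andbT; apply: contra_neq x0; exact: nrm_eq0.
rewrite -(ler_pM2r Nx).
have h : `|dot (T x - z *: x) x| <= hnorm dot (T x - z *: x) * hnorm dot x.
  exact: cauchy_schwarz.
rewrite !(nrmE hdot) -rmorphM /= in h.
have xx : dot x x = real_complex R (N x ^+ 2).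
  by rewrite rmorphXn /= -(nrmE hdot) sqrtCK.
have Tr : complex.Im (dot (T x) x) = 0.
  have : (dot (T x) x)^* = dot (T x) x by rewrite -(dotC hdot) T_sym.
  by move/CrealP; case: (dot (T x) x) => a c; rewrite complex_real /= => /eqP.
have im : complex.Im (dot (T x - z *: x) x) = - (complex.Im z * N x ^+ 2).
  rewrite (dotBl hdot) (dotZl hdot) xx; move: Tr; case: (dot (T x) x) => a c /= ->.
  by case: (z) => p q /=; rewrite mulr0 add0r add0r.
have : `|complex.Im (dot (T x - z *: x) x)| <= complex.Re `|dot (T x - z *: x) x|.
  rewrite normc_def /= -sqrtr_sqr ler_sqrt ?addr_ge0 ?sqr_ge0 //.
  by rewrite lerDr sqr_ge0.
rewrite im normrN normrM [`|N x ^+ 2|]ger0_norm ?sqr_ge0 // expr2 mulrA => h1.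
apply: le_trans h1 _.
by move: h; rewrite lecE => /andP[_].
Qed.

Lemma sym_inj z x : complex.Im z != 0 -> dom T x -> T x - z *: x = 0 -> x = 0.
Proof.
move=> z0 hx h; have := sym_lower_bound z hx; rewrite h (nrm0 hdot) => h1.
apply: (nrm_eq0 hdot); apply/eqP; rewrite eq_le nrm_ge0 // andbT.
by rewrite -(pmulr_rle0 _ (_ : 0 < `|complex.Im z|)) // normr_gt0.
Qed.

(** K approximately inverts T - (z + i d) as well: the error is - i d K. *)
Lemma resolvent_move z K (d : R) : resolvent_at z K ->
  (forall y, `|d| * N (K y) <= 2^-1 * N y) -> complex.Im (z + Complex 0 d) != 0 ->
  exists K', resolvent_at (z + Complex 0 d) K'.
Proof.
move=> [Kl Kc KE _] hd z0; apply: (resolvent_of_approximate Kl Kc).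
- by move=> y; case: (KE y).
- move=> y; rewrite scalerDl opprD addrA (KE y).2 addrAC subrr add0r.
  by rewrite (nrmN hdot) (nrmZi hdot).
by move=> x; exact: sym_inj.
Qed.

Lemma resolvent_nonreal : (exists z K, resolvent_at z K) ->
  exists z K, complex.Im z != 0 /\ resolvent_at z K.
Proof.
move=> [z [K hK]]; have [z0|z0] := boolP (complex.Im z != 0); first by exists z, K.
have [M M0 hM] : exists2 M : R, 0 < M & forall x, N (K x) <= M * N x.
  by case: (hK) => Kl Kc _ _; exact: (rcompact_bounded hdot hdot Kl Kc).
(* The shift 1/(2 M) is the largest that [resolvent_move] allows when K has norm at most M. *)
have hz : complex.Im (z + Complex 0 (2 * M)^-1) != 0.
  move: z0; case: (z) => a c /=; rewrite negbK => /eqP->.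
  by rewrite add0r gt_eqF // invr_gt0 mulr_gt0.
have [|K' hK'] := resolvent_move (d := (2 * M)^-1) hK _ hz.
  move=> y; rewrite gtr0_norm ?invr_gt0 ?mulr_gt0 //.
  rewrite invfM -mulrA ler_pM2l ?invr_gt0 // mulrC ler_pdivrMr //.
  by rewrite mulrC; exact: hM.
by exists (z + Complex 0 (2 * M)^-1), K'.
Qed.

(** At a nonreal w the resolvent has norm at most 1/|Im w|, so a shift by d = Im w / 2 is allowed.
    It multiplies Im w by 3/2, and the allowed shift grows with it. *)
Lemma resolvent_large (s : R) : (exists z K, resolvent_at z K) ->
  exists z K, s < `|complex.Im z| /\ resolvent_at z K.
Proof.
move=> /resolvent_nonreal [z [K [z0 hK]]].
pose c := `|complex.Im z|; have c0 : 0 < c by rewrite normr_gt0.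
(* The growth is geometric; this linear lower bound is enough for the archimedean property. *)
have : forall m : nat, exists z K, c + m%:R * (c / 2) <= `|complex.Im z| /\ resolvent_at z K.
  elim=> [|m [w [L [hw hL]]]]; first by exists z, K; rewrite mul0r addr0.
  have hc : c <= `|complex.Im w|.
    by apply: le_trans hw; rewrite lerDl mulr_ge0 // divr_ge0 // ltW.
  have w0 : 0 < `|complex.Im w| by exact: lt_le_trans hc.
  pose d := complex.Im w / 2.
  have im : complex.Im (w + Complex 0 d) = complex.Im w * (3 / 2).
    by rewrite /d; case: (w) => p q /=; field.
  have [y|| L' hL'] := @resolvent_move w L d hL.
  - rewrite /d normrM [`|2^-1|]ger0_norm ?invr_ge0 // mulrAC mulrC ler_pM2l ?invr_gt0 //.
    by case: hL => _ _ /(_ y) [h1 h2] _; rewrite -{2}h2; exact: sym_lower_bound.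
  - by rewrite im mulf_neq0 -?normr_gt0 // gtr0_norm; lra.
  exists (w + Complex 0 d), L'; split=> //; rewrite im normrM [`|3 / 2|]ger0_norm; last by lra.
  rewrite -natr1 mulrDl mul1r addrA; lra.
pose m := Num.bound (s / (c / 2)).
case: (pselect (0 <= s)) => [s0|/negP]; last first.
  by rewrite -ltNge => s0 _; exists z, K; split=> //; exact: lt_trans c0.
move=> /(_ m) [w [L [hw hL]]]; exists w, L; split=> //; apply: lt_le_trans hw.
have : s / (c / 2) < m%:R by apply: archi_boundP; rewrite divr_ge0 // divr_ge0 // ltW.
by rewrite ltr_pdivrMr ?divr_gt0 // => h; lra.
Qed.

(* U is the Cayley transform.  Along a subsequence (U - 1) U^m y is Cauchy, by
   compactness of U - 1; as U is isometric and commutes with U - 1, this puts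
   (U - 1) y, hence y = U y - (U - 1) y, into the closed range of U. *)
Lemma isometry_surjective (U : V -> V) : linear U -> (forall x, N (U x) = N x) ->
  rcompact dot dot (fun x => U x - x) -> forall y, exists x, U x = y.
Proof.
move=> Ul Uiso Uc y.
have itl m : linear (iter m U) by elim: m => [|m IH] // k a c; rewrite !iterS IH Ul.
have itN m x : N (iter m U x) = N x by elim: m => //= m; rewrite Uiso.
have [|s [l [hs hl]]] := Uc (fun m => iter m U y); first by exists (N y) => m; rewrite itN.
have close : forall m : nat, exists w, N (U w - (U y - y)) < m.+1%:R^-1.
  move=> m; have e0 : 0 < m.+1%:R^-1 / 2 :> R by rewrite divr_gt0 // invr_gt0.
  have [p hp] := hl _ e0; have h1 := hp p (leqnn _); have h2 := hp p.+1 (leqnSn _).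
  have [k hk] : exists k, s p.+1 = (s p + k.+1)%N.
    by exists (s p.+1 - s p).-1; have := hs p; move: (s p) (s p.+1) => a c h; rewrite prednK ?subn_gt0 // subnKC // ltnW.
  exists (iter k U (U y - y)).
  have sh q : U (iter q U y) - iter q U y = iter q U (U y - y).
    by rewrite (linB (itl q)) -iterSr.
  rewrite sh in h1; rewrite sh hk iterD in h2.
  rewrite -[U (iter k U _)]/(iter k.+1 U (U y - y)) -(itN (s p)) (linB (itl _)).
  apply: le_lt_trans (nrm_tri hdot l _ _) _.
  by rewrite [N (l - _)](nrm_dist hdot) [ltRHS]splitr ltrD.
have [w hw] := choice close.
have wc : rcauchy dot w.
  move=> eps e0; have [M hM] := inv_small (divr_gt0 e0 (ltr0n R 2)).
  exists M => m p /hM hm /hM hp; rewrite -Uiso (linB Ul).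
  apply: le_lt_trans (nrm_tri hdot (U y - y) _ _) _.
  rewrite [N (U y - y - _)](nrm_dist hdot) [ltRHS]splitr.
  by apply: ltrD; [exact: lt_trans (hw m) hm|exact: lt_trans (hw p) hp].
have [x hx] := complete hV wc; exists (y - x).
have Ux : U x = U y - y.
  apply/eqP; rewrite -subr_eq0; apply/eqP/(nrm_eps hdot) => eps e0.
  have [M hM] := inv_small (divr_gt0 e0 (ltr0n R 2)).
  have [M' hM'] := hx _ (divr_gt0 e0 (ltr0n R 2)).
  pose m := maxn M M'; have h1 := hM m (leq_maxl _ _); have h2 := hM' m (leq_maxr _ _).
  apply: le_lt_trans (nrm_tri hdot (U (w m)) _ _) _.
  rewrite -(linB Ul) Uiso (nrm_dist hdot) [ltRHS]splitr.
  by apply: ltrD => //; exact: lt_trans (hw m) h1.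
by rewrite (linB Ul) Ux opprB addrCA subrr addr0.
Qed.

Lemma self_adjoint_of_resolvent : densely_defined dot T ->
  (exists z K, complex.Im z != 0 /\ resolvent_at z K) -> self_adjoint dot T.
Proof.
move=> hd [z [K [z0 [Kl Kc KE KE']]]]; split=> // x y; split; last first.
  by move=> [hx ->] u hu; exact: T_sym.
(* By [UE] this is the Cayley transform (T - z^* ) (T - z)^-1, written so that U - 1 is visibly a
   multiple of the compact K. *)
move=> h; pose U y := y + (z - z^*) *: K y.
have UE w : U w = T (K w) - z^* *: K w.
  by rewrite /U -{1}[w](KE w).2 scalerBl addrA subrK.
have Ul : linear U.
  apply: linear_add => // k a c.
  by rewrite Kl scalerDr !scalerA [_ * k]mulrC.
have Uiso w : N (U w) = N w.
  rewrite -{2}[w](KE w).2 UE; have hw := (KE w).1; set v := K w in hw *.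
  rewrite /nrm /hnorm; congr (complex.Re (sqrtC _)).
  rewrite !(dotBl hdot) !(dotBr hdot) !(dotZl hdot) !(dotZr hdot) conjCK.
  rewrite (T_sym hw hw); set a := dot _ (T v); set q := dot v v.
  by rewrite !opprB !addrA; ring.
have Uc : rcompact dot dot (fun x => U x - x).
  rewrite (_ : (fun x => U x - x) = fun x => (z - z^*) *: K x); last first.
    by apply/funext => w; rewrite /U addrC addKr.
  apply: (@rcompact_compl _ _ _ _ dot dot dot hdot (fun x => (z - z^*) *: x) K
    (complex.Re `|z - z^*|)) => // [k a c|w|].
  - by rewrite scalerDr !scalerA mulrC.
  - by rewrite (nrmZ hdot) lexx.
  - by rewrite -ler0c RRe_real // ger0_real.
(* Here y plays the role of T^* x. The vector x' = K (y - z x) solves (T - z) x' = y - z x, so x and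
   x' have the same product with every vector in the range of T - z^*, in particular with U w.
   Choosing U w = x - x' yields x = x'. *)
have [w hw] := isometry_surjective Ul Uiso Uc (x - K (y - z *: x)).
set x' := K (y - z *: x) in hw.
have [hx' ex'] := KE (y - z *: x); rewrite -/x' in hx' ex'.
have [hu _] := KE w; set u := K w in hu.
have e1 : dot (U w) x = dot (U w) x'.
  rewrite UE -/u !(dotBl hdot) !(dotZl hdot) h // (T_sym hu hx').
  have -> : T x' = y - z *: x + z *: x' by rewrite -ex' subrK.
  rewrite (dotDr hdot) (dotBr hdot) !(dotZr hdot); ring.
have : x - x' = 0.
  by apply: (dot_eq0 hdot); rewrite -{1}hw (dotBr hdot) e1 subrr.
move/eqP; rewrite subr_eq0 => /eqP ex; rewrite -ex in hx' ex'.
split=> //; by move/eqP: ex'; rewrite (inj_eq (addIr _)) => /eqP.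
Qed.
End Resolvent.

(** * Maps bounded on a domain *)

Section BoundedOn.
Variable R : realType.

(** The predicate [P] is usually the domain of an unbounded operator, the only place where a
    commutator with it is meaningful. *)
Definition bdd_on (U V : lmodType R[i]) (dU : U -> U -> R[i]) (dV : V -> V -> R[i])
    (P : U -> Prop) (f : U -> V) : Prop :=
  exists2 M : R, 0 <= M & forall x, P x -> nrm dV (f x) <= M * nrm dU x.

Variables (U V W : lmodType R[i]) (dU : U -> U -> R[i]) (dV : V -> V -> R[i]).
Variable dW : W -> W -> R[i].
Hypothesis hU : exists f : {dot U for Num.conj}, forall x y, dU x y = f x y.
Hypothesis hdV : exists f : {dot V for Num.conj}, forall x y, dV x y = f x y.
Variable P : U -> Prop.

Lemma bdd_onD (f g : U -> V) : bdd_on dU dV P f -> bdd_on dU dV P g ->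
  bdd_on dU dV P (fun x => f x + g x).
Proof.
move=> [M M0 hM] [K K0 hK]; exists (M + K); first exact: addr_ge0.
move=> x hx; apply: le_trans (nrmD hdV _ _) _; rewrite mulrDl.
by apply: lerD; [exact: hM|exact: hK].
Qed.
Lemma bdd_onN (f : U -> V) : bdd_on dU dV P f -> bdd_on dU dV P (fun x => - f x).
Proof. by move=> [M M0 hM]; exists M => // x hx; rewrite nrmN //; exact: hM. Qed.
Lemma bdd_onB (f g : U -> V) : bdd_on dU dV P f -> bdd_on dU dV P g ->
  bdd_on dU dV P (fun x => f x - g x).
Proof. by move=> hf /bdd_onN; exact: bdd_onD. Qed.
Lemma bdd_on_sum (I : Type) (r : seq I) (f : I -> U -> V) :
  (forall i, bdd_on dU dV P (f i)) -> bdd_on dU dV P (fun x => \sum_(i <- r) f i x).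
Proof.
move=> h; elim: r => [|i r [M M0 hM]].
  by exists 0 => // x _; rewrite big_nil (nrm0 hdV) mul0r.
have [K K0 hK] := h i; exists (K + M); first exact: addr_ge0.
move=> x hx; rewrite big_cons; apply: le_trans (nrmD hdV _ _) _; rewrite mulrDl.
by apply: lerD; [exact: hK|exact: hM].
Qed.
Lemma bdd_on_ext (f g : U -> V) : (forall x, P x -> f x = g x) ->
  bdd_on dU dV P f -> bdd_on dU dV P g.
Proof. by move=> h [M M0 hM]; exists M => // x hx; rewrite -h //; exact: hM. Qed.
Lemma bdd_on_comp (Q : V -> Prop) (f : V -> W) (g : U -> V) :
  bdd_on dV dW Q f -> bdd_on dU dV P g -> (forall x, P x -> Q (g x)) ->
  bdd_on dU dW P (fun x => f (g x)).
Proof.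
move=> [M M0 hM] [K K0 hK] h; exists (M * K); first exact: mulr_ge0.
move=> x hx; apply: le_trans (hM _ (h _ hx)) _; rewrite -mulrA.
by rewrite ler_wpM2l // hK.
Qed.

Lemma bdd_onP (f : U -> V) : bdd_on dU dV P f <->
  exists M : R[i], forall x, P x -> hnorm dV (f x) <= M * hnorm dU x.
Proof.
split=> [[M M0 hM]|[M hM]].
  exists (real_complex R M) => x hx.
  by rewrite (nrmE hdV) (nrmE hU) -rmorphM lecR; exact: hM.
exists `|complex.Re M| => // x /hM; rewrite [X in _ * X](nrmE hU) => /nrm_bound h.
by apply: le_trans h _; rewrite ler_wpM2r ?nrm_ge0 // ler_norm.
Qed.
End BoundedOn.

(** * Transport of analytic properties through a finite frame *)

Section Frame.
Variables (R : realType) (U V : lmodType R[i]).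
Variables (dU : U -> U -> R[i]) (dV : V -> V -> R[i]).
Hypothesis hU : hilbert dU.
Hypothesis hdV : exists f : {dot V for Num.conj}, forall x y, dV x y = f x y.
Let hdU := hU.1.
Variables (I : finType) (ep : I -> V -> U) (mp : I -> U -> V).
Hypotheses (ep_linear : forall p, linear (ep p)) (mp_linear : forall p, linear (mp p)).
Hypothesis epK : forall x, \sum_p mp p (ep p x) = x.
Hypothesis ep_le : forall p x, nrm dU (ep p x) <= nrm dV x.
Hypothesis mp_bdd : forall p, bdd_on dU dV (fun=> True) (mp p).

Lemma mp_bound : exists2 M : I -> R, (forall p, 0 <= M p) &
  forall p y, nrm dV (mp p y) <= M p * nrm dU y.
Proof.
have h p : exists M : R, 0 <= M /\ forall y, nrm dV (mp p y) <= M * nrm dU y.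
  by have [M M0 hM] := mp_bdd p; exists M; split=> // y; exact: hM.
by have [M hM] := choice h; exists M => p; case: (hM p).
Qed.

Lemma frame_bdd (P : V -> Prop) (Q : U -> Prop) (W : lmodType R[i])
    (dW : W -> W -> R[i]) (f : V -> W) (g : I -> U -> W) :
  (exists f : {dot W for Num.conj}, forall x y, dW x y = f x y) ->
  (forall x, P x -> f x = \sum_p g p (ep p x)) ->
  (forall p x, P x -> Q (ep p x)) -> (forall p, bdd_on dU dW Q (g p)) ->
  bdd_on dV dW P f.
Proof.
move=> hW fE hPQ hg; apply: (bdd_on_ext (f := fun x => \sum_p g p (ep p x))).
  by move=> x /fE.
apply: bdd_on_sum => // p; apply: bdd_on_comp (hg p) _ (hPQ p).
by exists 1 => // x _; rewrite mul1r.
Qed.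

Lemma frame_hilbert : hilbert dV.
Proof.
split=> // u /(rcauchyP hdV) hu.
have h p : exists l, rcvg dU (fun m => ep p (u m)) l.
  apply: (complete hU) => eps /hu [N hN]; exists N => m k hm hk.
  by rewrite -(linB (ep_linear p)); apply: le_lt_trans (ep_le _ _) _; exact: hN.
have [l hl] := choice h; have [M M0 hM] := mp_bound.
exists (\sum_p mp p (l p)); apply/(rcvgP hdV) => eps e0.
(* The summand 1 keeps S positive even if all the bounds vanish. *)
pose S := \sum_p M p + 1.
have S0 : 0 < S by rewrite ltr_wpDl // sumr_ge0.
have h2 p : exists N : nat, forall m, (N <= m)%N -> nrm dU (ep p (u m) - l p) < eps / S.
  exact: hl p _ (divr_gt0 e0 S0).
have [N hN] := choice h2; exists (\max_p N p)%N => m hm.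
rewrite -[u m]epK -sumrB; apply: le_lt_trans (nrm_sum hdV _ _) _.
apply: (@le_lt_trans _ _ (\sum_p M p * (eps / S))).
  apply: ler_sum => p _; rewrite -(linB (mp_linear p)); apply: le_trans (hM _ _) _.
  rewrite ler_wpM2l // ltW // hN //; apply: leq_trans hm; exact: leq_bigmax.
rewrite -mulr_suml mulrCA gtr_pMr // ltr_pdivrMr // mul1r.
by rewrite ltrDl.
Qed.

Lemma frame_dense (D : operator U) (T : operator V) : linear_operator T ->
  (forall p y, dom D y -> dom T (mp p y)) ->
  densely_defined dU D -> densely_defined dV T.
Proof.
move=> hT hmp hD x eps /pos_complex [e0 ->]; have [M M0 hM] := mp_bound.
pose S := \sum_p M p + 1.
have S0 : 0 < S by rewrite ltr_wpDl // sumr_ge0.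
have h p : exists y, dom D y /\ nrm dU (ep p x - y) < complex.Re eps / S.
  have [|y hy] := hD (ep p x) (real_complex R (complex.Re eps / S)).
    by rewrite (ltcR 0) divr_gt0.
  by rewrite (nrmE hdU) ltcR => h; exists y.
have [y hy] := choice h; exists (\sum_p mp p (y p)).
  by apply: dom_sum => // p; apply: hmp; case: (hy p).
rewrite (nrmE hdV) ltcR -{1}[x]epK -sumrB; apply: le_lt_trans (nrm_sum hdV _ _) _.
apply: (@le_lt_trans _ _ (\sum_p M p * (complex.Re eps / S))).
  apply: ler_sum => p _; rewrite -(linB (mp_linear p)); apply: le_trans (hM _ _) _.
  by rewrite ler_wpM2l // ltW //; case: (hy p).
rewrite -mulr_suml mulrCA gtr_pMr // ltr_pdivrMr // mul1r.
by rewrite ltrDl.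
Qed.

(** T is compared with D in both directions: through [mp] by hypothesis, and through [ep] by
    combining this with the commutators of D with [ep p] after [mp q]. The first comparison gives an
    approximate inverse, the second injectivity. *)
Lemma frame_resolvent (D : operator U) (T : operator V) :
  linear_operator D -> linear_operator T ->
  (forall x y, dom D x -> dom D y -> dU (D x) y = dU x (D y)) ->
  (exists z K, resolvent_at dU D z K) ->
  (forall p y, dom D y -> dom T (mp p y)) -> (forall p x, dom T x -> dom D (ep p x)) ->
  (forall p, bdd_on dU dV (dom D) (fun y => T (mp p y) - mp p (D y))) ->
  (forall p q, bdd_on dU dU (dom D) (commutator D (fun y => ep p (mp q y)))) ->
  exists z K, complex.Im z != 0 /\ resolvent_at dV T z K.
Proof.
move=> hD hT D_sym hres hmp hep hP hC.
have hV := frame_hilbert.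
have [M M0 hM] := mp_bound.
have [P P0 hPb] : exists2 P : I -> R, (forall p, 0 <= P p) &
    forall p y, dom D y -> nrm dV (T (mp p y) - mp p (D y)) <= P p * nrm dU y.
  have h p : exists B : R, 0 <= B /\ forall y, dom D y ->
      nrm dV (T (mp p y) - mp p (D y)) <= B * nrm dU y.
    by have [B B0 hB] := hP p; exists B.
  by have [B hB] := choice h; exists B => p; case: (hB p).
(* Inserting the identity as a sum of [mp q] after [ep q] splits this into the defect of T on [mp q]
   and a commutator with D. *)
have hQ p : bdd_on dV dU (dom T) (fun x => ep p (T x) - D (ep p x)).
  apply: (frame_bdd (Q := dom D) (g := fun q y => ep p (T (mp q y) - mp q (D y))
    - commutator D (fun y => ep p (mp q y)) y)) => // [x hx|q].
    have xE : T x = \sum_q T (mp q (ep q x)).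
      rewrite -{1}[x]epK; apply: (op_sum hT) => q; exact/hmp/hep.
    have yE : D (ep p x) = \sum_q D (ep p (mp q (ep q x))).
      rewrite -{1}[x]epK (lin_sum (ep_linear p)); apply: (op_sum hD) => q.
      exact/hep/hmp/hep.
    rewrite xE yE (lin_sum (ep_linear p)) -sumrB; apply: eq_bigr => q _.
    by rewrite /commutator (linB (ep_linear p)) opprB addrA subrK.
  apply: bdd_onB => //; apply: (bdd_on_comp (Q := fun=> True) _ (hP q)) => //.
  by exists 1 => // x _; rewrite mul1r.
have [Q Q0 hQb] : exists2 Q : I -> R, (forall p, 0 <= Q p) &
    forall p x, dom T x -> nrm dU (ep p (T x) - D (ep p x)) <= Q p * nrm dV x.
  have h p : exists B : R, 0 <= B /\ forall x, dom T x ->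
      nrm dU (ep p (T x) - D (ep p x)) <= B * nrm dV x.
    by have [B B0 hB] := hQ p; exists B.
  by have [B hB] := choice h; exists B => p; case: (hB p).
(* The term with P makes the error of the approximate inverse at most 1/2, the term with M and Q
   makes T - z injective, and the 1 makes the imaginary part nonzero. *)
have [z [K [hz hK]]] := resolvent_large hU hD D_sym
  (1 + 2 * (\sum_p P p) + \sum_p M p * Q p) hres.
set s := `|complex.Im z| in hz.
have sP : 0 <= \sum_p P p by exact: sumr_ge0.
have sQ : 0 <= \sum_p M p * Q p by apply: sumr_ge0 => p _; exact: mulr_ge0.
have s0 : 0 < s by lra.
have [Kl Kc KE _] := hK.
have Kb y : nrm dU (K y) <= s^-1 * nrm dU y.
  rewrite mulrC ler_pdivlMr // mulrC -{2}[y](KE y).2.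
  by apply: (sym_lower_bound hU D_sym); case: (KE y).
(* The compressed resolvent: (T - z) K0 - 1 is the sum of the defects of T on [mp p], each applied
   after K and hence damped by 1/s. *)
pose K0 y := \sum_p mp p (K (ep p y)).
have K0l : linear K0.
  move=> k x y; rewrite /K0 scaler_sumr -big_split /=; apply: eq_bigr => p _.
  by rewrite ep_linear Kl mp_linear.
have dmp p y : dom T (mp p (K (ep p y))) by apply: hmp; case: (KE (ep p y)).
have [|y|y|x hx hxz|K' hK'] := @resolvent_of_approximate _ V dV hV T hT z K0 K0l.
- apply: rcompact_sum => // p.
  have ep1 : forall x, nrm dU (ep p x) <= 1 * nrm dV x by move=> x; rewrite mul1r.
  have h1 := rcompact_compr ep1 ler01 Kc.
  exact: (rcompact_compl hdU (mp_linear p) (hM p) (M0 p) h1).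
- by apply: dom_sum.
- rewrite /K0 (op_sum hT) // scaler_sumr -sumrB -[X in nrm dV (_ - X)]epK -sumrB.
  apply: le_trans (nrm_sum hdV _ _) _.
  apply: (@le_trans _ _ (\sum_p P p * (s^-1 * nrm dV y))).
    apply: ler_sum => p _; have [hd he] := KE (ep p y).
    have -> : T (mp p (K (ep p y))) - z *: mp p (K (ep p y)) - mp p (ep p y) =
        T (mp p (K (ep p y))) - mp p (D (K (ep p y))).
      have -> : mp p (ep p y) = mp p (D (K (ep p y))) - z *: mp p (K (ep p y)).
        by rewrite -(linZ (mp_linear p)) -(linB (mp_linear p)) he.
      by rewrite opprB addrA subrK.
    apply: le_trans (hPb p _ hd) _; rewrite ler_wpM2l //.
    apply: le_trans (Kb _) _; rewrite ler_wpM2l //.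
    by rewrite invr_ge0 ltW.
  rewrite -mulr_suml mulrA ler_wpM2r ?nrm_ge0 // ler_pdivrMr //; lra.
(* If T x = z x, then (D - z) ([ep p] x) is, up to sign, the bounded defect at x, while D - z is
   bounded below by s. Summing over the frame gives s N x <= (sum of M p Q p) N x, impossible unless
   x = 0. *)
- have xb p : s * nrm dU (ep p x) <= Q p * nrm dV x.
    apply: le_trans (hQb p x hx); rewrite (nrm_dist hdU).
    have -> : ep p (T x) = z *: ep p x.
      rewrite -(linZ (ep_linear p)); congr (ep p); apply/eqP.
      by rewrite -subr_eq0 hxz.
    exact: (sym_lower_bound hU D_sym z (hep p x hx)).
  have : s * nrm dV x <= (\sum_p M p * Q p) * nrm dV x.
    rewrite -{1}[x]epK mulr_suml.
    apply: (@le_trans _ _ (s * \sum_p nrm dV (mp p (ep p x)))).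
      by rewrite ler_pM2l //; exact: nrm_sum.
    rewrite mulr_sumr; apply: ler_sum => p _.
    apply: (@le_trans _ _ (s * (M p * nrm dU (ep p x)))); first by rewrite ler_pM2l.
    by rewrite mulrCA -mulrA ler_wpM2l.
  move=> h; apply: (nrm_eq0 hdV); apply/eqP; rewrite eq_le nrm_ge0 // andbT leNgt.
  apply/negP => hn; move: h; rewrite ler_pM2r // => h; lra.
- by exists z, K'; split=> //; rewrite -normr_gt0.
Qed.
End Frame.

(** * The twisted triple: analysis *)

Section DotForm.
Variables (C : numClosedFieldType) (V : lmodType C) (d : V -> V -> C).
Hypothesis d_linear : forall k x y z, d (k *: x + y) z = k * d x z + d y z.
Hypothesis d_herm : forall x y, d x y = (d y x)^*.
Hypothesis d_pos : forall x, x != 0 -> 0 < d x x.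

Let d_bilinear : bilinear_for *%R (Num.conj \; *%R) d.
Proof.
split=> [z k x y|z k x y]; first exact: d_linear.
by rewrite /= d_herm d_linear rmorphD rmorphM /= -!d_herm.
Qed.
HB.instance Definition _ := bilinear_isBilinear.Build C V V C _ _ d d_bilinear.
Let d_hermitian x y : d x y = (-1) ^+ false * (d y x)^*.
Proof. by rewrite expr0 mul1r. Qed.
HB.instance Definition _ := isHermitianSesquilinear.Build C V false Num.conj d d_hermitian.
HB.instance Definition _ := isDotProduct.Build C V d d_pos.

(** [hilbert] asks for a bundled inner product, whereas [dot3] is a bare function; the local
    instances bundle it. *)
Lemma dot_form_build : exists f : {dot V for Num.conj}, forall x y, d x y = f x y.
Proof. by exists (d : {dot V for Num.conj}). Qed.
End DotForm.

(** * The axioms for the twisted triple *)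

Section TripleAnalysis.
Variables (R : realType) (A : pzAlgType R[i]) (star : A -> A).
Variables (H : lmodType R[i]) (dot : H -> H -> R[i]) (act : A -> H -> H).
Variables (D : operator H) (J : H -> H).
Hypothesis HD : real_spectral_triple star dot act D J.
Variables (E : rightModule A) (n : nat) (e : 'M[A]_n) (phi : E -> 'cV[A]_n).
Hypotheses (he : e *m e = e) (hphi : iso_onto_eAn e phi).
Variable b : 'I_n -> E.
Hypothesis hb : forall i j, phi (b j) i 0 = e i j.
Hypothesis hes : forall i j, star (e i j) = e j i.
Variables (nabla : E -> connection_target E).
Variables (D1 : operator (EH act E)) (D' : operator (EHE star act J E)).
Hypotheses (hD1 : is_one_tensor nabla D D1) (hD' : is_tensor_one nabla D1 D').

Local Notation oact := (opp_act star act J).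
Local Notation EHE := (@EHE R[i] A star H act J E).
Local Notation mk3 := (@mk3 R[i] A star H act J E).
Local Notation entry := (@entry R[i] A star H act J E n phi).
Local Notation dot3 := (@dot3 R[i] A star H dot act J E n phi).
Local Notation eact := (@end_act R[i] A star H act J E).
Let hdot := dot_form HD.

Lemma act_bdd a : bdd_on dot dot (fun=> True) (act a).
Proof.
apply/(bdd_onP hdot hdot); case: HD => -[[_ _ [/(_ a) [_ [M hM]] _ _ _ _] _] _] _.
by exists M => x _.
Qed.
Lemma nrm_J x : nrm dot (J x) = nrm dot x.
Proof. by rewrite /nrm (J_norm HD). Qed.
Lemma nrm_invJ x : nrm dot (inverse J x) = nrm dot x.
Proof. by rewrite -nrm_J (JVK HD). Qed.
Lemma oact_bdd a : bdd_on dot dot (fun=> True) (oact^~ a).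
Proof.
have [M M0 hM] := act_bdd (star a); exists M => // x _.
by rewrite /opp_act nrm_J -[nrm dot x]nrm_invJ; exact: hM.
Qed.
Lemma commutator_bdd a : bdd_on dot dot (dom D) (commutator D (act a)).
Proof.
apply/(bdd_onP hdot hdot); case: HD => -[_ [_ /(_ a) [_ [M hM]] _]] _.
by exists M.
Qed.
Lemma commutator_oact_bdd a : bdd_on dot dot (dom D) (commutator D (oact^~ a)).
Proof.
have [s hs] := J_D HD; have [M M0 hM] := commutator_bdd (star a).
exists M => // x hx; have hy : dom D (inverse J x) by exact/(dom_invJ HD).
have := commutator_J_oact HD hs (star a) hy.
rewrite (starK (star_involution HD)) (JVK HD) => ->.
rewrite nrmZ // normrX normrN1 expr1n mul1r nrm_J -[nrm dot x]nrm_invJ.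
exact: hM.
Qed.
Lemma commutator2_bdd a c :
  bdd_on dot dot (dom D) (commutator (commutator D (act a)) (oact^~ c)).
Proof.
apply: bdd_onB => //.
  apply: (bdd_on_comp (Q := dom D) (commutator_bdd a) (g := oact^~ c)).
    by have [M M0 hM] := oact_bdd c; exists M => // x _; exact: hM.
  by move=> x; exact: (D_oact HD).
by apply: (bdd_on_comp (oact_bdd c) (commutator_bdd a)).
Qed.

Lemma dot3_form : exists f : {dot EHE for Num.conj}, forall x y, dot3 x y = f x y.
Proof.
apply: dot_form_build => [k x y z|x y|x x0].
- by rewrite (dot3Dl HD hphi) (dot3Zl HD hphi).
- exact: (dot3C HD).
- rewrite lt_def (dot3_ge0 HD) andbT; apply: contra_neq x0.
  exact: (dot3_eq0 HD he hphi hb).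
Qed.
Let hdot3 := dot3_form.

Lemma nrm_sqr (V : lmodType R[i]) (d : V -> V -> R[i]) x :
  (exists f : {dot V for Num.conj}, forall x y, d x y = f x y) ->
  d x x = real_complex R (nrm d x ^+ 2).
Proof. by move=> hd; rewrite rmorphXn /= -(nrmE hd) sqrtCK. Qed.

Lemma nrm3_sqr x : nrm dot3 x ^+ 2 = \sum_i \sum_j nrm dot (entry i j x) ^+ 2.
Proof.
apply: complexI; rewrite -(nrm_sqr x hdot3) rmorph_sum; apply: eq_bigr => i _.
by rewrite rmorph_sum; apply: eq_bigr => j _; rewrite (nrm_sqr _ hdot).
Qed.

Lemma entry_le i j x : nrm dot (entry i j x) <= nrm dot3 x.
Proof.
rewrite -ler_sqr ?nnegrE ?nrm_ge0 // nrm3_sqr (bigD1 i) //= (bigD1 j) //= -addrA.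
rewrite lerDl addr_ge0 // sumr_ge0 // => k _; first exact: sqr_ge0.
by rewrite sumr_ge0 // => l _; exact: sqr_ge0.
Qed.

Lemma mk3_bdd v w : bdd_on dot dot3 (fun=> True) (fun y => mk3 v y w).
Proof.
have h (p : 'I_n * 'I_n) : exists M : R, 0 <= M /\
    forall y, nrm dot (entry p.1 p.2 (mk3 v y w)) <= M * nrm dot y.
  have [M M0 hM] := bdd_on_comp (act_bdd (phi v p.1 0)) (oact_bdd (star (phi w p.2 0)))
    (fun _ _ => I).
  by exists M; split=> // y; rewrite (entryE HD hphi); exact: hM.
have [M hM] := choice h.
pose S := \sum_i \sum_j M (i, j) ^+ 2.
have S0 : 0 <= S by apply: sumr_ge0 => i _; apply: sumr_ge0 => j _; exact: sqr_ge0.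
(* The sharp constant from this estimate would be the square root of S; S + 1 dominates it. *)
exists (S + 1) => [|y _]; first exact: addr_ge0.
have SS : S <= (S + 1) ^+ 2 by rewrite sqrrD; have := sqr_ge0 S; lra.
rewrite -ler_sqr ?nnegrE ?mulr_ge0 ?nrm_ge0 ?addr_ge0 // exprMn nrm3_sqr.
apply: (@le_trans _ _ (S * nrm dot y ^+ 2)); last by rewrite ler_wpM2r ?sqr_ge0.
rewrite /S mulr_suml; apply: ler_sum => i _; rewrite mulr_suml.
apply: ler_sum => j _; rewrite -exprMn ler_sqr ?nnegrE ?mulr_ge0 ?nrm_ge0 //.
  by case: (hM (i, j)) => _; exact.
by case: (hM (i, j)).
Qed.

Lemma D'_mk3_bdd v w :
  bdd_on dot dot3 (dom D) (fun y => D' (mk3 v y w) - mk3 v (D y) w).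
Proof.
have [s hs] := connection_sumP (nabla v); have [t ht] := connection_sumP (nabla w).
have mk u u' (g : H -> H) : bdd_on dot dot (dom D) g ->
    bdd_on dot dot3 (dom D) (fun y => mk3 u (g y) u').
  by move=> hg; apply: (bdd_on_comp (mk3_bdd u u') hg).
have ac a (g : H -> H) : bdd_on dot dot (dom D) g ->
    bdd_on dot dot (dom D) (fun y => act a (g y)).
  by move=> hg; apply: (bdd_on_comp (act_bdd a) hg).
have oc a (g : H -> H) : bdd_on dot dot (dom D) g ->
    bdd_on dot dot (dom D) (fun y => oact (g y) a).
  by move=> hg; apply: (bdd_on_comp (oact_bdd a) hg).
(* These are the twisted terms without [mk3 v (D y) w], the only one in which D occurs outside a
   commutator. *)
pose F y := \sum_(q <- s) mk3 q.1.1 (act q.1.2 (commutator D (act q.2) y)) w +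
  \sum_(p <- t) (\sum_(q <- s) mk3 q.1.1 (act q.1.2 (oact
         (commutator (commutator D (act q.2)) (oact^~ (star p.2)) y)
         (star p.1.2))) p.1.1
     + mk3 v (oact (commutator D (oact^~ (star p.2)) y) (star p.1.2)) p.1.1).
apply: (bdd_on_ext (f := F)).
  move=> y hy; rewrite (D'_formula HD hD1 hD' hy hs ht) /twisted_terms /F.
  by rewrite [RHS]addrAC addrK.
apply: bdd_onD => //; apply: bdd_on_sum => // p.
  by apply/mk/ac; exact: commutator_bdd.
apply: bdd_onD => //; last by apply/mk/oc; exact: commutator_oact_bdd.
apply: bdd_on_sum => // q; apply/mk/ac/oc; exact: commutator2_bdd.
Qed.

(** Coordinates in M_n(H) and reconstruction from the dual basis: the frame to which the preceding
    results apply. *)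
Let ep (p : 'I_n * 'I_n) := entry p.1 p.2.
Let mp (p : 'I_n * 'I_n) y := mk3 (b p.1) y (b p.2).
Let ep_linear p : linear (ep p).
Proof. exact: (entry_linear HD hphi). Qed.
Let mp_linear p : linear (mp p).
Proof. exact: mk3_linear2. Qed.
Let epK x : \sum_p mp p (ep p x) = x.
Proof. by rewrite -[RHS](entryK HD he hphi hb) pair_big. Qed.
Let ep_le p x : nrm dot (ep p x) <= nrm dot3 x.
Proof. exact: entry_le. Qed.
Let mp_bdd p : bdd_on dot dot3 (fun=> True) (mp p).
Proof. exact: mk3_bdd. Qed.
Let lD' : linear_operator D' := D'_linear hD'.

Lemma dot3_hilbert : hilbert dot3.
Proof. exact: (frame_hilbert (H_hilbert HD) hdot3 ep_linear mp_linear epK ep_le mp_bdd). Qed.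

Let mp_dom p y : dom D y -> dom D' (mp p y).
Proof. exact: (dom_D' hD1 hD'). Qed.
Lemma entry_dom i j x : dom D' x -> dom D (entry i j x).
Proof.
move: x; apply: (dom_D'_ind hD1 hD').
- by rewrite (lin0 (entry_linear HD hphi i j)); exact: (dom0 (D_linear HD)).
- by move=> x y; rewrite (linD (entry_linear HD hphi i j)); exact: (domD (D_linear HD)).
by move=> v y w hy; rewrite (entryE HD hphi); apply/(D_act HD)/(D_oact HD).
Qed.

Lemma D'_dense : densely_defined dot3 D'.
Proof.
exact: (frame_dense (H_hilbert HD) hdot3 mp_linear epK mp_bdd lD' mp_dom (D_dense HD)).
Qed.

Lemma D'_resolvent : exists z K, complex.Im z != 0 /\ resolvent_at dot3 D' z K.
Proof.
have sa : self_adjoint dot D by case: HD.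
apply: (frame_resolvent (H_hilbert HD) hdot3 ep_linear mp_linear epK ep_le mp_bdd
  (D_linear HD) lD') => //.
- by move=> x y; exact: (D_sym sa).
- by apply/(compact_resolventP (H_hilbert HD)); case: HD => -[_ []].
- by move=> p x; exact: entry_dom.
- by move=> p; exact: D'_mk3_bdd.
(* The composite of [mp q] and [ep p] is an entry of pi(e) pi^(e), namely y |-> a y c; its
   commutator with D is [D, a] R_c + a [D, R_c]. *)
move=> p q; pose a := phi (b q.1) p.1 0; pose c := star (phi (b q.2) p.2 0).
have pq y : ep p (mp q y) = act a (oact y c) by exact: (entryE HD hphi).
apply: (bdd_on_ext (f := fun y => commutator D (act a) (oact y c) +
    act a (commutator D (oact^~ c) y))).
  move=> y hy; rewrite /commutator !pq (linB (act_linr HD a)) addrA subrK.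
  by [].
apply: bdd_onD => //; last exact: (bdd_on_comp (act_bdd a) (commutator_oact_bdd c)).
apply: (bdd_on_comp (Q := dom D) (commutator_bdd a) (g := oact^~ c)).
  by have [M M0 hM] := oact_bdd c; exists M => // x _; exact: hM.
by move=> x; exact: (D_oact HD).
Qed.

Lemma end_act_bdd S : bdd_on dot3 dot3 (fun=> True) (eact S).
Proof.
apply: (frame_bdd ep_le (Q := fun=> True)
  (g := fun p y => mk3 (S (b p.1)) y (b p.2))) => //.
  move=> x _; rewrite -{1}[x]epK (lin_sum (end_act_linear HD S)).
  by apply: eq_bigr => p _; rewrite (end_actE HD).
by move=> p; exact: mk3_bdd.
Qed.

Lemma end_act_dom S x : dom D' x -> dom D' (eact S x).
Proof.
move: x; apply: (dom_D'_ind hD1 hD').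
- by rewrite (lin0 (end_act_linear HD S)); exact: (dom0 lD').
- by move=> x y; rewrite (linD (end_act_linear HD S)); exact: (domD lD').
by move=> v y w hy; rewrite (end_actE HD); exact: (dom_D' hD1 hD').
Qed.

(** S leaves the middle factor alone, so the terms containing D y cancel and what remains are
    differences bounded by [D'_mk3_bdd]. *)
Lemma end_act_commutator S : bdd_on dot3 dot3 (dom D') (commutator D' (eact S)).
Proof.
apply: (frame_bdd ep_le (Q := dom D)
  (g := fun p y => (D' (mk3 (S (b p.1)) y (b p.2)) - mk3 (S (b p.1)) (D y) (b p.2))
     - eact S (D' (mp p y) - mp p (D y)))) => //.
- move=> x hx; have hp p : dom D (ep p x) by exact: entry_dom.
  have xE : D' x = \sum_p D' (mp p (ep p x)).
    by rewrite -{1}[x]epK; apply: (op_sum lD') => p; exact: mp_dom.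
  have yE : D' (eact S x) = \sum_p D' (mk3 (S (b p.1)) (ep p x) (b p.2)).
    rewrite -{1}[x]epK (lin_sum (end_act_linear HD S)).
    under eq_bigr => p _ do rewrite (end_actE HD).
    by apply: (op_sum lD') => p; exact: (dom_D' hD1 hD').
  rewrite /commutator xE yE (lin_sum (end_act_linear HD S)) -sumrB.
  apply: eq_bigr => p _; rewrite (linB (end_act_linear HD S)) [eact S (mp p (D _))](end_actE HD).
  by rewrite opprB addrA subrK.
- by move=> p x; exact: entry_dom.
move=> p; apply: bdd_onB => //; first exact: D'_mk3_bdd.
by apply: (bdd_on_comp (end_act_bdd S) (D'_mk3_bdd (b p.1) (b p.2))).
Qed.

Variable J' : EHE -> EHE.
Hypothesis hJ' : is_J' J'.

Lemma J'_real_structure : real_structure (A := endAlg E) dot3 eact D' J'.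
Proof.
have [sJ hJ] := JJ_ex HD; have [sD hsD] := J_D HD.
have VK := J'VK HD hJ'; have KV := VJ'K HD hJ'.
have invE x : inverse J' x = (-1) ^+ sJ *: J' x.
  apply: (J'_inj HD hJ'); rewrite VK (antiZ (J'_anti hJ')) rmorph_sign.
  by rewrite (J'J' hJ' hJ) scalerA -signr_addb addbb scale1r.
have domJ x : dom D' (J' x) <-> dom D' x.
  split=> [/(dom_J' HD hD1 hD' hJ')|]; last exact: (dom_J' HD hD1 hD' hJ').
  rewrite (J'J' hJ' hJ) => /(domZ lD' ((-1) ^+ sJ)).
  by rewrite scalerA -signr_addb addbb scale1r.
split.
- exact: J'_anti.
- split; last exact: (J'_surj HD hJ').
  move=> x; suff hN : nrm dot3 (J' x) = nrm dot3 x by rewrite !(nrmE hdot3) hN.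
  apply/eqP; rewrite -(@eqrXn2 _ 2) ?nrm_ge0 //; apply/eqP; rewrite !nrm3_sqr exchange_big.
  apply: eq_bigr => i _; apply: eq_bigr => j _.
  by rewrite (entry_J' HD hphi hJ') nrm_J.
- by exists sJ; exact: (J'J' hJ' hJ).
- exists sD => x; split; first by rewrite -[X in _ <-> dom D' X]VK domJ.
  move=> hx; have hy : dom D' (inverse J' x) by apply/domJ; rewrite VK.
  have := D'_J' HD hD1 hD' hJ' hsD hy; rewrite VK => ->.
  by rewrite scalerA -signr_addb addbb scale1r.
(* Conjugation by J' moves T to the third tensor factor, while S acts on the first. The sign
   relating J' to its inverse is pulled out of both sides beforehand. *)
move=> S T x; rewrite !invE.
have aZ U : forall k y, eact U (k *: y) = k *: eact U y.
  by move=> k y; exact: (linZ (end_act_linear HD U)).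
rewrite !aZ !(antiZ (J'_anti hJ')) !rmorph_sign aZ; congr (_ *: _).
move: x; apply: EHE_eq => [x y|x y|v y w].
- by rewrite (antiD (J'_anti hJ')) (linD (end_act_linear HD T))
    (antiD (J'_anti hJ')) (linD (end_act_linear HD S)).
- by rewrite (linD (end_act_linear HD S)) (antiD (J'_anti hJ'))
    (linD (end_act_linear HD T)) (antiD (J'_anti hJ')).
by rewrite !(J'E hJ', end_actE HD).
Qed.

Lemma twisted_real_triple_axioms :
  real_triple_axioms (A := endAlg E) (endA_star star phi) dot3 eact D' J'.
Proof.
split; split.
- exact: (endA_involution HD he hphi hb hes).
- exact: dot3_hilbert.
- split.
  + move=> S; split; first exact: (end_act_linear HD (S : endA E)).
    by have /(bdd_onP hdot3 hdot3) [M hM] := end_act_bdd S; exists M => x; exact: hM.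
  + exact: (end_act_linl HD).
  + exact: (end_act1 HD).
  + exact: (end_actM HD).
  + exact: (dot3_end_act HD he hphi hb hes).
- by split; [exact: lD'|exact: D'_dense].
- apply/(compact_resolventP dot3_hilbert).
  by have [z [K [_ hK]]] := D'_resolvent; exists z, K.
- move=> S; split; first by move=> x; exact: end_act_dom.
  by have /(bdd_onP hdot3 hdot3) := end_act_commutator S.
- exact: J'_real_structure.
Qed.

Lemma twisted_self_adjoint : hermitian_connection star phi nabla -> self_adjoint dot3 D'.
Proof.
move=> hh; apply: (self_adjoint_of_resolvent dot3_hilbert lD').
- by move=> x y; exact: (D'_sym HD hphi hD1 hD' hh).
- exact: D'_dense.
- exact: D'_resolvent.
Qed.
End TripleAnalysis.

(** The operators and J' are characterised by relations and not constructed in the statement, so the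
    existence clauses keep the universal part from being vacuous. Self-adjointness is tied to a
    hermitian connection, as a general one may yield an operator that is not symmetric. *)
Theorem proposition1 (R : realType)
    (A : pzAlgType R[i]) (star : A -> A)
    (H : lmodType R[i]) (dot : H -> H -> R[i]) (act : A -> H -> H)
    (D : operator H) (J : H -> H)
    (HD : real_spectral_triple star dot act D J)
    (E : rightModule A) (n : nat) (e : 'M[A]_n) (phi : E -> 'cV[A]_n)
    (he : e *m e = e) (hphi : iso_onto_eAn e phi)
    (nabla : E -> connection_target E) (hnabla : universal_connection nabla) :
  (* all the objects below are well defined *)
  [/\ bijective (@assoc _ A star H act J E),
      exists J', @is_J' _ A star H act J E J' &
      exists (D1 : operator (EH act E)) (D2 : operator (HE star act J E))
             (D' : operator (EHE star act J E))
             (D'' : operator (EHE' star act J E)),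
        [/\ is_one_tensor nabla D D1, is_tensor_one nabla D D2,
            is_tensor_one nabla D1 D' & is_one_tensor nabla D2 D'']] /\
  forall (D1 : operator (EH act E)) (D2 : operator (HE star act J E))
         (D' : operator (EHE star act J E)) (D'' : operator (EHE' star act J E))
         (J' : EHE star act J E -> EHE star act J E),
    is_one_tensor nabla D D1 -> is_tensor_one nabla D D2 ->
    is_tensor_one nabla D1 D' -> is_one_tensor nabla D2 D'' ->
    is_J' J' ->
    same_operator D' D'' /\
    (* E is given the hermitian structure of e A^n, with e a projection *)
    ((forall i j, star (e i j) = e j i) ->
     let rta := real_triple_axioms (A := endAlg E) (endA_star star phi)
                  (dot3 dot phi) (@end_act _ A star H act J E) D' J' in
     let rst := real_spectral_triple (A := endAlg E) (endA_star star phi)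
                  (dot3 dot phi) (@end_act _ A star H act J E) D' J' in
     rta /\ (hermitian_connection star phi nabla -> rst)).
Proof.
have [b hb] := dual_basis_exists he hphi; split.
  split; [exact: (assoc_bij HD)|exact: (J'_exists HD)|].
  exact: (operators_exist HD he hphi hb hnabla).
move=> D1 D2 D' D'' J' h1 h2 h3 h4 hJ'; split.
  exact: (same_operator_twist HD h1 h2 h3 h4).
move=> hes rta rst.
have hrta : rta by exact: (twisted_real_triple_axioms HD he hphi hb hes h1 h3 hJ').
split=> // hh; split=> //.
exact: (twisted_self_adjoint HD he hphi hb h1 h3 hh).
Qed.
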